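(* Let $G$ be a connected reductive group with no non-trivial characters. If $V$ is a stable representation of $G$ for which $V^{\mathrm{sss}}$ is pure of codimension one in $V$, then $V$ is coprincipal. In particular, every pure representation of $G$ is coprincipal.
   Context: Work over an algebraically closed field $K$ of characteristic $0$; representations are finite-dimensional and rational. For a representation $V$ of a reductive group $G$, write $V/G=\operatorname{Spec} K[V]^G$ and let $\pi\colon V\to V/G$ be the quotient map. A vector $v\in V$ is $G$-stable if the orbit $Gv$ is closed and $v$ is not contained in the closure of any other orbit. The set $V^s$ of stable vectors is Zariski open; $V$ is a stable representation if $V^s\neq\varnothing$. The closed set $V^{\mathrm{sss}}=V\setminus V^s$ is the strictly semi-stable locus. A stable representation $V$ of a connected reductive group is pure if $\pi(V^{\mathrm{sss}})$ is pure of codimension one in $V/G$ (vacuously true if $V^{\mathrm{sss}}=\varnothing$). It is coprincipal if it is pure and every irreducible component of $V^{\mathrm{sss}}$ (with its reduced subscheme structure) maps under $\pi$ to a principal divisor of $V/G$. *)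

(* Defs.v *)
From mathcomp Require Import all_boot all_order all_algebra.
From mathcomp Require Import boolp classical_sets.
From mathcomp Require Import mpoly.

Set Implicit Arguments.
Unset Strict Implicit.
Unset Printing Implicit Defensive.

Import GRing.Theory.
Local Open Scope ring_scope.
Local Open Scope classical_set_scope.

(* Zariski topologies are given by their families [cl : set (set T)] of closed
   sets; a subset of [T] carries the induced topology. *)
Section Topology.
Variables (T : Type) (cl : set (set T)).

Definition closure_of (X : set T) : set T :=
  [set x | forall C, cl C -> X `<=` C -> C x].

Definition connected_set (X : set T) : Prop :=
  X !=set0 /\
  forall A B, cl A -> cl B -> X `<=` A `|` B -> X `&` A `&` B = set0 ->
    X `<=` A \/ X `<=` B.

Definition irreducible_set (X : set T) : Prop :=
  X !=set0 /\
  forall A B, cl A -> cl B -> X `<=` A `|` B -> X `<=` A \/ X `<=` B.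

Definition irreducible_component (X C : set T) : Prop :=
  [/\ C `<=` X, irreducible_set C &
      forall D, D `<=` X -> irreducible_set D -> C `<=` D -> D = C].

(* There is a chain Y = Z_0 < Z_1 < ... < Z_k of irreducible closed subsets. *)
Definition codim_ge (Y : set T) (k : nat) : Prop :=
  exists Z : nat -> set T,
    [/\ Z 0%N = Y,
        forall i, (i <= k)%N -> cl (Z i) /\ irreducible_set (Z i) &
        forall i, (i < k)%N -> Z i `<` Z i.+1].

Definition has_codim (Y : set T) (k : nat) : Prop :=
  codim_ge Y k /\ ~ codim_ge Y k.+1.

Definition pure_of_codim (k : nat) (X : set T) : Prop :=
  cl X /\ forall C, irreducible_component X C -> has_codim C k.

End Topology.

Section MatrixGroups.
Variables (K : fieldType) (n : nat).

Definition peval_mx (p : {mpoly K[n * n]}) (g : 'M[K]_n) : K :=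
  p.@[fun i => mxvec g 0 i].

Definition closed_mx : set (set 'M[K]_n) :=
  [set Z | exists S : set {mpoly K[n * n]},
     Z = [set g | forall p, S p -> peval_mx p g = 0]].

(* Closed subgroups of GL_n; GL_n has the topology induced from 'M_n. *)
Definition algebraic_group (G : set 'M[K]_n) : Prop :=
  [/\ exists2 Z, closed_mx Z & G = Z `&` [set g | g \in unitmx],
      G 1%:M,
      forall g h, G g -> G h -> G (g *m h) &
      forall g, G g -> G (invmx g)].

(* K[G] is a quotient of K[GL_n] = K[x_ij, 1/det]. *)
Definition regular_on (G : set 'M[K]_n) (f : 'M[K]_n -> K) : Prop :=
  exists (p : {mpoly K[n * n]}) (k : nat),
    forall g, G g -> f g = peval_mx p g / (\det g) ^+ k.

Definition unipotent (u : 'M[K]_n) : Prop := exists k, (u - 1%:M) ^+ k = 0.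

Definition normal_in (G U : set 'M[K]_n) : Prop :=
  U `<=` G /\ forall g u, G g -> U u -> U (g *m u *m invmx g).

(* The unipotent radical of G, i.e. its largest closed connected normal
   unipotent subgroup, is trivial. *)
Definition reductive (G : set 'M[K]_n) : Prop :=
  forall U : set 'M[K]_n,
    algebraic_group U -> connected_set closed_mx U -> normal_in G U ->
    (forall u, U u -> unipotent u) -> U = [set 1%:M].

Definition character (G : set 'M[K]_n) (chi : 'M[K]_n -> K) : Prop :=
  [/\ forall g, G g -> chi g != 0,
      forall g h, G g -> G h -> chi (g *m h) = chi g * chi h &
      regular_on G chi].

Definition no_nontrivial_characters (G : set 'M[K]_n) : Prop :=
  forall chi, character G chi -> forall g, G g -> chi g = 1.

(* Only the values of [rho] on [G] matter. *)
Definition rational_representation (m : nat) (G : set 'M[K]_n)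
    (rho : 'M[K]_n -> 'M[K]_m) : Prop :=
  [/\ forall g, G g -> rho g \in unitmx,
      forall g h, G g -> G h -> rho (g *m h) = rho g *m rho h &
      forall i j, regular_on G (fun g => rho g i j)].

End MatrixGroups.

Section AffineSpace.
Variables (K : fieldType) (m : nat).

Definition peval (f : {mpoly K[m]}) (v : 'cV[K]_m) : K :=
  f.@[fun i => v i 0].

Definition closed_cV : set (set 'cV[K]_m) :=
  [set Z | exists S : set {mpoly K[m]},
     Z = [set v | forall f, S f -> peval f v = 0]].

Lemma peval1 v : peval 1 v = 1.
Proof. exact: rmorph1. Qed.

End AffineSpace.

(* The variety of closed points of Spec A, where the subring A of R is given by
   its underlying set. *)
Section MaximalSpectrum.
Variables (R : comNzRingType) (A : set R).

Definition ideal_in (I : set R) : Prop :=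
  [/\ I `<=` A, I 0, forall f h, I f -> I h -> I (f + h) &
      forall a f, A a -> I f -> I (a * f)].

Definition maximal_ideal (I : set R) : Prop :=
  [/\ ideal_in I, ~ I 1 &
      forall J, ideal_in J -> ~ J 1 -> I `<=` J -> J = I].

Definition maxspec : Type := {I : set R | maximal_ideal I}.

Definition vanishes_at (f : R) (x : maxspec) : Prop := sval x f.

Definition closed_maxspec : set (set maxspec) :=
  [set Z | exists2 S : set R, S `<=` A &
     Z = [set x | forall f, S f -> vanishes_at f x]].

(* A prime divisor whose ideal, i.e. that of D with its reduced subscheme
   structure, is generated by one element. *)
Definition principal_divisor (D : set maxspec) : Prop :=
  [/\ closed_maxspec D, irreducible_set closed_maxspec D,
      has_codim closed_maxspec D 1 &
      exists2 f, A f &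
        forall h, (A h /\ forall x, D x -> vanishes_at h x) <->
                  (exists2 q, A q & h = q * f)].

End MaximalSpectrum.

Section Representations.
Variables (K : fieldType) (n m : nat).
Variables (G : set 'M[K]_n) (rho : 'M[K]_n -> 'M[K]_m).

Definition orbit_of (v : 'cV[K]_m) : set 'cV[K]_m :=
  [set w | exists2 g, G g & w = rho g *m v].

Definition stable_vectors : set 'cV[K]_m :=
  [set v | closed_cV (orbit_of v) /\
     forall w, closure_of (@closed_cV K m) (orbit_of w) v ->
       orbit_of w = orbit_of v].

Definition sss : set 'cV[K]_m := ~` stable_vectors.

Definition stable_representation : Prop := stable_vectors !=set0.

(* The underlying set of K[V]^G; K is infinite in all uses, so polynomials may
   be compared through their values. *)
Definition invariants : set {mpoly K[m]} :=
  [set f | forall g v, G g -> peval f (rho g *m v) = peval f v].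

Lemma maximal_ideal_at (v : 'cV[K]_m) :
  maximal_ideal invariants [set f | invariants f /\ peval f v = 0].
Proof.
have invD f h : invariants f -> invariants h -> invariants (f + h).
  by move=> If Ih g w Gg; rewrite /peval !mevalD; congr (_ + _);
     [exact: If|exact: Ih].
have invM f h : invariants f -> invariants h -> invariants (f * h).
  by move=> If Ih g w Gg; rewrite /peval !mevalM; congr (_ * _);
     [exact: If|exact: Ih].
have invC c : invariants c%:MP by move=> g w Gg; rewrite /peval !mevalC.
split.
- split=> [f []//| |f h [If f0] [Ih h0]|a f Ia [If f0]].
  + by split; [rewrite -mpolyC0; exact: invC|rewrite /peval meval0].
  + by split; [exact: invD|rewrite /peval mevalD [X in X + _]f0 add0r].
  + by split; [exact: invM|rewrite /peval mevalM [X in _ * X]f0 mulr0].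
- by move=> [_]; rewrite peval1 => /eqP; rewrite oner_eq0.
- move=> J [JA J0 JD JM] J1 mJ; apply/seteqP; split=> // f Jf.
  split; first exact: JA.
  apply: contrapT => /eqP c0; apply: J1; set c := peval f v in c0.
  have Jfc : J (c%:MP - f).
    apply: mJ; split; last by rewrite /peval mevalB mevalC subrr.
    rewrite -mulN1r -mpolyC1 -mpolyCN; apply: invD; first exact: invC.
    by apply: invM; [exact: invC|exact: JA].
  have -> : 1 = (c^-1)%:MP * (c%:MP - f + f).
    by rewrite subrK -mpolyCM mulVf // mpolyC1.
  by apply: JM; [exact: invC|exact: JD].
Qed.

Definition git_quotient : Type := maxspec invariants.

Definition git_pi (v : 'cV[K]_m) : git_quotient :=
  exist _ [set f | invariants f /\ peval f v = 0] (maximal_ideal_at v).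

Definition pure_representation : Prop :=
  stable_representation /\
  pure_of_codim (@closed_maxspec _ invariants) 1 (git_pi @` sss).

Definition coprincipal : Prop :=
  pure_representation /\
  forall Z, irreducible_component (@closed_cV K m) sss Z ->
    principal_divisor (git_pi @` Z).

End Representations.

(* Main.v *)
Require Import Defs.
From mathcomp Require Import all_boot all_order all_algebra.
From mathcomp Require Import boolp classical_sets.
From mathcomp Require Import mpoly.
From HB Require Import structures.
From mathcomp Require Import ring zify.

(** The ring of polynomial functions on the representation is factorial, so an
    irreducible closed set of codimension one is the zero set of a prime [f].
    If it is a component of the set of non-stable vectors, and [F] is a nonzero
    function vanishing on that [G]-stable set, then all translates of [f] divide
    [F]. As [F] has finitely many prime factors and [G] is connected, the
    translates are proportional to [f]; the factor of proportionality is a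
    character, hence trivial, and [f] is invariant ([prime_semi_invariant]). The
    image in the quotient of the zero set of an invariant prime [f] is a closed
    irreducible set of codimension one whose ideal is generated by [f], because
    a quotient of invariants is invariant ([git_hypersurface_principal]). So, if
    the set of non-stable vectors is pure of codimension one, it is the zero set
    of a product of invariant primes, and its image is the union of the
    corresponding principal divisors ([pure_sss_coprincipal]).

    Conversely, prime factors of invariants are invariant. Hence the same
    factorization argument, made in the quotient, shows that a pure image of
    codimension one is cut out by a product of invariant primes. The same
    equation cuts out the set of non-stable vectors, which is the full preimage
    of its image ([stable_saturated]), and the second claim follows from the
    first ([pure_representation_sss]).

    The properties of the quotient used here are that every maximal ideal of the
    invariants comes from a vector and that invariants separate disjoint closed
    [G]-stable sets. Both come from the Nullstellensatz by averaging a relation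
    with a Reynolds operator ([reynolds_operator]), that is, from the linear
    reductivity of [G] ([reynolds]).

    Reductivity means that the unipotent radical is trivial, so linear
    reductivity is a theorem of characteristic 0. It is proved by induction on
    the dimension of the representation. A subspace of the Lie algebra that is
    stable under conjugation and consists of nilpotent matrices integrates to a
    normal unipotent subgroup, so it is 0 ([lie_nilpotent_eq0]). By a form of
    Cartan's criterion ([replica_trace_eq0]), the Lie algebra is then the direct
    sum of the radical of the trace form of the representation and of its
    orthogonal for the trace form of matrices. The Casimir operator of this
    orthogonal is a combination of group elements with coefficients of sum 0.
    The projection onto its generalized kernel is a polynomial in it with
    constant term 1, hence a combination with coefficients of sum 1. The
    induction hypothesis applies to this kernel, unless it is everything; then
    the orthogonal is 0, the differential of the representation vanishes, and
    the representation is trivial by Krull's intersection theorem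
    ([rep_constant]). *)

Set Implicit Arguments.
Unset Strict Implicit.
Unset Printing Implicit Defensive.

Import GRing.Theory.
Local Open Scope ring_scope.

(** * Ideals and divisibility *)

Lemma exists_minimal (T : Type) (P : T -> Prop) (size : T -> nat) :
  (exists x, P x) -> exists x, P x /\ forall y, P y -> (size x <= size y)%N.
Proof.
move=> [x Px].
have ex : exists k, `[< exists2 y, P y & size y = k >].
  by exists (size x); apply/asboolP; exists x.
case: (ex_minnP ex) => k /asboolP[y Py <-] kmin.
by exists y; split=> // z Pz; apply: kmin; apply/asboolP; exists z.
Qed.

Section RingConditions.

(** Equivalent to the finite generation of all ideals; this form needs no
    lists of generators. *)
Definition noetherian (R : comNzRingType) : Prop :=
  forall a : nat -> R, exists N (c : nat -> R), a N = \sum_(i < N) c i * a i.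

Definition ideal (R : comNzRingType) (P : R -> Prop) : Prop :=
  [/\ P 0, forall x y, P x -> P y -> P (x + y) & forall x y, P y -> P (x * y)].

Definition prime_ideal (R : comNzRingType) (P : R -> Prop) : Prop :=
  [/\ ideal P, ~ P 1 & forall x y, P (x * y) -> P x \/ P y].

Definition dvdr (R : comNzRingType) (x y : R) : Prop := exists z, y = z * x.

Definition prime_elt (R : comNzRingType) (p : R) : Prop :=
  [/\ p != 0, ~ dvdr p 1 & forall x y, dvdr p (x * y) -> dvdr p x \/ dvdr p y].

Definition factors (R : comNzRingType) (x : R) (ps : seq R) : Prop :=
  (forall p, p \in ps -> prime_elt p) /\
  exists2 u, dvdr u 1 & x = u * \prod_(p <- ps) p.

Definition factorial_ring (R : comNzRingType) : Prop :=
  forall x : R, x != 0 -> exists ps, factors x ps.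

End RingConditions.

Section Ideals.
Variables (R : comNzRingType) (P : R -> Prop) (iP : ideal P).

Lemma idealN x : P x -> P (- x).
Proof. by move=> Px; rewrite -mulN1r; case: iP => _ _; apply. Qed.

Lemma idealB x y : P x -> P y -> P (x - y).
Proof. by case: (iP) => _ PD _ Px /idealN; apply: PD. Qed.

Lemma ideal_sum (I : Type) (r : seq I) (F : I -> R) :
  (forall i, P (F i)) -> P (\sum_(i <- r) F i).
Proof.
by case: iP => P0 PD _ PF; elim/big_ind: _ => // x y; apply: PD.
Qed.

Lemma prime_ideal_exp x k : prime_ideal P -> P (x ^+ k) -> P x.
Proof.
case=> _ P1 PM; elim: k => [|k IHk]; rewrite ?expr0 // exprS.
by move=> /PM[].
Qed.

End Ideals.

Lemma dvdr_ideal (R : comNzRingType) (x : R) : ideal (dvdr x).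
Proof.
split; first by exists 0; rewrite mul0r.
- by move=> _ _ [a ->] [b ->]; exists (a + b); rewrite mulrDl.
- by move=> a _ [b ->]; exists (a * b); rewrite mulrA.
Qed.

Lemma prime_elt_ideal (R : comNzRingType) (p : R) :
  prime_elt p -> prime_ideal (dvdr p).
Proof. by case=> _ p1 pM; split=> //; exact: dvdr_ideal. Qed.

Lemma pseudo_division (R : comNzRingType) (g h : {poly R}) : g != 0 ->
  exists N q r,
    (lead_coef g ^+ N)%:P * h = q * g + r /\ (size r < size g)%N.
Proof.
move=> g0; exists (Pdiv.Ring.rscalp h g), (Pdiv.Ring.rdivp h g).
exists (Pdiv.Ring.rmodp h g).
by rewrite mul_polyC -Pdiv.ComRing.rdivp_eq Pdiv.Ring.ltn_rmodp.
Qed.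

(** The inverse of [muni] evaluates a polynomial in one variable, with its
    coefficients seen in one more variable, at the last variable. *)
Lemma muni_bijective (n : nat) (R : comNzRingType) :
  exists f : {rmorphism {poly {mpoly R[n]}} -> {mpoly R[n.+1]}},
    [/\ cancel f (@muni n R), cancel (@muni n R) f &
        forall c, f (c%:MP)%:P = c%:MP].
Proof.
have [f [fC fX]] : exists f : {rmorphism {poly {mpoly R[n]}} -> {mpoly R[n.+1]}},
    (forall c, f c%:P = mwiden c) /\ f 'X = 'X_ord_max.
  exists (horner_eval ('X_ord_max : {mpoly R[n.+1]}) \o map_poly (@mwiden n R)).
  split=> [c|]; first by rewrite /= map_polyC /= /horner_eval hornerC.
  by rewrite /= map_polyX /horner_eval hornerX.
have muX i : muni ('X_i : {mpoly R[n.+1]}) =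
    if unlift ord_max i is Some j then ('X_j)%:P else 'X.
  rewrite muniE msuppX big_seq1 mcoeffX eqxx scale1r.
  case: unliftP => [j ->|->].
    rewrite mnm1E [lift _ _ == _]eq_sym (negPf (neq_lift _ _)) expr0 alg_polyC; congr (_ %:P).
    congr 'X_[_]; apply/mnmP=> k; rewrite mnmE !mnm1E.
    by congr (nat_of_bool _); rewrite -!val_eqE /= /bump leqNgt ltn_ord.
  rewrite mnm1E eqxx expr1 (_ : [multinom _ | _ < _] = 0%MM) ?mpolyX0 ?scale1r //.
  apply/mnmP=> k; rewrite mnmE mnm1E mnm0E -val_eqE /=.
  by rewrite gtn_eqF.
have muW (c : {mpoly R[n]}) : muni (mwiden c) = c%:P.
  elim/mpolyind: c => [|a m p _ _ IHp]; first by rewrite !raddf0.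
  rewrite mwidenD muniD IHp rmorphD; congr (_ + _).
  rewrite mwidenZ muniZ mwidenX -mul_mpolyC rmorphM /= -mul_polyC; congr (_ * _).
  rewrite muniE msuppX big_seq1 mcoeffX eqxx scale1r.
  rewrite mnmwiden_ordmax expr0 alg_polyC; congr (_ %:P).
  by congr 'X_[_]; apply/mnmP=> k; rewrite mnmE mnmwiden_widen.
exists f; split=> [p|p|c]; last by rewrite fC mwidenC.
- elim/poly_ind: p => [|p c IHp]; first by rewrite !raddf0.
  rewrite (rmorphD f) (rmorphM f) fX fC muniD muniM IHp muW muX.
  by rewrite unlift_none.
- elim/mpolyind: p => [|a m p _ _ IHp]; first by rewrite !raddf0.
  rewrite muniD (rmorphD f); congr (_ + _); last exact: IHp.
  rewrite -[a *: _]mul_mpolyC.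
  rewrite muniM (rmorphM f) muniC fC mwidenC.
  congr (_ * _); rewrite mpolyXE_id.
  rewrite (big_morph _ (@muniM _ _) (@muni1 _ _)) rmorph_prod.
  apply: eq_bigr => i _; rewrite rmorphXn [in LHS]rmorphXn.
  congr (_ ^+ _). rewrite [X in f X]muX; case: unliftP => [j ->|->]; last exact: fX.
  rewrite fC mwidenX mnmwiden1; congr 'X_[_].
  by congr U_(_)%MM; apply/val_inj => /=; rewrite /bump leqNgt ltn_ord.
Qed.

(** A property of polynomial rings that is invariant under isomorphism need only
    be transported from [R] to [{poly R}]. The embedding [i] of the constants is
    part of the data because the Nullstellensatz concerns [K]-valued points. *)
Lemma mpoly_idomain_ind (K : idomainType)
    (Q : forall R : idomainType, (K -> R) -> Prop) :
  (forall (R S : idomainType) (i : K -> R) (j : K -> S) (f : {rmorphism R -> S})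
     (g : {rmorphism S -> R}),
     cancel f g -> cancel g f -> (forall c, f (i c) = j c) -> Q R i -> Q S j) ->
  Q K id ->
  (forall (R : idomainType) (i : K -> R), Q R i -> Q {poly R} (polyC \o i)) ->
  forall n, Q {mpoly K[n]} (@mpolyC n K).
Proof.
move=> Qiso Q0 Qpoly; elim=> [|n IHn].
  apply: (Qiso K _ id _ (@mpolyC 0 K) (meval (fun=> 0)) _ _ _ Q0) => //.
    by move=> c; exact: mevalC.
  move=> p; suff -> : p = (p@_0)%:MP by congr _%:MP; exact: mevalC.
  apply/mpolyP=> m; rewrite mcoeffC.
  have -> : m = 0%MM by apply/mnmP; case.
  by rewrite eqxx mulr1.
have [f [fK mK fC]] := muni_bijective n K.
exact: (Qiso _ _ _ _ f (@muni n K) fK mK fC (Qpoly _ _ IHn)).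
Qed.

(** * Hilbert's basis theorem *)

Section Combinations.
Variables (R : comNzRingType) (a : nat -> R).

Definition combination (N : nat) (f : R) : Prop :=
  exists c : nat -> R, f = \sum_(i < N) c i * a i.

Lemma combination_ideal N : ideal (combination N).
Proof.
split.
- by exists (fun=> 0); rewrite big1 // => i _; rewrite mul0r.
- move=> _ _ [c ->] [d ->]; exists (fun i => c i + d i).
  by rewrite -big_split; apply: eq_bigr => i _; rewrite mulrDl.
- move=> b _ [c ->]; exists (fun i => b * c i); rewrite mulr_sumr.
  by apply: eq_bigr => i _; rewrite mulrA.
Qed.

Lemma combination_leq N M f : (N <= M)%N -> combination N f -> combination M f.
Proof.
move=> NM [c ->]; exists (fun i => if (i < N)%N then c i else 0).
rewrite (big_ord_widen _ (fun i => c i * a i) NM) big_mkcond /=.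
by apply: eq_bigr => i _; case: ifP => //; rewrite mul0r.
Qed.

Lemma combination_gen N i : (i < N)%N -> combination N (a i).
Proof.
move=> iN; exists (fun j => (j == i)%:R).
rewrite (bigD1 (Ordinal iN)) //= eqxx mul1r big1 ?addr0 // => j ji.
by rewrite -val_eqE /= in ji; rewrite (negPf ji) mul0r.
Qed.

End Combinations.

Lemma combination_sub (R : comNzRingType) (a : nat -> R) (I : R -> Prop) N f :
  ideal I -> (forall i, (i < N)%N -> I (a i)) -> combination a N f -> I f.
Proof.
move=> iI Ia [c ->]; case: (iI) => I0 ID IM.
by elim/big_ind: _ => // i _; apply/IM/Ia.
Qed.

(** Hilbert's argument: each [f k] has minimal degree outside the ideal of the
    previous ones, and a relation between the leading coefficients of the [f k]
    produces a polynomial of smaller degree. *)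
Lemma noetherian_poly (R : comNzRingType) :
  noetherian R -> noetherian {poly R}.
Proof.
move=> noethR p; apply: contrapT => bad.
have badN N : ~ combination p N (p N).
  by move=> [c pN]; apply: bad; exists N, c.
pose J f := exists N, combination p N f.
have iJ : ideal J.
  split; first by exists 0, (fun=> 0); rewrite big_ord0.
  - move=> f g [N Nf] [M Mg]; exists (maxn N M).
    have [_ + _] := combination_ideal p (maxn N M); apply.
      exact: combination_leq (leq_maxl _ _) Nf.
    exact: combination_leq (leq_maxr _ _) Mg.
  - by move=> f g [N Ng]; exists N; have [_ _] := combination_ideal p N; apply.
pose span (s : seq {poly R}) := combination (nth 0 s) (size s).
have /choice[F FP] : forall s, exists f : {poly R},
    (forall x, x \in s -> J x) -> [/\ J f, ~ span s f &
      forall h, J h -> ~ span s h -> (size f <= size h)%N].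
  move=> s.
  have [Js|nJs] := pselect (forall x, x \in s -> J x); last by exists 0.
  have [N sN] : exists N, forall x, x \in s -> combination p N x.
    elim: s Js => [|x s IHs] Js; first by exists 0.
    have [N sN] := IHs (fun y ys => Js y (mem_behead (s := x :: s) ys)).
    have [M xM] := Js x (mem_head _ _).
    exists (maxn N M) => y; rewrite inE => /orP[/eqP ->|/sN].
      exact: combination_leq (leq_maxr _ _) xM.
    exact: combination_leq (leq_maxl _ _).
  have [|f [[Jf sf] fmin]] := @exists_minimal _ (fun f => J f /\ ~ span s f)
    (fun f : {poly R} => size f).
    exists (p N); split; first by exists N.+1; apply: combination_gen.
    move=> sp; apply: (badN N); apply: combination_sub sp.
      exact: combination_ideal.
    by move=> i ?; apply/sN/mem_nth.
  by exists f => _; split=> // h Jh sh; apply: fmin.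
pose st k := iter k (fun s => rcons s (F s)) [::].
pose f k := F (st k).
have szst k : size (st k) = k by elim: k => //= k IHk; rewrite size_rcons IHk.
have nthst k i : (i < k)%N -> (st k)`_i = f i.
  elim: k => // k IHk; rewrite ltnS leq_eqVlt /= nth_rcons szst.
  by case/orP=> [/eqP ->|ik]; rewrite ?ltnn ?eqxx // ik IHk.
have Jst k x : x \in st k -> J x.
  elim: k x => // k IHk x; rewrite /= mem_rcons inE => /orP[/eqP ->|/IHk //].
  by case: (FP _ IHk).
have fP k : [/\ J (f k), ~ combination f k (f k) &
    forall h, J h -> ~ combination f k h -> (size (f k) <= size h)%N].
  have eqc h : combination f k h <-> span (st k) h.
    by split=> -[c ->]; exists c; rewrite szst; apply: eq_bigr => i _;
      rewrite nthst.
  have [Jf sf fmin] := FP _ (@Jst k).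
  by split=> // [/eqc//|h Jh sh]; apply: fmin => // /eqc.
have [N [c lN]] := noethR (fun k => lead_coef (f k)).
have [JfN sfN minN] := fP N.
have f0 k : f k != 0.
  apply/negP => /eqP fk0; have [_ + _] := fP k; rewrite fk0; apply.
  by case: (combination_ideal f k).
have szle i : (i <= N)%N -> (size (f i) <= size (f N))%N.
  move=> iN; have [_ _ fmin] := fP i; apply: fmin => // siN.
  by apply: sfN; apply: combination_leq iN siN.
(* The leading terms of [g] and of [f N] cancel. *)
pose g := \sum_(i < N) (c i *: 'X^(size (f N) - size (f i))) * f i.
have cg : combination f N g.
  by exists (fun i => c i *: 'X^(size (f N) - size (f i))).
have Jg : J g.
  by apply: combination_sub cg => // i _; case: (fP i).
have : (size (f N - g)%R < size (f N))%N.
  have sN0 : (0 < size (f N))%N by rewrite lt0n size_poly_eq0.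
  rewrite -[X in (_ < X)%N](prednK sN0) ltnS; apply/leq_sizeP => j.
  rewrite leq_eqVlt => /orP[/eqP <-|jN].
    rewrite coefB -lead_coefE lN coef_sum -sumrB big1 // => i _.
    rewrite -scalerAl coefZ coefXnM.
    have si0 : (0 < size (f i))%N by rewrite lt0n size_poly_eq0.
    have := szle i (ltnW (ltn_ord i)).
    move=> sle; rewrite ltnNge.
    have -> : (size (f N) - size (f i) <= (size (f N)).-1)%N.
      by rewrite leq_subLR -(prednK sN0) /= -(prednK si0) addSn ltnS leq_addl.
    rewrite /=.
    have -> : ((size (f N)).-1 - (size (f N) - size (f i)) = (size (f i)).-1)%N.
      by rewrite -subn1 -subn1 subnAC subKn.
    by rewrite subrr.
  rewrite coefB nth_default; last by rewrite -(prednK sN0).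
  rewrite coef_sum big1 ?subrr // => i _.
  rewrite -scalerAl coefZ coefXnM; case: ifP => [_|_]; first by rewrite mulr0.
  rewrite [_`_(_ - _)]nth_default ?mulr0 //.
  rewrite leq_subRL; last first.
    by rewrite (leq_trans (leq_subr _ _)) // -(prednK sN0).
  by rewrite subnK ?szle ?(ltnW (ltn_ord i)) // -(prednK sN0).
rewrite ltnNge => /negP; apply; apply: minN.
  by case: (iJ) => _ JD _; apply: JD => //; apply: idealN.
move=> cfg; apply: sfN; rewrite -[f N](subrK g).
by have [_ + _] := combination_ideal f N; apply.
Qed.

Lemma noetherian_mpoly (R : idomainType) n : noetherian R -> noetherian {mpoly R[n]}.
Proof.
move=> noethR.
apply: (@mpoly_idomain_ind R (fun S _ => noetherian S)) => //.
  move=> S T i j f g _ gK _ noethS a.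
  have [N [c Ec]] := noethS (fun k => g (a k)).
  exists N, (fun k => f (c k)); rewrite -[LHS]gK Ec raddf_sum.
  by apply: eq_bigr => k _; rewrite /= rmorphM /= gK.
by move=> S _; apply: noetherian_poly.
Qed.

Lemma noetherian_field (K : fieldType) : noetherian K.
Proof.
move=> a; have [a0|a0] := eqVneq (a 0%N) 0.
  by exists 0, (fun=> 0); rewrite big_ord0.
by exists 1%N, (fun=> a 1%N / a 0%N); rewrite big_ord1 divfK.
Qed.

(** * The Nullstellensatz *)

(** The Nullstellensatz as a property of the [K]-algebra [R]. The condition
    [phi b != 0] is what makes it pass from [R] to [{poly R}]: it keeps the
    leading coefficients used in divisions from vanishing at the point. *)
Definition has_points (K : comNzRingType) (R : comNzRingType) (i : K -> R) : Prop :=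
  forall P : R -> Prop, prime_ideal P -> forall b, ~ P b ->
  exists phi : {rmorphism R -> K},
    [/\ forall c, phi (i c) = c, forall p, P p -> phi p = 0 & phi b != 0].

Lemma exists_nonroot (K : idomainType) (char0 : [pchar K] =i pred0)
  (p : {poly K}) : p != 0 -> exists k : nat, p.[k%:R] != 0.
Proof.
move=> p0; apply: contrapT => allroot.
have rootk k : root p k%:R.
  by rewrite rootE; apply: contrapT => pk; apply: allroot; exists k; apply/negP.
have := @max_poly_roots _ p [seq k%:R | k <- iota 0 (size p)] p0.
rewrite size_map size_iota ltnn => H.
suff : false by []; apply: H; first by apply/allP => _ /mapP[k _ ->].
rewrite map_inj_uniq ?iota_uniq // => k l /eqP.
wlog kl : k l / (k <= l)%N => [W|].
  by case/orP: (leq_total k l) => ? /eqP E; first exact: W (introT eqP E);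
    symmetry; apply: W (introT eqP (esym E)).
rewrite eq_sym -subr_eq0 -natrB // => /eqP lk.
have /pcharf0P char0K := char0; have := char0K (l - k)%N.
rewrite lk eqxx => /esym; rewrite subn_eq0 => lk'.
by apply/eqP; rewrite eqn_leq kl.
Qed.

Section CoefficientwiseIdeal.
Variables (R : comNzRingType) (P : R -> Prop) (pP : prime_ideal P).

Definition coefs_in (f : {poly R}) : Prop := forall i, P f`_i.

Let iP : ideal P. Proof. by case: pP. Qed.

Lemma coefs_in_ideal : ideal coefs_in.
Proof.
case: iP => P0 PD PM; split=> [i|f g Pf Pg i|f g Pg i].
- by rewrite coef0.
- by rewrite coefD; apply: PD.
- by rewrite coefM; apply: (ideal_sum iP) => j; apply: PM.
Qed.

(** Polynomials modulo [P] have a degree once their coefficients in [P] are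
    dropped. *)
Lemma strip_coefs (f : {poly R}) : exists g : {poly R},
  [/\ coefs_in (f - g), (size g <= size f)%N & g = 0 \/ ~ P (lead_coef g)].
Proof.
pose g := \poly_(i < size f) (if `[< P f`_i >] then 0 else f`_i).
have gE i : g`_i = if `[< P f`_i >] then 0 else f`_i.
  rewrite coef_poly; case: ltnP => // fi.
  by rewrite [f`_i]nth_default // if_same.
exists g; split; last 1 first.
- have [->|g0] := eqVneq g 0; [by left|right].
  have : lead_coef g != 0 by rewrite lead_coef_eq0.
  by rewrite lead_coefE gE; case: asboolP => //; rewrite eqxx.
- move=> i; rewrite coefB gE; case: asboolP => [|_]; first by rewrite subr0.
  by rewrite subrr; case: iP.
- exact: size_poly.
Qed.

Lemma strip_neq0 f g : coefs_in (f - g) -> ~ coefs_in f -> g != 0.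
Proof. by move=> fg nf; apply/negP => /eqP g0; rewrite g0 subr0 in fg. Qed.

Lemma coefs_in_prime : prime_ideal coefs_in.
Proof.
case: (pP) => _ P1 PM; have [c0 cD cM] := coefs_in_ideal.
split; first exact: coefs_in_ideal.
  by move/(_ 0%N); rewrite coef1.
move=> f g fg; apply: contrapT => /not_orP[nf ng].
have [f' [ff' _ lf]] := strip_coefs f; have [g' [gg' _ lg]] := strip_coefs g.
have f'0 := strip_neq0 ff' nf; have g'0 := strip_neq0 gg' ng.
case: lf => [/eqP|lf]; first by rewrite (negPf f'0).
case: lg => [/eqP|lg]; first by rewrite (negPf g'0).
have : coefs_in (f' * g').
  have -> : f' * g' = f * g - (g * (f - f') + f' * (g - g')) by ring.
  by apply: (idealB coefs_in_ideal) => //; apply: cD; apply: cM.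
move/(_ (size f' + size g').-2); rewrite -mul_lead_coef => /PM[] //.
Qed.

End CoefficientwiseIdeal.

(** Either [P] is generated by its constants, and then the variable is sent to
    a value that is not a root of [b]; or [P] contains a polynomial [f] of least
    degree with leading coefficient outside [P], which divides the elements of [P]
    after multiplication by powers of this coefficient. In that case the variable
    is sent to a root of [f], and [b] does not vanish there because some constant
    [e] outside [P] is a multiple of [b] modulo [P]. *)
Lemma has_points_poly (K : closedFieldType) (char0 : [pchar K] =i pred0)
    (R : idomainType) (i : K -> R) :
  has_points i -> has_points (polyC \o i).
Proof.
move=> ptsR P primeP b nPb.
have [iP P1 PM] := primeP; have [P0 PD PMl] := iP.
pose P' r := P r%:P.
have primeP' : prime_ideal P'.
  split=> [||x y]; last by rewrite /P' polyCM => /PM.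
    split=> [|x y|x y]; rewrite /P' ?polyC0 ?polyCD ?polyCM //; first exact: PD.
    exact: PMl.
  by rewrite /P' polyC1.
have coefsP f : coefs_in P' f -> P f.
  move=> Pf; rewrite -[f]coefK poly_def; apply: (ideal_sum iP) => j.
  by rewrite -mul_polyC mulrC; apply: PMl; apply: Pf.
have ext (phi : {rmorphism R -> K}) (t : K) : exists psi : {rmorphism {poly R} -> K},
    forall f, psi f = (map_poly phi f).[t].
  by exists (horner_eval t \o map_poly phi).
have [allP|/existsNP[f0 /not_implyP[Pf0 nf0]]] :=
  pselect (forall f, P f -> coefs_in P' f).
  have /existsNP[j Pbj] : ~ coefs_in P' b by move/coefsP.
  have [phi [phiK phiP phib]] := ptsR _ primeP' _ Pbj.
  have mb0 : map_poly phi b != 0.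
    by apply/negP => /eqP/polyP/(_ j); rewrite coef_map /= coef0 => /eqP; apply/negP.
  have [t bt] := exists_nonroot char0 mb0.
  have [psi psiE] := ext phi t%:R; exists psi; split.
  - by move=> c; rewrite psiE /= map_polyC /= hornerC; exact: phiK.
  - move=> p /allP Pp; rewrite psiE.
    rewrite (_ : map_poly phi p = 0) ?horner0 //; apply/polyP => k.
    by rewrite coef_map /= coef0 phiP //; apply: Pp.
  - by rewrite psiE.
(* [f] generates [P] over the fraction field of the quotient of [R] by [P']. *)
have [|f [[Pf lf] fmin]] := @exists_minimal _
    (fun f => P f /\ ~ P' (lead_coef f)) (fun f : {poly R} => size f).
  have [g [fg _ lg]] := strip_coefs primeP' f0; exists g; split; last first.
    by case: lg (strip_neq0 fg nf0) => // ->; rewrite eqxx.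
  by rewrite -[g](subKr f0); apply: (idealB iP) => //; apply: coefsP.
have fminP h : P h -> (size h < size f)%N -> coefs_in P' h.
  move=> Ph hf; apply: contrapT => nh.
  have [g [hg gh lg]] := strip_coefs primeP' h.
  case: lg => [g0|lg]; first by move: (strip_neq0 hg nh); rewrite g0 eqxx.
  have : (size f <= size g)%N.
    apply: fmin; split=> //; rewrite -[g](subKr h).
    by apply: (idealB iP) => //; apply: coefsP.
  by rewrite leqNgt (leq_ltn_trans gh).
have pdiv (g h : {poly R}) : ~ P' (lead_coef g) -> exists N q r,
    [/\ (lead_coef g ^+ N)%:P * h = q * g + r, (size r < size g)%N
      & ~ P' (lead_coef g ^+ N)].
  move=> lg; have [|N [q [r [Er rg]]]] := @pseudo_division _ g h.
    by apply/negP => /eqP g0; apply: lg; rewrite g0 lead_coef0 /P' polyC0.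
  exists N, q, r; split=> //.
  by move/(prime_ideal_exp primeP').
pose J h := exists u p, P p /\ h = u * b + p.
have JP h : P h -> J h by move=> Ph; exists 0, h; rewrite mul0r add0r.
have iJ : ideal J.
  split; first exact: JP.
  - move=> _ _ [u [p [Pp ->]]] [v [q [Pq ->]]]; exists (u + v), (p + q).
    by split; [exact: PD|rewrite mulrDl addrACA].
  - move=> x _ [u [p [Pp ->]]]; exists (x * u), (x * p).
    by split; [exact: PMl|rewrite mulrDr mulrA].
have [|g [[Jg lg gf] gmin]] := @exists_minimal _
    (fun g => [/\ J g, ~ P' (lead_coef g) & (size g < size f)%N])
    (fun g : {poly R} => size g).
  have [N [q [r [Er rf nc]]]] := pdiv f b lf.
  have nPr : ~ P r.
    move=> Pr; have : P ((lead_coef f ^+ N)%:P * b).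
      by rewrite Er; apply: PD => //; apply: PMl.
    by case/PM.
  have [g [rg gr lg]] := strip_coefs primeP' r; exists g; split.
  - rewrite -[g](subKr r); apply: (idealB iJ); last by apply/JP/coefsP.
    exists (lead_coef f ^+ N)%:P, (- (q * f)); split.
      by apply: (idealN iP); apply: PMl.
    by rewrite Er addrC addKr.
  - by case: lg (@strip_neq0 _ _ r g rg) => // -> H; have := H (fun h => nPr (coefsP _ h));
      rewrite eqxx.
  - exact: leq_ltn_trans gr rf.
have gminP h : J h -> (size h < size g)%N -> P h.
  move=> Jh hg; apply: contrapT => nPh.
  have [h' [hh' sh' lh']] := strip_coefs primeP' h.
  case: lh' => [h0|lh'].
    by apply/nPh/coefsP; rewrite h0 subr0 in hh'.
  have : (size g <= size h')%N.
    apply: gmin; split=> //; last by rewrite (leq_ltn_trans sh') ?(ltn_trans hg).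
    by rewrite -[h'](subKr h); apply: (idealB iJ) => //; apply/JP/coefsP.
  by rewrite leqNgt (leq_ltn_trans sh').
have g0 : g != 0.
  by apply/negP => /eqP g0; apply: lg; rewrite g0 lead_coef0 /P' polyC0.
have f0' : f != 0.
  by apply/negP => /eqP f0'; apply: lf; rewrite f0' lead_coef0 /P' polyC0.
(* By minimality, [g] divides [f] over that fraction field, where [f] is
   irreducible because [P] is prime. *)
have sg1 : (size g <= 1)%N.
  rewrite leqNgt; apply/negP => sg.
  have [N [q [r [Er rg nc]]]] := pdiv g f lg.
  have Pr : P r.
    apply: gminP => //.
    have -> : r = (lead_coef g ^+ N)%:P * f - q * g by rewrite Er addrC addKr.
    apply: (idealB iJ); first by apply: JP; apply: PMl.
    by case: iJ => _ _; apply.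
  have Eqg : q * g = (lead_coef g ^+ N)%:P * f - r by rewrite Er addrK.
  have nPg : ~ P g.
    move=> Pg; have := fmin g (conj Pg lg); by rewrite leqNgt gf.
  have Pq : P q.
    have : P (q * g) by rewrite Eqg; apply: (idealB iP) => //; apply: PMl.
    by case/PM.
  have c0 : lead_coef g ^+ N != 0 by rewrite expf_neq0 // lead_coef_eq0.
  have sf : size ((lead_coef g ^+ N)%:P * f) = size f by rewrite size_Cmul.
  have sqg : size (q * g) = size f.
    by rewrite Eqg size_polyDl ?sf // size_polyN (ltn_trans rg).
  have q0 : q != 0.
    by apply/negP => /eqP q0; move: sqg; rewrite q0 mul0r size_poly0 => /esym/eqP;
       rewrite size_poly_eq0 (negPf f0').
  have sq : (size q < size f)%N.
    rewrite -sqg size_mul // -subn1 -addnBA ?(ltnW sg) // -addn1 leq_add2l.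
    by rewrite subn_gt0.
  have : P' (lead_coef (q * g)).
    rewrite lead_coefM /P' polyCM mulrC; apply: PMl.
    by rewrite lead_coefE; apply: (fminP q).
  rewrite Eqg lead_coefDl ?sf ?size_polyN ?(ltn_trans rg) // lead_coefM lead_coefC.
  by case: primeP' => _ _ PM' /PM'[].
have gE : g = (lead_coef g)%:P.
  by rewrite [g in LHS]size1_polyC // lead_coefE; congr (_`_ _)%:P;
    apply/esym/eqP; rewrite -subn1 subn_eq0.
set e := lead_coef g in gE lg.
have nce : ~ P' (lead_coef f * e) by case: primeP' => _ _ PM' /PM'[].
have [phi [phiK phiP phice]] := ptsR _ primeP' _ nce.
move: phice; rewrite rmorphM mulf_eq0 => /norP[phic phie].
have [t ft] : exists t, root (map_poly phi f) t.
  apply/closed_rootP; rewrite size_map_poly_id0 //; apply/negP => /eqP sf.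
  apply: lf; rewrite lead_coefE sf /= /P' -[f`_0]/(f`_0) -size1_polyC ?sf //.
have [psi psiE] := ext phi t.
have psiP h : P h -> psi h = 0.
  move=> Ph; have [N [q [r [Er rf nc]]]] := pdiv f h lf.
  have Pr : P r.
    have -> : r = (lead_coef f ^+ N)%:P * h - q * f by rewrite Er addrC addKr.
    by apply: (idealB iP); apply: PMl.
  have psir : psi r = 0.
    rewrite psiE (_ : map_poly phi r = 0) ?horner0 //; apply/polyP => k.
    by rewrite coef_map /= coef0 phiP //; apply: (fminP r).
  have psif : psi f = 0 by apply/eqP; rewrite psiE.
  have /eqP := congr1 psi Er; rewrite rmorphD !rmorphM psif psir mulr0 addr0.
  rewrite psiE map_polyC /= hornerC rmorphXn mulf_eq0 expf_eq0 (negPf phic) andbF.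
  by move/eqP.
exists psi; split=> //.
- by move=> c; rewrite psiE /= map_polyC /= hornerC; exact: phiK.
- case: Jg => u [p [Pp Eg]]; apply/negP => /eqP psib.
  have := congr1 psi Eg; rewrite rmorphD rmorphM psib mulr0 (psiP p Pp) addr0 gE.
  by rewrite psiE map_polyC /= hornerC => /eqP; apply/negP.
Qed.

Lemma has_points_mpoly (K : closedFieldType) (char0 : [pchar K] =i pred0) n :
  has_points (@mpolyC n K).
Proof.
apply: (@mpoly_idomain_ind K (fun R => @has_points K R)) => //; last 1 first.
- by move=> R i; apply: has_points_poly.
- move=> R S i j f g fK gK fi ptsR P [iP P1 PM] b nPb.
  have [||phi [phiK phiP phib]] := ptsR (fun x => P (f x)) _ (g b).
  + split=> [||x y]; rewrite ?rmorph1 ?rmorphM //; last exact: PM.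
    case: iP => P0 PD PMl; split=> [|x y|x y]; rewrite ?rmorph0 ?rmorphD ?rmorphM //.
      exact: PD.
    exact: PMl.
  + by rewrite gK.
  exists (phi \o g); split=> //=.
  + by move=> c; rewrite -fi fK.
  + by move=> p Pp; apply: phiP; rewrite gK.
- move=> P [iP P1 PM] b nPb; exists idfun; split=> //= [p Pp|].
    have [//|p0] := eqVneq p 0; case: P1; rewrite -(mulVf p0).
    by case: iP => _ _; apply.
  by apply/negP => /eqP b0; case: iP => P0 _ _; rewrite b0 in nPb.
Qed.

(** An ideal maximal among those avoiding 1 is prime. *)
Lemma ideal_sub_prime (R : comNzRingType) (I : R -> Prop) :
  ideal I -> ~ I 1 -> exists P, prime_ideal P /\ (forall x, I x -> P x).
Proof.
move=> iI I1; have [I0 ID IM] := iI.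
(* The empty set takes care of the empty chain. *)
pose good (P : set R) := P = set0 \/ [/\ ideal P, ~ P 1 & I `<=` P]%classic.
have [|P [gP Pmax]] := @Zorn_bigcup _ good.
  move=> F Fgood Ftot.
  have [[X FX X0]|noX] := pselect (exists2 X, F X & X <> set0); last first.
    left; apply/seteqP; split=> // x [X FX Xx]; apply: noX; exists X => //.
    by move=> X0; rewrite X0 in Xx.
  right; have gF Y y : F Y -> Y y -> [/\ ideal Y, ~ Y 1 & I `<=` Y]%classic.
    by move=> FY Yy; case: (Fgood _ FY) => // Y0; rewrite Y0 in Yy.
  have [iX X1 IX] : [/\ ideal X, ~ X 1 & I `<=` X]%classic.
    by case: (Fgood _ FX).
  split; first split.
  - by exists X => //; case: iX.
  - move=> x y [Y FY Yx] [Z FZ Zy].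
    have [iY _ _] := gF _ _ FY Yx; have [iZ _ _] := gF _ _ FZ Zy.
    case: (Ftot _ _ FY FZ) => [YZ|ZY].
      by exists Z => //; case: iZ => _ + _; apply=> //; apply: YZ.
    by exists Y => //; case: iY => _ + _; apply=> //; apply: ZY.
  - move=> x y [Y FY Yy]; exists Y => //.
    by have [[_ _ +] _ _] := gF _ _ FY Yy; apply.
  - by move=> [Y FY Y1]; have [_ + _] := gF _ _ FY Y1; apply.
  - by move=> x Ix; exists X => //; apply: IX.
have gI : good I by right; split.
have {gP} [iP P1 IP] : [/\ ideal P, ~ P 1 & I `<=` P]%classic.
  case: gP => // P0; case: (Pmax I) => //; split; first by rewrite P0.
  by rewrite P0 => /(_ _ I0).
have [P0 PD PM] := iP.
exists P; split=> //; split=> // x y Pxy; apply: contrapT => /not_orP[nx ny].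
pose Q z := exists a p, P p /\ z = a * x + p.
have iQ : ideal Q.
  split; first by exists 0, 0; rewrite mul0r addr0.
  - move=> _ _ [a [p [Pp ->]]] [b [q [Pq ->]]]; exists (a + b), (p + q).
    by split; [exact: PD|rewrite mulrDl addrACA].
  - move=> c _ [a [p [Pp ->]]]; exists (c * a), (c * p).
    by split; [exact: PM|rewrite mulrDr mulrA].
have PQ : (P `<=` Q)%classic by move=> p Pp; exists 0, p; rewrite mul0r add0r.
have [Q1|Q1] := pselect (Q 1).
  case: Q1 => a [p [Pp E]]; apply: ny; rewrite -[y]mulr1 E mulrDr.
  by apply: PD; [rewrite mulrCA [y * x]mulrC; apply: PM|apply: PM].
apply: (Pmax Q); last by right; split=> // z /IP/PQ.
split=> // QP; apply: nx; apply: QP; exists 1, 0.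
by rewrite mul1r addr0.
Qed.

Lemma nullstellensatz (K : closedFieldType) (char0 : [pchar K] =i pred0) n
    (P : {mpoly K[n]} -> Prop) (b : {mpoly K[n]}) :
  prime_ideal P -> ~ P b ->
  exists v : 'I_n -> K, (forall p, P p -> p.@[v] = 0) /\ b.@[v] != 0.
Proof.
move=> primeP nPb; have [phi [phiK phiP phib]] := has_points_mpoly char0 primeP nPb.
have phiE p : phi p = p.@[fun i => phi 'X_i].
  elim/mpolyind: p => [|a m p _ _ IHp]; first by rewrite rmorph0 meval0.
  rewrite rmorphD mevalD IHp mevalZ -mul_mpolyC rmorphM phiK; congr (_ * _ + _).
  rewrite mevalX mpolyXE_id rmorph_prod; apply: eq_bigr => i _.
  by rewrite rmorphXn.
by exists (fun i => phi 'X_i); split=> [p Pp|]; rewrite -phiE //; apply: phiP.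
Qed.

Lemma weak_nullstellensatz (K : closedFieldType) (char0 : [pchar K] =i pred0) n
    (I : {mpoly K[n]} -> Prop) :
  ideal I -> ~ I 1 -> exists v : 'I_n -> K, forall p, I p -> p.@[v] = 0.
Proof.
move=> iI I1; have [P [primeP IP]] := ideal_sub_prime iI I1.
have [v [vP _]] := nullstellensatz char0 primeP (let: And3 _ P1 _ := primeP in P1).
by exists v => p /IP/vP.
Qed.

(** * Unique factorization *)

Section Divisibility.
Variable R : idomainType.
Implicit Types x y z p q u : R.

Lemma dvdr_mull x y z : dvdr x y -> dvdr x (z * y).
Proof. by case: (dvdr_ideal x) => _ _; apply. Qed.

Lemma dvdr_trans x y z : dvdr x y -> dvdr y z -> dvdr x z.
Proof. by move=> [a ->] [b ->]; exists (b * a); rewrite mulrA. Qed.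

Lemma prime_elt_dvd_prod p ps :
  prime_elt p -> dvdr p (\prod_(q <- ps) q) -> exists2 q, q \in ps & dvdr p q.
Proof.
move=> pp; have [_ p1 pM] := pp.
elim: ps => [|q ps IHps]; first by rewrite big_nil.
rewrite big_cons => /pM[pq|/IHps[r rps pr]].
  by exists q => //; rewrite mem_head.
by exists r => //; rewrite inE rps orbT.
Qed.

Lemma prime_elt_associates p q :
  prime_elt p -> prime_elt q -> dvdr p q -> exists2 u, dvdr u 1 & q = u * p.
Proof.
move=> [p0 p1 pM] [q0 q1 qM] [a Ea]; exists a => //.
have : dvdr q (a * p) by exists 1; rewrite Ea mul1r.
case/qM=> -[b Eb].
  exfalso; apply: p1; exists b; apply: (mulIf q0).
  by rewrite mul1r {1}Ea {1}Eb; ring.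
exists b; apply: (mulIf q0); by rewrite mul1r -mulrA [a * q]mulrC mulrA -Eb mulrC -Ea.
Qed.

(** By primality, [p] is associated to one of the [ps]. The number of factors
    is what bounds the extraction of constant primes below. *)
Lemma factors_cancel p x ps : prime_elt p -> factors (p * x) ps ->
  exists qs, factors x qs /\ size ps = (size qs).+1.
Proof.
move=> pp [psP [u u1 E]]; have [p0 p1 pM] := pp.
have : dvdr p (u * \prod_(q <- ps) q) by exists x; rewrite -E mulrC.
case/pM => [pu|]; first by case: p1; apply: dvdr_trans pu u1.
move/(prime_elt_dvd_prod pp) => [q qps pq].
have [v v1 Eq] := prime_elt_associates pp (psP _ qps) pq.
exists (rem q ps); split; last first.
  by rewrite size_rem // prednK // lt0n size_eq0; case: (ps) qps.
split; first by move=> r /mem_rem/psP.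
exists (u * v).
  case: u1 v1 => [a Ea] [b Eb]; exists (a * b).
  by rewrite mulrACA -Ea -Eb mulr1.
apply: (mulfI p0); rewrite E (perm_big _ (perm_to_rem qps)) big_cons Eq /=; ring.
Qed.

Lemma factorsM x y ps qs :
  factors x ps -> factors y qs -> factors (x * y) (ps ++ qs).
Proof.
move=> [psP [u u1 ->]] [qsP [v v1 ->]]; split.
  by move=> p; rewrite mem_cat => /orP[/psP|/qsP].
exists (u * v); last by rewrite big_cat /= mulrACA.
case: u1 v1 => [a Ea] [b Eb]; exists (a * b).
by rewrite mulrACA -Ea -Eb mulr1.
Qed.

Lemma factors_prime p : prime_elt p -> factors p [:: p].
Proof.
move=> pp; split; first by move=> q; rewrite inE => /eqP ->.
by exists 1; [exists 1; rewrite mulr1|rewrite big_seq1 mul1r].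
Qed.

End Divisibility.

Section GaussLemma.
Variables (R : idomainType) (factR : factorial_ring R).
Implicit Types (p : R) (f g h q : {poly R}).

Lemma dvdr_polyC p f : dvdr p%:P f <-> forall i, dvdr p f`_i.
Proof.
split=> [[g ->] i|pf]; first by exists g`_i; rewrite coefMC.
have /choice[c cE] : forall i, exists z, f`_i = z * p by exact: pf.
exists (\poly_(i < size f) c i); apply/polyP => i; rewrite coefMC coef_poly.
by case: ltnP => [_|fi]; rewrite -?cE // nth_default // mul0r.
Qed.

Lemma prime_elt_polyC p : prime_elt p -> prime_elt p%:P.
Proof.
move=> pp; have [_ q1 qM] := coefs_in_prime (prime_elt_ideal pp).
have [p0 _ _] := pp; split; first by rewrite polyC_eq0.
  by move/dvdr_polyC.
by move=> f g /dvdr_polyC/qM[] /dvdr_polyC; [left|right].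
Qed.

Lemma factors_polyC (a : R) ps : factors a ps -> factors a%:P (map polyC ps).
Proof.
move=> [psP [u [v uv] ->]]; split.
  by move=> _ /mapP[p /psP pp ->]; apply: prime_elt_polyC.
exists u%:P; first by exists v%:P; rewrite -polyCM -uv polyC1.
by rewrite polyCM big_map (big_morph _ (@polyCM R) (polyC1 R)).
Qed.

Definition primitive q := forall p, prime_elt p -> ~ dvdr p%:P q.

(** Constant primes dividing [f] are taken out one by one; they also divide the
    leading coefficient, which has finitely many prime factors. *)
Lemma primitive_part f : f != 0 ->
  exists (a : R) q, [/\ a != 0, f = a%:P * q & primitive q].
Proof.
move=> f0; have l0 : lead_coef f != 0 by rewrite lead_coef_eq0.
have [ps fps] := factR l0; elim: {ps}(size ps) {-2}ps (erefl (size ps)) f f0 fps l0.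
  move=> ps /size0nil -> f f0 fps l0; exists 1, f; split; rewrite ?oner_eq0 ?mul1r //.
  move=> p pp [g fE]; have [_ p1 _] := pp; apply: p1.
  case: fps => _ [u u1]; rewrite big_nil mulr1 fE lead_coefM lead_coefC => E.
  by apply: dvdr_trans u1; rewrite -E; exists (lead_coef g).
move=> k IHk ps sps f f0 fps l0.
have [[p [pp [g fE]]]|noP] := pselect (exists p, prime_elt p /\ dvdr p%:P f).
  have [p0 _ _] := pp.
  move: fps; rewrite {1}fE lead_coefM lead_coefC mulrC => /(factors_cancel pp)[qs [gqs]].
  rewrite sps => -[sqs].
  have g0 : g != 0 by apply: contraNneq f0 => g0; rewrite fE g0 mul0r.
  have [|a [q [a0 gE qP]]] := IHk qs (esym sqs) g g0 gqs; first by rewrite lead_coef_eq0.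
  exists (p * a), q; split=> //; first by rewrite mulf_neq0.
  by rewrite fE gE polyCM; ring.
exists 1, f; split; rewrite ?oner_eq0 ?mul1r // => p pp pf.
by apply: noP; exists p.
Qed.

Lemma primitive_dvd q (a : R) h : primitive q -> a != 0 ->
  dvdr q (a%:P * h) -> dvdr q h.
Proof.
move=> qP a0; have [ps [psP [u [v uv] ->]]] := factR a0.
elim: ps psP h => [|p ps IHps] psP h.
  rewrite big_nil mulr1 => /(dvdr_mull v%:P).
  by rewrite mulrA -polyCM -uv polyC1 mul1r.
have pp := psP _ (mem_head _ _).
rewrite big_cons mulrCA polyCM -mulrA => -[k E].
have [p0 _ pM] := prime_elt_polyC pp.
have : dvdr p%:P (k * q).
  by exists ((u * \prod_(j <- ps) j)%:P * h); rewrite -E mulrC.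
case/pM => [[l El]|/(qP _ pp)//].
apply: IHps; first by move=> r rps; apply: psP; rewrite inE rps orbT.
by exists l; apply: (mulfI p0); rewrite E El; ring.
Qed.

(** Gauss's lemma: each prime factor of [a] divides [g] or [h], and can be
    cancelled there. *)
Lemma primitive_factorization q (a : R) g h : primitive q -> a != 0 ->
  a%:P * q = g * h ->
  exists g' h', [/\ q = g' * h', size g' = size g & size h' = size h].
Proof.
move=> qP a0; have [ps [psP [u [v uv] ->]]] := factR a0.
have u0 : u != 0.
  by apply/negP => /eqP u0; move: uv; rewrite u0 mulr0 => /eqP; rewrite oner_eq0.
elim: ps psP g h => [|p ps IHps] psP g h.
  rewrite big_nil mulr1 => E; exists (v%:P * g), h; split=> //; last first.
    rewrite size_Cmul //; apply/negP => /eqP v0.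
    by move: uv; rewrite v0 mul0r => /eqP; rewrite oner_eq0.
  by rewrite -mulrA -E mulrA -polyCM -uv polyC1 mul1r.
have pp := psP _ (mem_head _ _); have [pC0 _ pM] := prime_elt_polyC pp.
have p0 : p != 0 by case: pp.
rewrite big_cons mulrCA polyCM -mulrA => E.
have : dvdr p%:P (g * h).
  by exists ((u * \prod_(j <- ps) j)%:P * q); rewrite -E mulrC.
have psP' r : r \in ps -> prime_elt r by move=> rps; apply: psP; rewrite inE rps orbT.
case/pM => -[k Ek].
  have [|g' [h' [-> sg sh]]] := IHps psP' k h.
    by apply: (mulfI pC0); rewrite E Ek; ring.
  by exists g', h'; split=> //; rewrite sg Ek mulrC size_Cmul.
have [|g' [h' [-> sg sh]]] := IHps psP' g k.
  by apply: (mulfI pC0); rewrite E Ek; ring.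
by exists g', h'; split=> //; rewrite sh Ek mulrC size_Cmul.
Qed.

(** The last hypothesis is irreducibility over the field of fractions of [R].
    Let [q] divide [g * h], and let [d] have least degree in the ideal generated
    by [q] and [g]. If [d] is constant, then a multiple of [h] by a constant is
    divisible by [q]; otherwise [d] is associated to [q] over the field of
    fractions, and [q] divides [g]. *)
Lemma primitive_irreducible_prime q : (1 < size q)%N -> primitive q ->
  (forall (a : R) g h, a != 0 -> a%:P * q = g * h ->
     ~~ ((1 < size g) && (size g < size q))%N) ->
  prime_elt q.
Proof.
move=> sq qP irrq; have q0 : q != 0 by rewrite -size_poly_gt0 (ltn_trans _ sq).
split=> // [[k /(congr1 (size \o polyseq))]|g h [k Ek]].
  rewrite /= size_poly1 => E; have k0 : k != 0.
    by apply/negP => /eqP k0; move: E; rewrite k0 mul0r size_poly0.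
  move: k0 E; rewrite -size_poly_gt0 => k0; rewrite size_mul -?size_poly_gt0 ?(ltnW sq) //.
  by case: (size k) k0 => // a _; case: (size q) sq => [|[|b]] // _; rewrite !addnS !addSn.
pose J f := exists u v, f = u * q + v * g.
have iJ : ideal J.
  split; first by exists 0, 0; rewrite !mul0r addr0.
  - move=> _ _ [u [v ->]] [w [z ->]]; exists (u + w), (v + z); ring.
  - move=> c _ [u [v ->]]; exists (c * u), (c * v); ring.
have Jq : J q by exists 1, 0; rewrite mul1r mul0r addr0.
have Jg : J g by exists 0, 1; rewrite mul1r mul0r add0r.
have [|d [[Jd d0] dmin]] := @exists_minimal _ (fun d => J d /\ d != 0)
   (fun d : {poly R} => size d); first by exists q.
have dP f : J f -> exists2 a : R, a != 0 & exists s, a%:P * f = s * d.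
  move=> Jf; have [N [s [r [E rd]]]] := pseudo_division f d0.
  exists (lead_coef d ^+ N); first by rewrite expf_neq0 // lead_coef_eq0.
  exists s; rewrite E; suff -> : r = 0 by rewrite addr0.
  apply: contraTeq rd => r0; rewrite -leqNgt; apply: dmin; split=> //.
  have -> : r = (lead_coef d ^+ N)%:P * f - s * d by rewrite E addrC addKr.
  by apply: (idealB iJ); case: iJ => _ _; apply.
have [a a0 [s Es]] := dP _ Jq; have [b b0 [t Et]] := dP _ Jg.
have [sd1|sd1] := leqP (size d) 1.
  right; have [u [v Ed]] := Jd.
  have Ed' := size1_polyC sd1.
  apply: (primitive_dvd (a := d`_0) qP).
    by rewrite -polyC_eq0 -Ed'.
  by rewrite -Ed' Ed; exists (u * h + v * k); rewrite mulrDl -[v * g * h]mulrA Ek; ring.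
left; have := irrq a d s a0; rewrite Es mulrC => /(_ erefl).
rewrite sd1 /= -leqNgt => qd.
have s0 : s != 0.
  apply/negP => /eqP s0; move/eqP: Es; rewrite s0 mul0r mulf_eq0 polyC_eq0.
  by rewrite (negPf a0) (negPf q0).
have s1 : (size s <= 1)%N.
  have := congr1 (size \o polyseq) Es; rewrite /= size_Cmul // size_mul //.
  move=> E; move: qd; rewrite E -(prednK (ltn_trans (ltn0Sn _) sd1)).
  by rewrite addnS /= -[X in (_ <= X)%N]add1n leq_add2r.
have Es' := size1_polyC s1.
have sC0 : s`_0 != 0 by rewrite -polyC_eq0 -Es'.
apply: (primitive_dvd (a := s`_0 * b) qP); first by rewrite mulf_neq0.
exists (t * a%:P); rewrite polyCM -Es' -mulrA Et -mulrA Es; ring.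
Qed.

Lemma factorial_poly : factorial_ring {poly R}.
Proof.
move=> f f0; have [a [q [a0 Ef qP]]] := primitive_part f0; rewrite Ef in f0 *.
have [ps /factors_polyC aps] := factR a0.
suff [qs qqs] : exists qs, factors q qs by exists (map polyC ps ++ qs); apply: factorsM.
have q0 : q != 0 by apply: contraNneq f0 => ->; rewrite mulr0.
clear f Ef f0 a a0 ps aps.
elim: {q}(size q) {-2}q (leqnn (size q)) q0 qP => [|k IHk] q sq q0 qP.
  by move: sq; rewrite leqn0 size_poly_eq0 (negPf q0).
have [q1|q1] := leqP (size q) 1.
  have Eq := size1_polyC q1; have c0 : q`_0 != 0 by rewrite -polyC_eq0 -Eq.
  have [qs /factors_polyC qqs] := factR c0; exists (map polyC qs).
  by rewrite Eq.
have [irrq|] := pselect (forall (a : R) g h, a != 0 -> a%:P * q = g * h ->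
     ~~ ((1 < size g) && (size g < size q))%N).
  by exists [:: q]; apply/factors_prime/primitive_irreducible_prime.
move=> /existsNP[b /existsNP[g /existsNP[h /not_implyP[b0]]]].
move=> /not_implyP[E /negP]; rewrite negbK => /andP[g1 gq].
have [g' [h' [Eq sg sh]]] := primitive_factorization qP b0 E.
have gh0 : g' * h' != 0 by rewrite -Eq.
move: (gh0); rewrite mulf_eq0 => /norP[g0 h0].
have gP : primitive g' by move=> p pp pg; apply: (qP p pp); rewrite Eq mulrC; apply: dvdr_mull.
have hP : primitive h' by move=> p pp pg; apply: (qP p pp); rewrite Eq; apply: dvdr_mull.
have hq : (size h' < size q)%N.
  rewrite Eq size_mul // sg -(prednK (ltn_trans (ltn0Sn 0) g1)) addSn /=.
  rewrite -[X in (X < _)%N]add0n ltn_add2r -ltnS prednK // (ltn_trans _ g1) //.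
have [|gs ggs] := IHk g' _ g0 gP; first by rewrite -ltnS (leq_trans _ sq) // sg.
have [|hs hhs] := IHk h' _ h0 hP; first by rewrite -ltnS (leq_trans _ sq).
by exists (gs ++ hs); rewrite Eq; apply: factorsM.
Qed.

End GaussLemma.

Lemma factorial_mpoly (K : fieldType) n : factorial_ring {mpoly K[n]}.
Proof.
apply: (@mpoly_idomain_ind K (fun R _ => factorial_ring R)); last 1 first.
- by move=> R _; apply: factorial_poly.
- move=> R S i j f g fK gK _ factR x x0.
  have [|ps [psP [u [v uv] E]]] := factR (g x).
    by apply: contraNneq x0 => gx0; rewrite -[x]gK gx0 rmorph0.
  have dE a b : dvdr (f a) b -> dvdr a (g b).
    by move=> [c ->]; exists (g c); rewrite rmorphM fK.
  have dE' a b : dvdr a (g b) -> dvdr (f a) b.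
    by move=> [c E']; exists (f c); rewrite -[b]gK E' rmorphM.
  exists (map f ps); split.
    move=> _ /mapP[p /psP[p0 p1 pM] ->]; split.
    + by apply: contraNneq p0 => fp0; rewrite -[p]fK fp0 rmorph0.
    + by move/dE; rewrite rmorph1.
    + by move=> a b /dE; rewrite rmorphM => /pM[]/dE'; [left|right].
  exists (f u); first by exists (f v); rewrite -rmorphM -uv rmorph1.
  by rewrite -[x]gK E rmorphM rmorph_prod big_map.
- move=> x x0; exists [::]; split=> //; exists x; last by rewrite big_nil mulr1.
  by exists x^-1; rewrite mulVf.
Qed.

(** * Subspaces and bilinear forms *)

Section Subspaces.
Variable K : fieldType.

Definition subspace (V : lmodType K) (S : V -> Prop) : Prop :=
  S 0 /\ forall c u v, S u -> S v -> S (c *: u + v).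

Section Closure.
Variables (V : lmodType K) (S : V -> Prop) (sS : subspace S).

Lemma subspaceD u v : S u -> S v -> S (u + v).
Proof. by move=> Su Sv; rewrite -[u]scale1r; case: sS => _; apply. Qed.

Lemma subspaceZ c u : S u -> S (c *: u).
Proof. by move=> Su; rewrite -[_ *: _]addr0; case: sS => S0; apply. Qed.

Lemma subspaceB u v : S u -> S v -> S (u - v).
Proof. by move=> Su Sv; rewrite -scaleN1r; apply: subspaceD => //; apply: subspaceZ. Qed.

Lemma subspace_sum (I : Type) (r : seq I) (Q : pred I) (F : I -> V) :
  (forall i, Q i -> S (F i)) -> S (\sum_(i <- r | Q i) F i).
Proof. by move=> SF; apply: big_ind => //; [case: sS|exact: subspaceD]. Qed.

End Closure.

(** A matrix of largest rank among those with rows in [S]. *)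
Lemma subspace_rowspace N (S : 'rV[K]_N -> Prop) : subspace S ->
  exists A : 'M[K]_N, forall v, S v <-> (v <= A)%MS.
Proof.
move=> sS.
pose Q r := `[< exists A : 'M[K]_N, \rank A = r /\ forall v, (v <= A)%MS -> S v >].
have Q0 : exists r, Q r.
  exists 0%N; apply/asboolP; exists 0; rewrite mxrank0; split=> // v.
  by rewrite submx0 => /eqP ->; case: sS.
have Qle r : Q r -> (r <= N)%N by move=> /asboolP[A [<- _]]; exact: rank_leq_row.
case: (ex_maxnP Q0 Qle) => r /asboolP[A [rA AS]] rmax.
exists A => v; split; last exact: AS.
move=> Sv; apply: contrapT => /negP vA.
have : Q (\rank (A + v)%MS).
  apply/asboolP; exists (A + v)%MS; split=> // w /sub_addsmxP[[a b] ->] /=.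
  apply: subspaceD => //; first by apply: AS; exact: submxMl.
  rewrite [b]mx11_scalar mul_scalar_mx; exact: subspaceZ.
move/rmax; rewrite leqNgt -rA => /negP; apply.
rewrite ltn_neqAle mxrankS ?addsmxSl // andbT.
apply: contra vA => /eqP rAv.
have : (A + v <= A)%MS by rewrite -(geq_leqif (mxrank_leqif_sup (addsmxSl A v))) rAv.
by rewrite addsmx_sub => /andP[].
Qed.

(** The form is a column of the cokernel of a matrix that spans [S]. *)
Lemma subspace_separation N (S : 'rV[K]_N -> Prop) v : subspace S -> ~ S v ->
  exists l : 'cV[K]_N, (forall s, S s -> s *m l = 0) /\ v *m l != 0.
Proof.
move=> sS Sv; have [A AS] := subspace_rowspace sS.
have : v *m cokermx A != 0.
  by apply/negP => /eqP vA; apply/Sv/AS; rewrite submxE vA.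
case/matrix0Pn => i [j vj]; exists (col j (cokermx A)); split.
  by move=> s /AS; rewrite submxE colE mulmxA => /eqP ->; rewrite mul0mx.
by apply/matrix0Pn; exists i, 0; rewrite colE mulmxA -colE mxE.
Qed.

Lemma subspace_separation_mx p q (S : 'M[K]_(p, q) -> Prop) v :
  subspace S -> ~ S v ->
  exists l : 'I_(p * q) -> K, (forall s, S s -> \sum_k mxvec s 0 k * l k = 0) /\
    \sum_k mxvec v 0 k * l k != 0.
Proof.
move=> [S0 SD] Sv.
have [||l [lS lv]] := @subspace_separation _ (fun u => S (vec_mx u)) (mxvec v).
- by split=> [|c x y Sx Sy]; rewrite ?linear0 ?linearP //; apply: SD.
- by rewrite mxvecK.
exists (fun k => l k 0); split=> [s Ss|].
  have /matrixP/(_ 0 0) : mxvec s *m l = 0 by apply: lS; rewrite mxvecK.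
  by rewrite !mxE.
apply: contraNneq lv => lv; apply/eqP/matrixP => i j; rewrite !ord1 !mxE.
exact: lv.
Qed.

End Subspaces.

Section BilinearForms.
Variables (K : fieldType) (N : nat) (b : 'rV[K]_N -> 'rV[K]_N -> K).
Hypothesis bl : forall y c u v, b (c *: u + v) y = c * b u y + b v y.
Hypothesis br : forall x c u v, b x (c *: u + v) = c * b x u + b x v.

Definition orthogonal_in (S T : 'rV[K]_N -> Prop) (x : 'rV[K]_N) : Prop :=
  S x /\ forall y, T y -> b x y = 0.

Lemma form_sumr x (I : finType) (c : I -> K) (F : I -> 'rV[K]_N) :
  b x (\sum_i c i *: F i) = \sum_i c i * b x (F i).
Proof.
have b0 : b x 0 = 0.
  by apply: (addrI (b x 0)); rewrite -{1}[b x 0]mul1r -br scale1r !addr0.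
by elim/big_rec2: _ => // i y1 y2 _ <-; rewrite br.
Qed.

Lemma form_suml x (I : finType) (c : I -> K) (F : I -> 'rV[K]_N) :
  b (\sum_i c i *: F i) x = \sum_i c i * b (F i) x.
Proof.
have b0 : b 0 x = 0.
  by apply: (addrI (b 0 x)); rewrite -{1}[b 0 x]mul1r -bl scale1r !addr0.
by elim/big_rec2: _ => // i y1 y2 _ <-; rewrite bl.
Qed.

Definition gram m d (A : 'M[K]_(m, N)) (B : 'M[K]_(d, N)) : 'M[K]_(m, d) :=
  \matrix_(i, j) b (row i A) (row j B).

Lemma gramM m d (u : 'rV[K]_m) (A : 'M[K]_(m, N)) (B : 'M[K]_(d, N)) j :
  (u *m gram A B) 0 j = b (u *m A) (row j B).
Proof.
by rewrite [u *m A]mulmx_sum_row form_suml mxE; apply: eq_bigr => i _; rewrite mxE.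
Qed.

Lemma orthogonal_in_gram m d (u : 'rV[K]_m) (A : 'M[K]_(m, N)) (B : 'M[K]_(d, N)) :
  u *m gram A B = 0 -> forall y, (y <= B)%MS -> b (u *m A) y = 0.
Proof.
move=> uAB y /submxP[w ->]; rewrite [w *m B]mulmx_sum_row form_sumr big1 // => i _.
by rewrite -gramM uAB mxE mulr0.
Qed.

Lemma gram_mulmx m d m' d' (a : 'M[K]_(m', m)) (c : 'M[K]_(d', d))
    (A : 'M[K]_(m, N)) (B : 'M[K]_(d, N)) :
  gram (a *m A) (c *m B) = a *m gram A B *m c^T.
Proof.
apply/matrixP => i j; rewrite mxE !row_mul.
rewrite [row j c *m B]mulmx_sum_row form_sumr mxE; apply: eq_bigr => k _.
rewrite -gramM !mxE mulrC; congr (_ * _); apply: eq_bigr => l _.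
by rewrite mxE.
Qed.

Variables (S T : 'rV[K]_N -> Prop) (sS : subspace S) (sT : subspace T).
Hypothesis TS : forall x, T x -> S x.

(** The Gram matrix of a basis of [T] is invertible, and gives the coordinates
    of the orthogonal projection onto [T]. *)
Lemma orthogonal_decomposition :
  (forall x, T x -> orthogonal_in S T x -> x = 0) ->
  forall x, S x -> exists y z, [/\ T y, orthogonal_in S T z & x = y + z].
Proof.
move=> T0 x Sx; have [A AT] := subspace_rowspace sT.
pose B := row_base A.
have BT v : T v <-> (v <= B)%MS by rewrite eq_row_base.
have Bu : gram B B \in unitmx.
  rewrite -row_free_unit -kermx_eq0.
  apply/eqP/row_matrixP => i; rewrite row0; set u := row i _.
  have uG : u *m gram B B = 0 by apply/sub_kermxP; exact: row_sub.
  have TuB : T (u *m B) by apply/BT/submxMl.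
  have : u *m B = 0.
    apply: (T0 _ TuB); split; first exact: TS.
    by move=> y /BT; apply: orthogonal_in_gram.
  by move/(canRL (mulmxKp (row_base_free A))); rewrite mul0mx.
pose y := (gram x B *m invmx (gram B B)) *m B.
have Ty : T y by apply/BT/submxMl.
exists y, (x - y); split=> //; last by rewrite addrC subrK.
split; first by apply: (subspaceB sS) => //; apply: TS.
move=> z /BT; have -> : x - y = 1%:M *m (x - y) by rewrite mul1mx.
apply: orthogonal_in_gram; rewrite mul1mx.
apply/rowP => j; rewrite !mxE !row_id.
have -> : b (x - y) (row j B) = gram x B 0 j - b y (row j B).
  by rewrite -[x - y]addrC -scaleN1r bl mulN1r addrC mxE row_id.
by rewrite -gramM mulmxKV // subrr.
Qed.

(** The Gram matrix between bases of [S] and of [T] has independent rows, so the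
    dimension of [S] is at most that of [T]. *)
Lemma orthogonal_eq0_full :
  (forall x, orthogonal_in S T x -> x = 0) -> forall x, S x -> T x.
Proof.
move=> T0; have [A AT] := subspace_rowspace sT; have [B BS] := subspace_rowspace sS.
have AB : (A <= B)%MS.
  by apply/row_subP => i; apply/BS/TS/AT; exact: row_sub.
have Bfree : row_free (gram (row_base B) (row_base A)).
  rewrite -kermx_eq0; apply/eqP/row_matrixP => i; rewrite row0; set u := row i _.
  have uG : u *m gram (row_base B) (row_base A) = 0.
    by apply/sub_kermxP; exact: row_sub.
  have : u *m row_base B = 0.
    apply: T0; split.
      by apply/BS; rewrite (submx_trans (submxMl _ _)) ?eq_row_base.
    by move=> y /AT; rewrite -(eq_row_base A); apply: orthogonal_in_gram.
  by move/(canRL (mulmxKp (row_base_free B))); rewrite mul0mx.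
have rBA : (\rank B <= \rank A)%N.
  by rewrite -(eqP Bfree) rank_leq_col.
have BA : (B <= A)%MS by rewrite -(geq_leqif (mxrank_leqif_sup AB)).
by move=> x /BS xB; apply/AT; apply: submx_trans xB BA.
Qed.

End BilinearForms.

(** * Nilpotent and triangular matrices, integer relations between eigenvalues *)

Definition nilpotent_mx (K : fieldType) m (A : 'M[K]_m) : Prop := exists k, A ^+ k = 0.

(** Fitting's decomposition: [E] projects onto the generalized kernel of [A]. It
    comes from Bezout's identity between the factors [h] and ['X^k] of the
    characteristic polynomial. *)
Lemma fitting (K : fieldType) m (A : 'M[K]_m) :
  exists E (d : nat) (s : nat -> K),
    [/\ E = 1 + \sum_(k < d) s k *: A ^+ k.+1, E * E = E &
        exists k, A ^+ k * E = 0].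
Proof.
case: m A => [|m] A.
  exists 1, 0%N, (fun=> 0); rewrite big_ord0 addr0 mulr1; split=> //.
  by exists 0; apply/matrixP; case.
have cp0 : char_poly A != 0 by rewrite monic_neq0 // char_poly_monic.
have [k [h]] := multiplicity_XsubC (char_poly A) 0.
rewrite cp0 subr0 => /= h0 cpE.
have /Bezout_eq1_coprimepP[[u v] /= uv] : coprimep h ('X ^+ k.+1).
  by rewrite coprimep_expr // coprimepX.
pose f : {rmorphism {poly K} -> 'M[K]_m.+1} := horner_mx A.
have fX : f 'X = A by exact: horner_mx_X.
have fZ c p : f (c *: p) = c *: f p by exact: linearZ.
have cpA : f (h * 'X^k) = 0 by rewrite -cpE; exact: Cayley_Hamilton.
pose w := v * 'X^k.
have fE : f (v * 'X^(k.+1)) = \sum_(i < size w) w`_i *: A ^+ i.+1.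
  have fM a b' : f (a * b') = f a * f b' by exact: rmorphM.
  rewrite exprS mulrCA -/w fM fX.
  rewrite -[w in LHS]coefK poly_def rmorph_sum mulr_sumr; apply: eq_bigr => i _.
  by rewrite fZ (rmorphXn f) fX -scalerAr exprS.
have Euh : 1 - f (v * 'X^(k.+1)) = f (u * h).
  by rewrite -(rmorph1 f) -uv -rmorphB addrK.
exists (f (u * h)), (size w), (fun i => - w`_i); split.
- rewrite -Euh fE; congr (_ + _); rewrite -sumrN; apply: eq_bigr => i _.
  by rewrite scaleNr.
- rewrite -{1}Euh mulrBl mul1r -rmorphM.
  have -> : v * 'X^(k.+1) * (u * h) = v * 'X * u * (h * 'X^k) by rewrite exprS; ring.
  by rewrite (rmorphM f (v * 'X * u) (h * 'X^k)) cpA mulr0 subr0.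
- exists k; have -> : A ^+ k = f 'X^k by rewrite (rmorphXn f) fX.
  have -> : f 'X^k * f (u * h) = f u * f (h * 'X^k) by rewrite -!rmorphM; congr (f _); ring.
  by rewrite cpA mulr0.
Qed.

Lemma idempotent_base (K : fieldType) m (E : 'M[K]_m) :
  E * E = E -> row_base E *m col_base E = 1%:M.
Proof.
move=> EE; apply: (row_free_inj (row_base_free E)).
apply: (row_full_inj (col_base_full E)).
rewrite mul1mx mulmx_base -mulmxA mulmxA mulmx_base.
exact: EE.
Qed.

Lemma mxtrace_idempotent (K : fieldType) m (E : 'M[K]_m) :
  E * E = E -> \tr E = (\rank E)%:R.
Proof.
by move/idempotent_base => RC; rewrite -{1}(mulmx_base E) mxtrace_mulC RC mxtrace1.
Qed.

(** The complement of Fitting's projection is a polynomial in [A] without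
    constant term, so its trace is 0; but it is also its rank. *)
Lemma nilpotent_of_traces (K : fieldType) (char0 : [pchar K] =i pred0) m
    (A : 'M[K]_m) :
  (forall k, \tr (A ^+ k.+1) = 0) -> nilpotent_mx A.
Proof.
move=> trA; have [E [d [s [EE Eid [k AE]]]]] := fitting A.
exists k; suff -> : A ^+ k = A ^+ k * E by [].
have E'id : (1 - E) * (1 - E) = 1 - E.
  by rewrite mulrBr mulr1 mulrBl mul1r Eid subrr subr0.
have : \tr (1 - E) = 0.
  rewrite EE opprD addNKr -scaleN1r mxtraceZ.
  elim/big_ind: _ => [|x y /eqP + /eqP|i _]; rewrite ?mxtrace0 ?mulr0 //.
    by rewrite mxtraceD mulrDr => /eqP -> /eqP ->; rewrite addr0.
  by rewrite mxtraceZ trA !mulr0.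
rewrite mxtrace_idempotent // => /eqP; move/pcharf0P : char0 => ->.
rewrite mxrank_eq0 subr_eq0 => /eqP E1.
by rewrite -E1 mulr1.
Qed.

Lemma invmx_mul (K : fieldType) n (A B : 'M[K]_n) :
  A \in unitmx -> B \in unitmx -> invmx (A *m B) = invmx B *m invmx A.
Proof.
move=> Au Bu; have ABu : A *m B \in unitmx by rewrite unitmx_mul Au.
have E : A *m B *m (invmx B *m invmx A) = 1%:M.
  by rewrite mulmxA mulmxK // mulmxV.
by rewrite -[LHS]mulmx1 -E mulKmx.
Qed.

Section Triangular.
Variable K : fieldType.

(** The part of the Jordan normal form that is needed: the matrix commutes with
    its diagonal, and differs from it by a nilpotent matrix. *)
Definition block_triangular n (M : 'M[K]_n) : Prop :=
  forall i j, M i j != 0 -> (i <= j)%N /\ M i i = M j j.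

Definition lower_block_triangular n (M : 'M[K]_n) : Prop :=
  forall i j, M i j != 0 -> (j <= i)%N /\ M i i = M j j.

End Triangular.

(** An eigenvector [v] with eigenvalue [a] splits off as a first row; the
    triangular form of the remaining block is known by induction, and the entries
    under [a] are cleared where the diagonal differs from [a]. *)
Lemma lower_block_triangularization (K : closedFieldType) n (X : 'M[K]_n) :
  exists2 P, P \in unitmx & lower_block_triangular (P *m X *m invmx P).
Proof.
elim: n X => [|n IHn] X.
  by exists 1%:M; [exact: unitmx1|case].
have [a] : exists a, root (char_poly X) a.
  by apply/closed_rootP; rewrite size_char_poly.
rewrite -eigenvalue_root_char => /eigenvalueP[v vX v0].
have rv : \rank v = 1%N by apply/eqP; rewrite rank_rV v0.
pose P := row_ebase v; have Pu : P \in unitmx by exact: row_ebase_unit.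
pose M : 'M_(1 + n) := P *m X *m invmx P.
have [c c0 vE] : exists2 c, c != 0 & v = c *: row 0 P.
  exists (col_ebase v 0 0).
    by have := col_ebase_unit v; rewrite unitmxE det_mx11 unitfE.
  rewrite -{1}(mulmx_ebase v) rv [col_ebase v]mx11_scalar mul_scalar_mx -scalemxAl.
  rewrite mxE; congr (_ *: _); apply/rowP => j; rewrite !mxE (bigD1 0) //= !mxE /=.
  rewrite mul1r big1 ?addr0 // => i; rewrite -val_eqE /= => i0.
  by rewrite !mxE /= eq_sym (negPf i0) mul0r.
have rP : row 0 P *m X = a *: row 0 P.
  move: vX; rewrite vE -scalemxAl scalerA mulrC -scalerA.
  exact: (scalerI c0).
have rM : row 0 M = a *: delta_mx 0 0.
  rewrite /M -mulmxA row_mul mulmxA rP -scalemxAl; congr (_ *: _).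
  by rewrite -row_mul mulmxV // row1.
have rMj j : M 0 j = a * (j == 0)%:R.
  by have /rowP/(_ j) := rM; rewrite [in X in X -> _]mxE => ->; rewrite !mxE.
have MP : M = P *m X *m invmx P by [].
clearbody M.
have M00 : ulsubmx M = a%:M.
  apply/matrixP => i j; rewrite !ord1 !mxE /= mulr1n.
  rewrite (_ : lshift n (0 : 'I_1) = (ord0 : 'I_(1 + n))); last exact: val_inj.
  by rewrite rMj eqxx mulr1.
have M01 : ursubmx M = 0.
  apply/matrixP => i j; rewrite !ord1 !mxE.
  rewrite (_ : lshift n (0 : 'I_1) = (ord0 : 'I_(1 + n))); last exact: val_inj.
  by rewrite rMj mulr0.
have ME : M = block_mx a%:M 0 (dlsubmx M) (drsubmx M).
  by rewrite -M00 -M01 submxK.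
set b := dlsubmx M in ME; set X' := drsubmx M in ME.
have [Q Qu] := IHn X'; set M' := Q *m X' *m invmx Q => M'tri.
have M'E : Q *m X' *m invmx Q = M' by [].
clearbody M'.
(* Conjugation by [1 0; c 1] clears the entries below [a] in the rows where
   [M'] has another diagonal entry. *)
pose D : 'M[K]_n := diag_mx (\row_i (M' i i != a)%:R).
pose A := (M' - a%:M) *m D + (1%:M - D).
have Aij i j : A i j = (M' i j - a *+ (i == j)) * (M' j j != a)%:R +
    ((i == j)%:R - (M' i i != a)%:R *+ (i == j)).
  rewrite !mxE (bigD1 j) //= !mxE eqxx mulr1n big1 ?addr0 // => k kj.
  by rewrite !mxE (negPf kj) mulr0n mulr0.
have Au : A \in unitmx.
  rewrite unitmxE det_trig; last first.
    apply/is_trig_mxP => i j ij; rewrite Aij.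
    have -> : (i == j) = false by apply/negbTE; rewrite neq_ltn ij.
    rewrite !mulr0n !subr0 addr0.
    have [->|/M'tri[]] := eqVneq (M' i j) 0; first by rewrite mul0r.
    by rewrite leqNgt ij.
  rewrite unitfE; apply/prodf_neq0 => i _; rewrite Aij eqxx mulr1n.
  have [->|nz] := eqVneq (M' i i) a; first by rewrite mulr0 add0r subr0 oner_eq0.
  by rewrite mulr1 subrr addr0 subr_eq0.
pose w := Q *m b; pose c' := D *m (invmx A *m w).
pose R : 'M_(1 + n) := block_mx 1%:M 0 c' 1%:M *m block_mx 1%:M 0 0 Q.
pose R' : 'M_(1 + n) := block_mx 1%:M 0 0 (invmx Q) *m block_mx 1%:M 0 (- c') 1%:M.
have RR' : R *m R' = 1%:M.
  rewrite /R /R' !mulmx_block !(mulmx0,mul0mx,mulmx1,mul1mx,addr0,add0r).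
  rewrite ?(mulmx0,mul0mx,mulmx1,mul1mx,addr0,add0r).
  by rewrite mulmxA mulmxV // mul1mx subrr scalar_mx_block.
have [Ru R'u] := mulmx1_unit RR'.
have RV : invmx R = R' by rewrite -[R']mul1mx -(mulVmx Ru) -mulmxA RR' mulmx1.
exists (R *m P : 'M_(1 + n)); first by rewrite unitmx_mul Ru.
have -> : R *m P *m X *m invmx (R *m P) =
    block_mx a%:M 0 ((1%:M - D) *m invmx A *m w) M'.
  rewrite (invmx_mul Ru Pu).
  have -> : R *m P *m X *m (invmx P *m invmx R) = R *m M *m R'.
    by rewrite RV MP !mulmxA.
  have -> : R = block_mx 1%:M 0 c' Q.
    by rewrite /R mulmx_block !(mulmx0,mul0mx,mulmx1,mul1mx,addr0,add0r).
  have -> : R' = block_mx 1%:M 0 (- (invmx Q *m c')) (invmx Q).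
    by rewrite /R' mulmx_block !(mulmx0,mul0mx,mulmx1,mul1mx,addr0,add0r) mulmxN.
  rewrite ME !mulmx_block !(mulmx0,mul0mx,mulmx1,mul1mx,addr0,add0r) M'E -/w.
  rewrite mul_mx_scalar mulmxN mulmxA M'E.
  congr (block_mx _ _ _ _).
  have -> : (1%:M - D) *m invmx A *m w = w - (M' - a%:M) *m c'.
    have -> : (M' - a%:M) *m c' = A *m (invmx A *m w) - (1%:M - D) *m (invmx A *m w).
      by rewrite -mulmxBl /A addrK /c' mulmxA.
    by rewrite [A *m _]mulmxA mulmxV // mul1mx opprB addrCA subrr addr0 -mulmxA.
  by rewrite mulmxBl mul_scalar_mx opprB addrA [w + _]addrC.
rewrite -[_.+1]/(1 + n)%N => i j.
case: (split_ordP i) => i' ->; case: (split_ordP j) => j' ->.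
- by rewrite !ord1.
- by rewrite block_mxEur mxE eqxx.
- rewrite block_mxEdl block_mxEdr block_mxEul !ord1 => nz; split=> //.
  rewrite mxE eqxx mulr1n; apply: contra_neq_eq nz => nz.
  rewrite -mulmxA mxE big1 // => k _; rewrite mxE [1%:M _ _]mxE [(- D) _ _]mxE [D _ _]mxE mxE.
  have [ik|ik] := eqVneq i' k; last by rewrite mulr0n subr0 mul0r.
  by rewrite nz subrr mul0r.
- rewrite !block_mxEdr => /M'tri[ji ->]; split=> //.
Qed.

Lemma block_triangularization (K : closedFieldType) n (X : 'M[K]_n) :
  exists2 P, P \in unitmx & block_triangular (invmx P *m X *m P).
Proof.
have [Q Qu Qtri] := lower_block_triangularization X^T.
exists Q^T; first by rewrite unitmx_tr.
move=> i j.
have -> : invmx Q^T *m X *m Q^T = (Q *m X^T *m invmx Q)^T.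
  by rewrite !trmx_mul trmxK trmx_inv mulmxA.
by rewrite ![_^T _ _]mxE => nz; have [ij ->] := Qtri _ _ nz.
Qed.

Lemma block_triangular_exp (K : fieldType) n (M : 'M[K]_n) k :
  block_triangular M -> (forall i j : 'I_n, (j < i)%N -> (M ^+ k) i j = 0) /\
  forall i, (M ^+ k) i i = M i i ^+ k.
Proof.
move=> Mtri; have diag0 (i j : 'I_n) : (j < i)%N -> M i j = 0.
  by move=> ji; apply: contraTeq ji => /Mtri[ij _]; rewrite -leqNgt.
elim: k => [|k [IHtri IHdiag]].
  split=> [i j ji|i]; last by rewrite expr0 mxE eqxx.
  by rewrite expr0 mxE; case: eqVneq ji => // ->; rewrite ltnn.
split=> [i j ji|i]; rewrite exprS mxE.
  apply: big1 => l _; have [il|il] := ltnP l i; first by rewrite diag0 ?mul0r.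
  by rewrite IHtri ?mulr0 // (leq_trans ji il).
rewrite (bigD1 i) //= IHdiag exprS big1 ?addr0 // => l li.
have [il|il] := ltnP i l; first by rewrite IHtri ?mulr0.
by rewrite diag0 ?mul0r // ltn_neqAle il andbT.
Qed.

Lemma conjmx_exp (K : fieldType) n (P X : 'M[K]_n) k : P \in unitmx ->
  (invmx P *m X *m P) ^+ k = invmx P *m X ^+ k *m P.
Proof.
move=> Pu; elim: k => [|k IHk]; first by rewrite !expr0 -[1]/(1%:M) mulmx1 mulVmx.
rewrite !exprS IHk -[RHS]/(invmx P *m (X *m X ^+ k) *m P).
rewrite -[LHS]/(invmx P *m X *m P *m (invmx P *m X ^+ k *m P)).
by rewrite !mulmxA mulmxK.
Qed.

Lemma mxtrace_nilpotent (K : closedFieldType) n (X : 'M[K]_n) :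
  nilpotent_mx X -> \tr X = 0.
Proof.
move=> [k Xk]; have [P Pu Ptri] := block_triangularization X.
have -> : \tr X = \tr (invmx P *m X *m P) by rewrite mxtrace_mulC mulmxA mulmxV ?mul1mx.
apply: big1 => i _; apply/eqP.
have [_ /(_ i)] := block_triangular_exp k Ptri.
rewrite conjmx_exp // Xk mulmx0 mul0mx mxE => /esym/eqP.
by rewrite expf_eq0 => /andP[].
Qed.

Lemma block_triangular_nilpotent (K : fieldType) n (M : 'M[K]_n) :
  block_triangular M -> (forall i, M i i = 0) -> M ^+ n = 0.
Proof.
move=> Mtri M0.
have diag0 (i j : 'I_n) : (j <= i)%N -> M i j = 0.
  rewrite leq_eqVlt => /orP[/eqP/val_inj ->|ji]; first exact: M0.
  by apply: contraTeq ji => /Mtri[ij _]; rewrite -leqNgt.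
have Mk k (i j : 'I_n) : (j < i + k)%N -> (M ^+ k) i j = 0.
  elim: k i j => [|k IHk] i j ji.
    by rewrite expr0 mxE; case: eqVneq ji => // ->; rewrite addn0 ltnn.
  rewrite exprS mxE; apply: big1 => l _.
  have [il|il] := leqP l i; first by rewrite diag0 ?mul0r.
  by rewrite IHk ?mulr0 // (leq_trans ji) // addnS -addSn leq_add2r.
by apply/matrixP => i j; rewrite Mk ?mxE // (leq_trans (ltn_ord j)) // leq_addl.
Qed.

Section IntegerRelations.
Variables (K : fieldType) (char0 : [pchar K] =i pred0).

Lemma intr_eq0_char0 (z : int) : z%:~R = 0 :> K -> z = 0.
Proof.
have natP k : k%:R = 0 :> K -> k = 0%N.
  by move/pcharf0P : char0 => E /eqP; rewrite E => /eqP.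
case: z => k; first by move/natP => ->.
by rewrite NegzE mulrNz => /eqP; rewrite oppr_eq0 => /eqP/natP.
Qed.

Variables (n : nat) (lam : 'I_n -> K).

Definition relation (k : 'I_n -> int) : Prop := \sum_i (k i)%:~R * lam i = 0.

Definition relation_orthogonal (q : 'I_n -> int) : Prop :=
  forall k, relation k -> \sum_i k i * q i = 0.

Lemma common_denominator (v : 'I_n -> rat) :
  exists (d : int) (k : 'I_n -> int), d != 0 /\ forall i, d%:~R * v i = (k i)%:~R.
Proof.
exists (\prod_i denq (v i)), (fun i => numq (v i) * \prod_(j | j != i) denq (v j)).
split=> [|i]; first by apply/prodf_neq0 => i _; exact: denq_neq0.
rewrite (bigD1 i) //= !rmorphM /= -[X in _ * X](divq_num_den (v i)).
by field; rewrite intr_eq0 denq_neq0.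
Qed.

(** The integer relations generate a rational subspace. When nothing but 0 is
    orthogonal to it, it is the whole space, so that a nonzero multiple of each
    unit vector is a relation. *)
Lemma relation_orthogonal_eq0 :
  (forall q, relation_orthogonal q -> forall i, q i = 0) -> forall i, lam i = 0.
Proof.
move=> q0.
pose S (v : 'rV[rat]_n) := exists (d : int) (k : 'I_n -> int),
  [/\ d != 0, relation k & forall i, d%:~R * v 0 i = (k i)%:~R].
have sS : subspace S.
  split=> [|c u v [d [k [d0 rk du]]] [e [l [e0 rl ev]]]].
    exists 1, (fun=> 0); split=> // [|i]; last by rewrite mxE mulr0.
    by apply: big1 => i _; rewrite mul0r.
  exists (denq c * d * e), (fun i => numq c * e * k i + denq c * d * l i); split.
  - by rewrite !mulf_neq0 ?denq_neq0.
  - rewrite /relation (eq_bigr (fun i => (numq c * e)%:~R * ((k i)%:~R * lam i) +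
      (denq c * d)%:~R * ((l i)%:~R * lam i))); last first.
      by move=> i _; rewrite !rmorphD /= !rmorphM /=; ring.
    by rewrite big_split -!mulr_sumr /= rk rl !mulr0 addr0.
  - move=> i; rewrite !mxE rmorphD !rmorphM /= -du -ev.
    have cE : (numq c)%:~R = (denq c)%:~R * c :> rat.
      by rewrite -[X in _ * X](divq_num_den c) mulrC divfK // intr_eq0 denq_neq0.
    by rewrite cE; ring.
have [A AS] := subspace_rowspace sS.
have Afull : row_full A.
  rewrite -cokermx_eq0; apply/eqP/matrixP => i j; rewrite [RHS]mxE.
  have [d [q [d0 dq]]] := common_denominator (fun i => cokermx A i j).
  have qorth : relation_orthogonal q.
    move=> k rk; have : S (\row_i (k i)%:~R).
      by exists 1, k; split=> // l; rewrite mxE mul1r.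
    move/AS; rewrite submxE => /eqP/matrixP/(_ 0 j); rewrite !mxE => E.
    apply: (@intr_inj rat); rewrite rmorph_sum /= rmorph0.
    transitivity (d%:~R * 0 : rat); last by rewrite mulr0.
    rewrite -[in RHS]E mulr_sumr.
    by apply: eq_bigr => l _; rewrite mxE rmorphM /= -dq; ring.
  have := dq i; rewrite (q0 _ qorth) => /eqP; rewrite mulf_eq0 intr_eq0 (negPf d0).
  by move/eqP.
move=> i; have : S (delta_mx 0 i) by apply/AS; exact: submx_full.
move=> [d [k [d0 rk dk]]]; move: rk; rewrite /relation (bigD1 i) //= big1; last first.
  move=> j ji; have := dk j; rewrite mxE (negPf ji) andbF mulr0 => /esym/eqP.
  by rewrite intr_eq0 => /eqP ->; rewrite mul0r.
have := dk i; rewrite mxE !eqxx mulr1 => /intr_inj <-; rewrite addr0 => /eqP.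
by rewrite mulf_eq0 => /orP[/eqP/intr_eq0_char0/eqP|/eqP //]; rewrite (negPf d0).
Qed.

End IntegerRelations.

(** * Polynomial functions of a matrix and their derivatives *)

Lemma mpoly_generated n (R : comNzRingType) (Q : {mpoly R[n]} -> Prop) :
  (forall c, Q c%:MP) -> (forall i, Q 'X_i) ->
  (forall p q, Q p -> Q q -> Q (p + q)) -> (forall p q, Q p -> Q q -> Q (p * q)) ->
  forall p, Q p.
Proof.
move=> QC QX QD QM p.
have Q1 : Q 1 by rewrite -mpolyC1.
have QXn i k : Q ('X_i ^+ k).
  by elim: k => [|k IHk] //; rewrite exprS; apply: QM.
elim/mpolyind: p => [|a m p _ _ IHp]; first by rewrite -mpolyC0.
apply: QD => //; rewrite -mul_mpolyC; apply: (QM) => //; rewrite mpolyXE_id.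
by apply: (big_ind Q) => [//|x y|i _]; [exact: QM|exact: QXn].
Qed.

Lemma poly_ext (K : idomainType) (char0 : [pchar K] =i pred0) (P Q : {poly K}) :
  (forall k : nat, P.[k%:R] = Q.[k%:R]) -> P = Q.
Proof.
move=> PQ; apply/eqP; rewrite -subr_eq0; apply: contrapT => /negP nz.
have [k] := exists_nonroot char0 nz.
by rewrite hornerD hornerN PQ subrr eqxx.
Qed.

Lemma mpoly_ext (K : closedFieldType) (char0 : [pchar K] =i pred0) n
    (p q : {mpoly K[n]}) : (forall v, p.@[v] = q.@[v]) -> p = q.
Proof.
move=> pq; apply/eqP; rewrite -subr_eq0; apply: contrapT => /negP nz.
have [||v [_]] := @nullstellensatz K char0 n (fun x => x = 0) (p - q).
- split=> [||x y /eqP]; first split=> [//|x y -> ->|x y ->]; rewrite ?addr0 ?mulr0 //.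
    by move/eqP; rewrite oner_eq0.
  by rewrite mulf_eq0 => /orP[] /eqP; [left|right].
- by apply/eqP.
by rewrite mevalB pq subrr eqxx.
Qed.

Section PolynomialFunctions.
Variables (K : fieldType) (n : nat).
Local Notation peval_mx := (@peval_mx K n).

(** The polynomial is hidden in an existential, so that compositions,
    determinants and adjugates are handled without formulas. *)
Definition polyfun (f : 'M[K]_n -> K) : Prop :=
  exists p : {mpoly K[n * n]}, forall g, f g = peval_mx p g.

Lemma polyfun_eq f h : (forall g, f g = h g) -> polyfun f -> polyfun h.
Proof. by move=> fh [p pf]; exists p => g; rewrite -fh. Qed.

Lemma polyfun_peval p : polyfun (peval_mx p).
Proof. by exists p. Qed.

Lemma polyfun_const c : polyfun (fun=> c).
Proof. by exists c%:MP => g; rewrite /Defs.peval_mx mevalC. Qed.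

Lemma polyfun_coord i j : polyfun (fun g => g i j).
Proof. by exists 'X_(mxvec_index i j) => g; rewrite /Defs.peval_mx mevalXU mxvecE. Qed.

Lemma polyfunD f h : polyfun f -> polyfun h -> polyfun (fun g => f g + h g).
Proof. by move=> [p pf] [q qh]; exists (p + q) => g; rewrite pf qh /Defs.peval_mx mevalD. Qed.

Lemma polyfunM f h : polyfun f -> polyfun h -> polyfun (fun g => f g * h g).
Proof. by move=> [p pf] [q qh]; exists (p * q) => g; rewrite pf qh /Defs.peval_mx mevalM. Qed.

Lemma polyfunZ c f : polyfun f -> polyfun (fun g => c * f g).
Proof. by apply: polyfunM; exact: polyfun_const. Qed.

Lemma polyfunB f h : polyfun f -> polyfun h -> polyfun (fun g => f g - h g).
Proof. by move=> [p pf] [q qh]; exists (p - q) => g; rewrite pf qh /Defs.peval_mx mevalB. Qed.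

Lemma polyfun_sum (I : Type) (r : seq I) (P : pred I) F :
  (forall i, P i -> polyfun (F i)) -> polyfun (fun g => \sum_(i <- r | P i) F i g).
Proof.
move=> PF; elim: r => [|i r IHr].
  by apply: polyfun_eq (polyfun_const 0) => g; rewrite big_nil.
case Pi : (P i); last by apply: polyfun_eq IHr => g; rewrite big_cons Pi.
by apply: polyfun_eq (polyfunD (PF i Pi) IHr) => g; rewrite big_cons Pi.
Qed.

Lemma polyfun_prod (I : Type) (r : seq I) (P : pred I) F :
  (forall i, P i -> polyfun (F i)) -> polyfun (fun g => \prod_(i <- r | P i) F i g).
Proof.
move=> PF; elim: r => [|i r IHr].
  by apply: polyfun_eq (polyfun_const 1) => g; rewrite big_nil.
case Pi : (P i); last by apply: polyfun_eq IHr => g; rewrite big_cons Pi.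
by apply: polyfun_eq (polyfunM (PF i Pi) IHr) => g; rewrite big_cons Pi.
Qed.

Lemma polyfun_meval N (p : {mpoly K[N]}) (c : 'I_N -> 'M[K]_n -> K) :
  (forall i, polyfun (c i)) -> polyfun (fun g => p.@[fun i => c i g]).
Proof.
move=> cP; elim/mpoly_generated: p => [a|i|p q IHp IHq|p q IHp IHq].
- by apply: polyfun_eq (polyfun_const a) => g; rewrite mevalC.
- by apply: polyfun_eq (cP i) => g; rewrite mevalXU.
- by apply: polyfun_eq (polyfunD IHp IHq) => g; rewrite mevalD.
- by apply: polyfun_eq (polyfunM IHp IHq) => g; rewrite mevalM.
Qed.

Definition polymap p q (F : 'M[K]_n -> 'M[K]_(p, q)) : Prop :=
  forall i j, polyfun (fun g => F g i j).

Lemma polyfun_comp f (F : 'M[K]_n -> 'M[K]_n) :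
  polyfun f -> polymap F -> polyfun (fun g => f (F g)).
Proof.
move=> [p pf] FP.
apply: (polyfun_eq (fun g => esym (pf (F g)))); rewrite /Defs.peval_mx.
apply: (@polyfun_meval _ p (fun k g => mxvec (F g) 0 k)) => k.
by case/mxvec_indexP: k => i j; apply: polyfun_eq (FP i j) => g; rewrite mxvecE.
Qed.

Lemma polymap_id : polymap id.
Proof. exact: polyfun_coord. Qed.

Lemma polymap_const p q (A : 'M[K]_(p, q)) : polymap (fun=> A).
Proof. by move=> i j; exact: polyfun_const. Qed.

Lemma polymap_mul p q r (F : 'M[K]_n -> 'M[K]_(p, q)) (H : 'M[K]_n -> 'M[K]_(q, r)) :
  polymap F -> polymap H -> polymap (fun g => F g *m H g).
Proof.
move=> FP HP i j; apply: polyfun_eq (fun g => esym (mxE _ _ _ _)) _.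
by apply: polyfun_sum => k _; apply: polyfunM; [exact: FP|exact: HP].
Qed.

Lemma polymap_comp p q (F : 'M[K]_n -> 'M[K]_(p, q)) (H : 'M[K]_n -> 'M[K]_n) :
  polymap F -> polymap H -> polymap (fun g => F (H g)).
Proof. by move=> FP HP i j; apply: (polyfun_comp (FP i j) HP). Qed.

Lemma polyfun_det p (F : 'M[K]_n -> 'M[K]_p) : polymap F -> polyfun (fun g => \det (F g)).
Proof.
move=> FP; apply: polyfun_sum => s _; apply: polyfunZ.
by apply: polyfun_prod => i _; exact: FP.
Qed.

Lemma polymap_adj : polymap (fun g : 'M[K]_n => \adj g).
Proof.
move=> i j; apply: polyfun_eq (fun g => esym (mxE _ _ _ _)) _.
apply: polyfunZ; apply: polyfun_det => k l.
by apply: polyfun_eq (polyfun_coord (lift j k) (lift i l)) => g; rewrite !mxE.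
Qed.

Lemma polymap_conj (g h : 'M[K]_n) : polymap (fun x => g *m x *m h).
Proof.
apply: polymap_mul; last exact: polymap_const.
by apply: polymap_mul; [exact: polymap_const|exact: polymap_id].
Qed.

(** A directional derivative, read off from the restriction of [f] to a line; as
    a relation, it does not involve a polynomial representing [f]. *)
Definition deriv_at (f : 'M[K]_n -> K) (g y : 'M[K]_n) (d : K) : Prop :=
  exists P : {poly K}, (forall t, P.[t] = f (g + t *: y)) /\ P^`().[0] = d.

Lemma deriv_at_eq f h g y d : (forall x, f x = h x) ->
  deriv_at f g y d -> deriv_at h g y d.
Proof. by move=> fh [P [Pf Pd]]; exists P; split=> // t; rewrite -fh. Qed.

Lemma deriv_at_const c g y : deriv_at (fun=> c) g y 0.
Proof. by exists c%:P; split=> [t|]; rewrite ?hornerC // derivC horner0. Qed.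

Lemma deriv_atD f h g y d e : deriv_at f g y d -> deriv_at h g y e ->
  deriv_at (fun x => f x + h x) g y (d + e).
Proof.
move=> [P [Pf <-]] [Q [Qh <-]]; exists (P + Q); split=> [t|].
  by rewrite hornerD Pf Qh.
by rewrite derivD hornerD.
Qed.

Lemma deriv_atM f h g y d e : deriv_at f g y d -> deriv_at h g y e ->
  deriv_at (fun x => f x * h x) g y (d * h g + f g * e).
Proof.
move=> [P [Pf <-]] [Q [Qh <-]]; exists (P * Q); split=> [t|].
  by rewrite hornerM Pf Qh.
rewrite derivM hornerD !hornerM; congr (_ * _ + _ * _).
  by rewrite Qh scale0r addr0.
by rewrite Pf scale0r addr0.
Qed.

Lemma deriv_atZ c f g y d : deriv_at f g y d -> deriv_at (fun x => c * f x) g y (c * d).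
Proof.
move=> [P [Pf <-]]; exists (c *: P); split=> [t|]; first by rewrite hornerZ Pf.
by rewrite derivZ hornerZ.
Qed.

Lemma deriv_atB f h g y d e : deriv_at f g y d -> deriv_at h g y e ->
  deriv_at (fun x => f x - h x) g y (d - e).
Proof.
move=> fd /(deriv_atZ (-1)) he; rewrite -mulN1r; apply: deriv_at_eq (deriv_atD fd he).
by move=> x; rewrite mulN1r.
Qed.

Lemma deriv_at_sum (I : Type) (r : seq I) F (d : I -> K) g y :
  (forall i, deriv_at (F i) g y (d i)) ->
  deriv_at (fun x => \sum_(i <- r) F i x) g y (\sum_(i <- r) d i).
Proof.
move=> Fd; elim: r => [|i r IHr].
  by rewrite big_nil; apply: deriv_at_eq (deriv_at_const 0 g y) => x; rewrite big_nil.
rewrite big_cons; apply: deriv_at_eq (deriv_atD (Fd i) IHr) => x.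
by rewrite big_cons.
Qed.

Lemma deriv_at_coord i j g y : deriv_at (fun x => x i j) g y (y i j).
Proof.
exists ((g i j)%:P + y i j *: 'X); split=> [t|].
  by rewrite hornerD hornerC hornerZ hornerX !mxE mulrC.
by rewrite derivD derivC derivZ derivX add0r hornerZ hornerC mulr1.
Qed.

Lemma deriv_at_line f (F : 'M[K]_n -> 'M[K]_n) g y z d :
  (forall t, F (g + t *: y) = F g + t *: z) ->
  deriv_at f (F g) z d -> deriv_at (fun x => f (F x)) g y d.
Proof. by move=> Fz [P [Pf Pd]]; exists P; split=> // t; rewrite Pf Fz. Qed.

Definition directional (p : {mpoly K[n * n]}) (g y : 'M[K]_n) : K :=
  \sum_i peval_mx (p^`M(i)) g * mxvec y 0 i.

Lemma deriv_at_peval p g y : deriv_at (peval_mx p) g y (directional p g y).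
Proof.
rewrite /directional; elim/mpoly_generated: p => [c|i|p q IHp IHq|p q IHp IHq].
- rewrite big1 => [|i _]; last by rewrite mderivC /Defs.peval_mx meval0 mul0r.
  by apply: deriv_at_eq (deriv_at_const c g y) => x; rewrite /Defs.peval_mx mevalC.
- rewrite (bigD1 i) //= big1 => [|j ji]; last first.
    by rewrite mderivX mnm1E eq_sym (negPf ji) scale0r /Defs.peval_mx meval0 mul0r.
  rewrite mderivX mnm1E eqxx scale1r addr0.
  have -> : (U_(i) - U_(i) = 0)%MM by apply/mnmP => j; rewrite mnmBE subnn mnm0E.
  rewrite mpolyX0 /Defs.peval_mx meval1 mul1r.
  case/mxvec_indexP: i => a b; rewrite mxvecE.
  by apply: deriv_at_eq (deriv_at_coord a b g y) => x; rewrite mevalXU mxvecE.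
- have -> : \sum_i peval_mx (p + q)^`M(i) g * mxvec y 0 i =
      directional p g y + directional q g y.
    rewrite -big_split; apply: eq_bigr => i _.
    by rewrite mderivD /Defs.peval_mx mevalD mulrDl.
  by apply: deriv_at_eq (deriv_atD IHp IHq) => x; rewrite /Defs.peval_mx mevalD.
- have -> : \sum_i peval_mx (p * q)^`M(i) g * mxvec y 0 i =
      directional p g y * peval_mx q g + peval_mx p g * directional q g y.
    rewrite mulr_suml mulr_sumr -big_split; apply: eq_bigr => i _.
    by rewrite mderivM /Defs.peval_mx mevalD !mevalM /=; ring.
  by apply: deriv_at_eq (deriv_atM IHp IHq) => x; rewrite /Defs.peval_mx mevalM.
Qed.

Lemma polyfun_deriv_at f g y : polyfun f -> exists d, deriv_at f g y d.
Proof.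
move=> [p pf]; exists (directional p g y).
by apply: deriv_at_eq (deriv_at_peval p g y) => x; rewrite pf.
Qed.

Definition coordinate_mul (x : 'M[K]_n) (i : 'I_(n * n)) : {mpoly K[n * n]} :=
  \sum_j (lin_mulmxr x j i) *: 'X_j.

(** The left-invariant vector field with value [x] at the identity. *)
Definition linv_deriv (x : 'M[K]_n) (p : {mpoly K[n * n]}) : {mpoly K[n * n]} :=
  \sum_i p^`M(i) * coordinate_mul x i.

Lemma peval_coordinate_mul x i g : peval_mx (coordinate_mul x i) g = mxvec (g *m x) 0 i.
Proof.
rewrite -[g *m x]/(mulmxr x g) -[X in mulmxr x X]mxvecK -(mul_rV_lin (mulmxr x)) mxE.
rewrite /Defs.peval_mx raddf_sum; apply: eq_bigr => j _ /=.
by rewrite mevalZ mevalXU mulrC.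
Qed.

Lemma peval_linv_deriv x p g : peval_mx (linv_deriv x p) g = directional p g (g *m x).
Proof.
rewrite {1}/Defs.peval_mx raddf_sum; apply: eq_bigr => i _ /=.
by rewrite mevalM -peval_coordinate_mul.
Qed.

Lemma linv_deriv_linear x c p q :
  linv_deriv x (c *: p + q) = c *: linv_deriv x p + linv_deriv x q.
Proof.
rewrite /linv_deriv scaler_sumr -big_split; apply: eq_bigr => i _.
by rewrite mderivD mderivZ mulrDl scalerAl.
Qed.

HB.instance Definition _ x := GRing.isLinear.Build K {mpoly K[n * n]} {mpoly K[n * n]}
  _ (linv_deriv x) (linv_deriv_linear x).

Lemma linv_derivM x p q :
  linv_deriv x (p * q) = linv_deriv x p * q + p * linv_deriv x q.
Proof.
rewrite /linv_deriv mulr_suml mulr_sumr -big_split; apply: eq_bigr => i _ /=.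
by rewrite mderivM; ring.
Qed.

Lemma linv_derivC x c : linv_deriv x c%:MP = 0.
Proof. by apply: big1 => i _; rewrite mderivC mul0r. Qed.

End PolynomialFunctions.

Lemma deriv_at_unique (K : closedFieldType) (char0 : [pchar K] =i pred0) n
    (f : 'M[K]_n -> K) g y d e : deriv_at f g y d -> deriv_at f g y e -> d = e.
Proof.
move=> [P [Pf <-]] [Q [Qf <-]]; congr (_^`().[0]).
by apply: poly_ext => // k; rewrite Pf Qf.
Qed.

(** * The Lie algebra of the group and the differential of a representation *)

Section LieAlgebra.
Variables (K : closedFieldType) (char0 : [pchar K] =i pred0) (n : nat).
Variables (G : set 'M[K]_n) (G_group : algebraic_group G).
Hypothesis G_nochar : no_nontrivial_characters G.
Local Notation peval_mx := (@peval_mx K n).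

Lemma group1 : G 1%:M. Proof. by case: G_group. Qed.

Lemma groupM g h : G g -> G h -> G (g *m h). Proof. by case: G_group => _ _ + _; apply. Qed.

Lemma groupV g : G g -> G (invmx g). Proof. by case: G_group => _ _ _; apply. Qed.

Lemma group_unitmx g : G g -> g \in unitmx.
Proof. by case: G_group => -[Z _ ->] _ _ _ []. Qed.

Lemma mulmx_groupV g : G g -> g *m invmx g = 1%:M.
Proof. by move/group_unitmx/mulmxV. Qed.

Lemma mulmx_Vgroup g : G g -> invmx g *m g = 1%:M.
Proof. by move/group_unitmx/mulVmx. Qed.

(** The determinant is a character. *)
Lemma group_det1 g : G g -> \det g = 1.
Proof.
apply: G_nochar; split.
- by move=> h /group_unitmx; rewrite unitmxE unitfE.
- by move=> h k _ _; rewrite det_mulmx.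
- have [p pE] := polyfun_det (@polymap_id K n).
  by exists p, 0%N => h _; rewrite pE expr0 divr1.
Qed.

Lemma group_adj g : G g -> invmx g = \adj g.
Proof.
move=> Gg; rewrite /invmx group_unitmx // group_det1 //.
by rewrite invr1 scale1r.
Qed.

Definition vanishing (p : {mpoly K[n * n]}) : Prop := forall g, G g -> peval_mx p g = 0.

Lemma vanishing_ideal : ideal vanishing.
Proof.
split=> [g _|p q vp vq g Gg|p q vq g Gg]; rewrite /Defs.peval_mx.
- by rewrite meval0.
- by rewrite mevalD [X in X + _]vp // [X in _ + X]vq // addr0.
- by rewrite mevalM [X in _ * X]vq // mulr0.
Qed.

Lemma vanishing_subspace : subspace vanishing.
Proof.
have [v0 vD vM] := vanishing_ideal.
by split=> // c p q vp vq; apply: vD => //; rewrite -mul_mpolyC; apply: vM.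
Qed.

(** Since the determinant is 1, the group is closed in the space of all
    matrices. *)
Lemma group_of_vanishing g : (forall p, vanishing p -> peval_mx p g = 0) -> G g.
Proof.
move=> vg; have [[Z [S ZE] GE] _ _ _] := G_group; rewrite GE; split.
  rewrite ZE => p Sp; apply: vg => h; rewrite GE ZE => -[+ _]; exact.
have [p pE] := polyfunB (polyfun_det (@polymap_id K n)) (polyfun_const n 1).
rewrite /= unitmxE; have : peval_mx p g = 0.
  by apply: vg => h Gh; rewrite -pE group_det1 // subrr.
by rewrite -pE => /eqP; rewrite subr_eq0 => /eqP ->; rewrite unitr1.
Qed.

(** The tangent space of the group at the identity. *)
Definition lie (x : 'M[K]_n) : Prop :=
  forall p, vanishing p -> directional p 1%:M x = 0.

Lemma directional_linear p (g : 'M[K]_n) c (x y : 'M[K]_n) :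
  directional p g (c *: x + y) = c * directional p g x + directional p g y.
Proof.
rewrite /directional mulr_sumr -big_split; apply: eq_bigr => i _ /=.
by rewrite linearP !mxE; ring.
Qed.

Lemma directional0 p (g : 'M[K]_n) : directional p g 0 = 0.
Proof. by apply: big1 => i _; rewrite linear0 mxE mulr0. Qed.

Lemma lie_subspace : subspace lie.
Proof.
split=> [p _|c x y Lx Ly p vp]; first exact: directional0.
by rewrite directional_linear Lx // Ly // mulr0 addr0.
Qed.

Lemma lie_deriv_at f x d : lie x -> polyfun f -> (forall g, G g -> f g = 0) ->
  deriv_at f 1%:M x d -> d = 0.
Proof.
move=> Lx [p pf] fG fd; rewrite -(Lx p); last by move=> g Gg; rewrite -pf fG.
apply: (deriv_at_unique char0 fd).
by apply: deriv_at_eq (deriv_at_peval p 1%:M x) => y; rewrite pf.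
Qed.

(** Left translations by group elements preserve the ideal of the group. *)
Lemma linv_deriv_vanishing x p : lie x -> vanishing p -> vanishing (linv_deriv x p).
Proof.
move=> Lx vp g Gg; rewrite peval_linv_deriv.
apply: (@lie_deriv_at (fun h => peval_mx p (g *m h)) x) => //.
- apply: polyfun_comp; first exact: polyfun_peval.
  by apply: polymap_mul; [exact: polymap_const|exact: polymap_id].
- by move=> h Gh; apply/vp/groupM.
- apply: (deriv_at_line (z := g *m x)); last by rewrite mulmx1; exact: deriv_at_peval.
  by move=> t; rewrite mulmxDr -scalemxAr.
Qed.

Lemma lie_conj g x : G g -> lie x -> lie (g *m x *m invmx g).
Proof.
move=> Gg Lx p vp.
apply: (@lie_deriv_at (fun h => peval_mx p (g *m h *m invmx g)) x) => //.
- apply: polyfun_comp; first exact: polyfun_peval.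
  exact: polymap_conj.
- by move=> h Gh; apply: vp; apply: groupM; [exact: groupM|exact: groupV].
- apply: (deriv_at_line (z := g *m x *m invmx g)).
    by move=> t; rewrite mulmxDr mulmxDl -scalemxAr -scalemxAl.
  by rewrite mulmx1 mulmx_groupV //; exact: deriv_at_peval.
Qed.

Section Representation.
Variables (m : nat) (R : 'I_m -> 'I_m -> {mpoly K[n * n]}).

Definition rep_at (g : 'M[K]_n) : 'M[K]_m := \matrix_(i, j) peval_mx (R i j) g.

Definition drep (x : 'M[K]_n) : 'M[K]_m := \matrix_(i, j) directional (R i j) 1%:M x.

Definition multiplicative_rep : Prop :=
  forall g h, G g -> G h -> rep_at (g *m h) = rep_at g *m rep_at h.

Hypothesis R_mul : multiplicative_rep.

Lemma drep_linear c x y : drep (c *: x + y) = c *: drep x + drep y.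
Proof. by apply/matrixP => i j; rewrite !mxE directional_linear. Qed.

Lemma polymap_rep_at : polymap rep_at.
Proof. by move=> i j; exists (R i j) => g; rewrite mxE. Qed.

Lemma deriv_at_rep x i j : deriv_at (fun h => rep_at h i j) 1%:M x (drep x i j).
Proof.
rewrite mxE; apply: deriv_at_eq (deriv_at_peval (R i j) 1%:M x) => h.
by rewrite mxE.
Qed.

Lemma deriv_at_rep_mul (A : 'M[K]_m) (B : 'M[K]_m) x i j :
  deriv_at (fun h => (A *m rep_at h *m B) i j) 1%:M x ((A *m drep x *m B) i j).
Proof.
have E C : (A *m C *m B) i j = \sum_k \sum_l (A i l * B k j) * C l k.
  rewrite mxE; apply: eq_bigr => k _; rewrite mxE mulr_suml; apply: eq_bigr => l _.
  by ring.
rewrite E; apply: deriv_at_eq (fun h => esym (E (rep_at h))) _.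
apply: deriv_at_sum => k; apply: deriv_at_sum => l; apply: deriv_atZ.
exact: deriv_at_rep.
Qed.

Lemma polymap_rep_mul (A B : 'M[K]_m) : polymap (fun h => A *m rep_at h *m B).
Proof.
apply: polymap_mul; last exact: polymap_const.
by apply: polymap_mul; [exact: polymap_const|exact: polymap_rep_at].
Qed.

(** The derivative at [h = 1] of [rep_at R (g h) = rep_at R g *m rep_at R h]. *)
Lemma linv_deriv_rep g x i j : G g -> lie x ->
  peval_mx (linv_deriv x (R i j)) g = (rep_at g *m drep x) i j.
Proof.
move=> Gg Lx; rewrite peval_linv_deriv; apply/eqP; rewrite -subr_eq0; apply/eqP.
apply: (@lie_deriv_at (fun h => peval_mx (R i j) (g *m h) - (rep_at g *m rep_at h *m 1%:M) i j) x) => //.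
- apply: polyfunB.
    apply: polyfun_comp; first exact: polyfun_peval.
    by apply: polymap_mul; [exact: polymap_const|exact: polymap_id].
  exact: polymap_rep_mul.
- by move=> h Gh; rewrite mulmx1 -R_mul // [X in _ - X]mxE subrr.
- apply: deriv_atB; last by rewrite -[rep_at g *m _]mulmx1; exact: deriv_at_rep_mul.
  apply: (deriv_at_line (z := g *m x)); last by rewrite mulmx1; exact: deriv_at_peval.
  by move=> t; rewrite mulmxDr -scalemxAr.
Qed.

Lemma drep_conj g x : G g -> lie x ->
  drep (g *m x *m invmx g) = rep_at g *m drep x *m rep_at (invmx g).
Proof.
move=> Gg Lx; apply/matrixP => i j; apply/eqP; rewrite -subr_eq0; apply/eqP.
apply: (@lie_deriv_at (fun h => rep_at (g *m h *m invmx g) i j -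
  (rep_at g *m rep_at h *m rep_at (invmx g)) i j) x) => //.
- apply: polyfunB; first exact: polymap_comp polymap_rep_at (polymap_conj _ _) _ _.
  exact: polymap_rep_mul.
- by move=> h Gh; rewrite !R_mul ?subrr //; [exact: groupM|exact: groupV].
- apply: deriv_atB; last exact: deriv_at_rep_mul.
  apply: (deriv_at_line (f := fun h => rep_at h i j)
    (F := fun h => g *m h *m invmx g) (z := g *m x *m invmx g)).
    by move=> t; rewrite mulmxDr mulmxDl -scalemxAr -scalemxAl.
  by rewrite mulmx1 mulmx_groupV //; exact: deriv_at_rep.
Qed.

(** The image in the matrices of an element of the group algebra whose
    augmentation is [c]. The augmentation is recorded because [A] need not
    determine it. *)
Definition combination_of_group (c : K) (A : 'M[K]_m) : Prop :=
  exists s : seq (K * 'M[K]_n), [/\ forall z, z \in s -> G z.2,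
    c = \sum_(z <- s) z.1 & A = \sum_(z <- s) z.1 *: rep_at z.2].

Lemma combination_groupD c d A B : combination_of_group c A ->
  combination_of_group d B -> combination_of_group (c + d) (A + B).
Proof.
move=> [s [sG -> ->]] [t [tG -> ->]]; exists (s ++ t).
split; rewrite ?big_cat //= => z; rewrite mem_cat => /orP[/sG|/tG] //.
Qed.

Lemma combination_group0 : combination_of_group 0 0.
Proof. by exists [::]; rewrite !big_nil. Qed.

Lemma combination_groupZ a c A :
  combination_of_group c A -> combination_of_group (a * c) (a *: A).
Proof.
move=> [s [sG -> ->]]; exists [seq (a * z.1, z.2) | z <- s].
split=> [_ /mapP[z /sG Gz ->] //||].
  by rewrite big_map mulr_sumr.
by rewrite big_map scaler_sumr; apply: eq_bigr => z _; rewrite scalerA.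
Qed.

Lemma combination_group_rep g : G g -> combination_of_group 1 (rep_at g).
Proof.
move=> Gg; exists [:: (1, g)]; rewrite !big_seq1 scale1r; split=> // z.
by rewrite inE => /eqP ->.
Qed.

Lemma combination_group_sum (I : Type) (r : seq I) c F :
  (forall i, combination_of_group (c i) (F i)) ->
  combination_of_group (\sum_(i <- r) c i) (\sum_(i <- r) F i).
Proof.
move=> cF; elim: r => [|i r IHr]; first by rewrite !big_nil; exact: combination_group0.
by rewrite !big_cons; apply: combination_groupD.
Qed.

Lemma combination_groupM c d A B : combination_of_group c A ->
  combination_of_group d B -> combination_of_group (c * d) (A *m B).
Proof.
move=> [s [sG -> ->]] dB; rewrite mulr_suml mulmx_suml.
elim: s sG => [|z s IHs] sG; first by rewrite !big_nil; exact: combination_group0.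
rewrite !big_cons; apply: combination_groupD; last first.
  by apply: IHs => y ys; apply: sG; rewrite inE ys orbT.
rewrite -scalemxAl; apply: combination_groupZ.
have Gz : G z.2 by apply: sG; exact: mem_head.
move: dB => [t [tG -> ->]]; exists [seq (y.1, z.2 *m y.2) | y <- t]; split.
- by move=> _ /mapP[y /tG Gy ->]; exact: groupM.
- by rewrite big_map.
- rewrite big_map mulmx_sumr; apply: eq_big_seq => y yt.
  by rewrite -scalemxAr R_mul //; exact: tG.
Qed.

(** A linear form vanishing on all pairs [(rep_at g, 1)] vanishes on
    [(drep x, 0)], by differentiation. *)
Lemma combination_group_drep x : lie x -> combination_of_group 0 (drep x).
Proof.
move=> Lx.
pose S (u : 'rV[K]_(m * m + 1)) := exists c A,
  combination_of_group c A /\ u = row_mx (mxvec A) c%:M.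
have sS : subspace S.
  split=> [|a u v [c [A [cA ->]]] [d [B [dB ->]]]].
    exists 0, 0; split; first exact: combination_group0.
    by rewrite linear0 raddf0 row_mx0.
  exists (a * c + d), (a *: A + B); split.
    by apply: combination_groupD => //; exact: combination_groupZ.
  rewrite linearP scale_row_mx add_row_mx; congr row_mx.
  by rewrite raddfD /= scale_scalar_mx.
have [[c [A [cA]]]|nS] := pselect (S (row_mx (mxvec (drep x)) 0%:M)).
  by case/eq_row_mx => /(can_inj mxvecK) -> /matrixP/(_ 0 0); rewrite !mxE /= !mulr1n => ->.
have [l [lS]] := subspace_separation sS nS; case/eqP.
have lE A (c : K) : (row_mx (mxvec A) c%:M *m l) 0 0 =
    \sum_i \sum_j l (lshift 1 (mxvec_index i j)) 0 * A i j + c * l (rshift (m * m) 0) 0.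
  rewrite mxE big_split_ord big_ord1 row_mxEr mxE eqxx mulr1n; congr (_ + _).
  rewrite (reindex _ (curry_mxvec_bij m m)) /= pair_bigA; apply: eq_bigr => -[i j] _ /=.
  by rewrite row_mxEl mxvecE mulrC.
apply/matrixP => a b; rewrite !ord1 lE [RHS]mxE mul0r.
apply: (@lie_deriv_at (fun g => (\sum_i \sum_j l (lshift 1 (mxvec_index i j)) 0 * rep_at g i j)
   + 1 * l (rshift (m * m) 0) 0) x) => //.
- apply: polyfunD; last exact: polyfun_const.
  apply: polyfun_sum => i _; apply: polyfun_sum => j _; apply: polyfunZ.
  exact: polymap_rep_at.
- move=> g Gg; rewrite -lE lS ?mxE //.
  by exists 1, (rep_at g); split=> //; exact: combination_group_rep.
- apply: deriv_atD; last exact: deriv_at_const.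
  apply: deriv_at_sum => i; apply: deriv_at_sum => j; apply: deriv_atZ.
  exact: deriv_at_rep.
Qed.

End Representation.

(** The bracket is the derivative at the identity of [g |-> g y g^-1], which
    takes its values in [a]. *)
Lemma lie_bracket_stable (a : 'M[K]_n -> Prop) x y : subspace a ->
  (forall g z, G g -> a z -> a (g *m z *m invmx g)) ->
  lie x -> a y -> a (x *m y - y *m x).
Proof.
move=> sa aG Lx ay; apply: contrapT => na.
have [l [la]] := subspace_separation_mx sa na; case/eqP.
have /choice[adj' adjE] : forall ij : 'I_n * 'I_n, exists d,
    deriv_at (fun g : 'M[K]_n => (\adj g) ij.1 ij.2) 1%:M x d.
  by move=> ij; apply: polyfun_deriv_at; exact: polymap_adj.
pose A' := \matrix_(i, j) adj' (i, j).
have adjE' i j : deriv_at (fun g : 'M[K]_n => (\adj g) i j) 1%:M x (A' i j).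
  by rewrite mxE; exact: (adjE (i, j)).
have adj1 : \adj (1%:M : 'M[K]_n) = 1%:M.
  by have := mul_mx_adj (1%:M : 'M[K]_n); rewrite mul1mx det1.
have A'E : A' = - x.
  apply/eqP; rewrite -addr_eq0; apply/eqP/matrixP => i j; rewrite [RHS]mxE.
  have -> : (A' + x) i j = (x *m \adj 1%:M + 1%:M *m A') i j - 0.
    by rewrite adj1 mulmx1 mul1mx subr0 [x + _]addrC.
  apply: (@lie_deriv_at (fun g => (g *m \adj g) i j - (i == j)%:R) x) => //.
  - apply: polyfunB; last exact: polyfun_const.
    by apply: polymap_mul; [exact: polymap_id|exact: polymap_adj].
  - by move=> g Gg; rewrite mul_mx_adj group_det1 // mxE subrr.
  - apply: deriv_atB; last exact: deriv_at_const.
    rewrite mxE; apply: deriv_at_eq (fun g => esym (mxE _ _ _ _)) _.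
    rewrite [(x *m _) i j]mxE [(1%:M *m _) i j]mxE -big_split.
    apply: deriv_at_sum => k; apply: deriv_atM; last exact: adjE'.
    exact: deriv_at_coord.
have T' i j : deriv_at (fun g => (g *m y *m \adj g) i j) 1%:M x ((x *m y - y *m x) i j).
  have -> : (x *m y - y *m x) i j = (x *m y *m \adj 1%:M + 1%:M *m y *m A') i j.
    by rewrite adj1 A'E mulmx1 mul1mx mulmxN.
  rewrite mxE; apply: deriv_at_eq (fun g => esym (mxE _ _ _ _)) _.
  rewrite [(_ *m \adj _) i j]mxE [(_ *m A') i j]mxE -big_split.
  apply: deriv_at_sum => k; apply: deriv_atM; last exact: adjE'.
  rewrite mxE; apply: deriv_at_eq (fun g => esym (mxE _ _ _ _)) _.
  apply: deriv_at_sum => q; rewrite -[X in deriv_at _ _ _ X]addr0.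
  rewrite -[X in _ + X](mulr0 ((1%:M : 'M[K]_n) i q)).
  by apply: deriv_atM; [exact: deriv_at_coord|exact: deriv_at_const].
apply: (@lie_deriv_at (fun g => \sum_k mxvec (g *m y *m \adj g) 0 k * l k) x) => //.
- apply: polyfun_sum => k _; case/mxvec_indexP: k => i j.
  apply: polyfunM; last exact: polyfun_const.
  apply: (@polyfun_eq _ _ (fun g => (g *m y *m \adj g) i j)) => [g|]; first by rewrite mxvecE.
  apply: polymap_mul; last exact: polymap_adj.
  by apply: polymap_mul; [exact: polymap_id|exact: polymap_const].
- by move=> g Gg; apply: la; rewrite -group_adj //; exact: aG.
- apply: deriv_at_sum => k; case/mxvec_indexP: k => i j.
  rewrite mxvecE -[X in deriv_at _ _ _ X]addr0.
  rewrite -[X in _ + X](mulr0 (mxvec (1%:M *m y *m \adj 1%:M) 0 (mxvec_index i j))).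
  apply: deriv_atM; last exact: deriv_at_const.
  by apply: deriv_at_eq (T' i j) => g; rewrite mxvecE.
Qed.

End LieAlgebra.

(** * Associative algebras generated by nilpotent Lie algebras *)

Section MatrixDerivatives.
Variables (K : fieldType) (n : nat).

Definition mderiv_at p q (F : 'M[K]_n -> 'M[K]_(p, q)) g y (D : 'M[K]_(p, q)) : Prop :=
  forall i j, deriv_at (fun h => F h i j) g y (D i j).

Lemma mderiv_at_const p q (A : 'M[K]_(p, q)) g y : mderiv_at (fun=> A) g y 0.
Proof. by move=> i j; rewrite mxE; exact: deriv_at_const. Qed.

Lemma mderiv_at_mul p q r (F : 'M[K]_n -> 'M[K]_(p, q)) (H : 'M[K]_n -> 'M[K]_(q, r)) g y D E :
  mderiv_at F g y D -> mderiv_at H g y E ->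
  mderiv_at (fun h => F h *m H h) g y (D *m H g + F g *m E).
Proof.
move=> FD HE i j; rewrite !mxE -big_split; apply: deriv_at_eq (fun g => esym (mxE _ _ _ _)) _.
by apply: deriv_at_sum => k; apply: deriv_atM; [exact: FD|exact: HE].
Qed.

Lemma mderiv_at_exp k (g y : 'M[K]_n) :
  mderiv_at (fun h => h ^+ k) g y (\sum_(i < k) g ^+ i * y * g ^+ (k.-1 - i)).
Proof.
elim: k => [|k IHk]; first by rewrite big_ord0; exact: (mderiv_at_const 1).
have -> : \sum_(i < k.+1) g ^+ i * y * g ^+ (k - i) =
    y *m g ^+ k + g *m (\sum_(i < k) g ^+ i * y * g ^+ (k.-1 - i)).
  rewrite big_ord_recl expr0 mul1r subn0; congr (_ + _).
  rewrite -[RHS]/(g * _) mulr_sumr; apply: eq_bigr => i _.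
  by rewrite lift0 exprS !mulrA -subn1 -subnDA add1n.
move=> i j; apply: deriv_at_eq (fun h => congr1 (fun A : 'M_n => A i j) (esym (exprS h k))) _.
by apply: mderiv_at_mul => // a b; exact: deriv_at_coord.
Qed.

End MatrixDerivatives.

Section Words.
Variables (K : closedFieldType) (char0 : [pchar K] =i pred0) (n : nat).
Variable (a : 'M[K]_n -> Prop).
Hypothesis a_sub : subspace a.
Hypothesis a_bracket : forall x y, a x -> a y -> a (x * y - y * x).
Hypothesis a_nil : forall x, a x -> nilpotent_mx x.

Definition word_in (w : seq 'M[K]_n) : Prop := forall x, x \in w -> a x.

Definition word_prod (w : seq 'M[K]_n) : 'M[K]_n := \prod_(x <- w) x.

Lemma word_prod_cat u v : word_prod (u ++ v) = word_prod u * word_prod v.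
Proof. exact: big_cat. Qed.

Lemma word_prod_cons x v : word_prod (x :: v) = x * word_prod v.
Proof. exact: big_cons. Qed.

Lemma word_prod_nseq k x : word_prod (nseq k x) = x ^+ k.
Proof. by elim: k => [|k IHk]; rewrite ?exprS -?IHk /word_prod /= ?big_nil ?big_cons. Qed.

Lemma word_in_cat u v : word_in (u ++ v) <-> word_in u /\ word_in v.
Proof.
split=> [uv|[au av] x]; last by rewrite mem_cat => /orP[/au|/av].
by split=> x xu; apply: uv; rewrite mem_cat xu ?orbT.
Qed.

Lemma word_in_cons x v : word_in (x :: v) <-> a x /\ word_in v.
Proof.
split=> [xv|[ax av] y]; last by rewrite inE => /orP[/eqP ->|/av].
by split=> [|y yv]; apply: xv; rewrite inE ?eqxx // yv orbT.
Qed.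

Lemma word_in_nseq k x : a x -> word_in (nseq k x).
Proof. by move=> ax y /nseqP[->]. Qed.

(** Modulo shorter words, the trace of a word does not depend on the order of
    its letters; so these traces are symmetric multilinear forms vanishing on
    the diagonal, and vanish by polarization. *)
Lemma word_trace w : (0 < size w)%N -> word_in w -> \tr (word_prod w) = 0.
Proof.
elim: {w}(size w) {-2}w (leqnn (size w)) => [|k IHk] w.
  by rewrite leqn0 => /eqP ->.
move=> sw w0 aw.
have swap u v x y : size (u ++ x :: y :: v) = k.+1 -> word_in (u ++ x :: y :: v) ->
    \tr (word_prod (u ++ x :: y :: v)) = \tr (word_prod (u ++ y :: x :: v)).
  move=> suv /word_in_cat[au /word_in_cons[ax /word_in_cons[ay av]]].
  apply/eqP; rewrite -subr_eq0 -raddfB /=; apply/eqP.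
  have -> : word_prod (u ++ x :: y :: v) - word_prod (u ++ y :: x :: v) =
      word_prod (u ++ (x * y - y * x) :: v).
    by rewrite !word_prod_cat !word_prod_cons mulrBl mulrBr !mulrA.
  apply: IHk.
  - by move: suv; rewrite !size_cat /= !addnS => -[->].
  - by rewrite size_cat /= addnS.
  - by apply/word_in_cat; split=> //; apply/word_in_cons; split=> //; exact: a_bracket.
have move_left u z y i j : (size u + i + j)%N = k -> word_in u -> a z -> a y ->
    \tr (word_prod u * y ^+ i * z * y ^+ j) = \tr (word_prod u * z * y ^+ (i + j)).
  elim: i j => [|i IHi] j suv au az ay; first by rewrite expr0 mulr1.
  rewrite addSn -addnS -IHi //; last by move: suv; lia.
  have wE b c : word_prod u * y ^+ i * b * c * y ^+ j =
      word_prod ((u ++ nseq i y) ++ b :: c :: nseq j y).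
    by rewrite !word_prod_cat !word_prod_cons !word_prod_nseq !mulrA.
  rewrite exprSr mulrA wE swap -?wE.
  - by rewrite exprS !mulrA.
  - by rewrite !size_cat /= !size_nseq -suv; lia.
  - apply/word_in_cat; split; first by apply/word_in_cat; split=> //; exact: word_in_nseq.
    by apply/word_in_cons; split=> //; apply/word_in_cons; split=> //; exact: word_in_nseq.
have polar j : (j <= k.+1)%N -> forall u y, size u = j -> word_in u -> a y ->
    \tr (word_prod u * y ^+ (k.+1 - j)) = 0.
  elim: j => [_ u y /size0nil -> _ ay|j IHj jk u y].
    rewrite /word_prod big_nil mul1r subn0; apply: mxtrace_nilpotent.
    by have [l yl] := a_nil ay; exists l; rewrite -exprM mulnC exprM yl expr0n.
  case/lastP: u => // u z; rewrite size_rcons => -[su].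
  rewrite -cats1 => /word_in_cat[au /word_in_cons[az _]] ay.
  rewrite subSS word_prod_cat word_prod_cons [word_prod [::]]big_nil mulr1.
  set r := (k - j)%N; have rE : (k.+1 - j = r.+1)%N by rewrite /r subSn.
  (* By induction the function vanishes on the line through [y] with direction
     [z]; modulo shorter words its derivative is [r.+1] times the trace of
     the word [u z y ^ r]. *)
  have [P [Pt P']] : deriv_at (fun h => \tr (word_prod u *m h ^+ r.+1)) y z
      (\sum_i (0 *m y ^+ r.+1 + word_prod u *m
        (\sum_(l < r.+1) y ^+ l * z * y ^+ (r - l))) i i).
    by apply: deriv_at_sum => i; apply: mderiv_at_mul;
       [exact: mderiv_at_const|exact: mderiv_at_exp].
  have P0 : P = 0.
    apply: (poly_ext char0) => t; rewrite horner0 Pt -rE.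
    apply: IHj => //; first exact: ltnW.
    by apply: subspaceD => //; exact: subspaceZ.
  move: P'; rewrite P0 deriv0 horner0 mul0mx add0r.
  rewrite -[X in _ = X]/(\tr (word_prod u * (\sum_(l < r.+1) y ^+ l * z * y ^+ (r - l)))).
  rewrite mulr_sumr raddf_sum /= (eq_bigr (fun=> \tr (word_prod u * z * y ^+ r))); last first.
    move=> l _; have lr : (l <= r)%N by rewrite -ltnS.
    by rewrite !mulrA move_left ?subnKC // -addnA subnKC // su subnKC.
  rewrite sumr_const card_ord => /esym/eqP; rewrite -mulr_natr mulf_eq0.
  by move/pcharf0P : char0 => -> /orP[/eqP|//].
move: sw; rewrite leq_eqVlt ltnS => /orP[/eqP sw|sw]; last exact: IHk.
have := polar k.+1 (leqnn _) w 0 sw aw; rewrite subnn expr0 mulr1; apply.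
by case: a_sub.
Qed.

(** The associative algebra without unit generated by [a]. *)
Definition word_span (z : 'M[K]_n) : Prop := exists ws : seq (seq 'M[K]_n),
  (forall w, w \in ws -> (0 < size w)%N /\ word_in w) /\ z = \sum_(w <- ws) word_prod w.

Lemma word_span_word w : (0 < size w)%N -> word_in w -> word_span (word_prod w).
Proof.
by move=> w0 aw; exists [:: w]; rewrite big_seq1; split=> // v; rewrite inE => /eqP ->.
Qed.

Lemma word_span_gen x : a x -> word_span x.
Proof.
move=> ax; have <- : word_prod [:: x] = x by rewrite word_prod_cons /word_prod big_nil mulr1.
by apply: word_span_word => // y; rewrite inE => /eqP ->.
Qed.

Lemma word_spanD x y : word_span x -> word_span y -> word_span (x + y).
Proof.
move=> [ws [wsP ->]] [vs [vsP ->]]; exists (ws ++ vs); rewrite big_cat; split=> // w.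
by rewrite mem_cat => /orP[/wsP|/vsP].
Qed.

Lemma word_span_sum (I : Type) (r : seq I) (Q : pred I) F :
  (forall i, Q i -> word_span (F i)) -> word_span (\sum_(i <- r | Q i) F i).
Proof.
by move=> FP; apply: big_ind => //; [exists [::]; rewrite big_nil|exact: word_spanD].
Qed.

Lemma word_spanZ c x : word_span x -> word_span (c *: x).
Proof.
move=> [ws [wsP ->]]; rewrite scaler_sumr big_seq; apply: word_span_sum => w /wsP[].
case: w => // x' w _ /word_in_cons[ax aw];
have -> : c *: word_prod (x' :: w) = word_prod (c *: x' :: w).
  by rewrite !word_prod_cons; exact: scalemxAl.
apply: word_span_word => //; apply/word_in_cons; split=> //; exact: subspaceZ.
Qed.

Lemma word_spanM x y : word_span x -> word_span y -> word_span (x * y).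
Proof.
move=> [ws [wsP ->]] [vs [vsP ->]]; rewrite mulr_suml big_seq.
apply: word_span_sum => w /wsP[w0 aw]; rewrite mulr_sumr big_seq.
apply: word_span_sum => v /vsP[v0 av]; rewrite -word_prod_cat.
by apply: word_span_word; rewrite ?size_cat ?addn_gt0 ?w0 //; apply/word_in_cat.
Qed.

Lemma word_span_exp x k : word_span x -> word_span (x ^+ k.+1).
Proof.
move=> sx; elim: k => [|k IHk]; first by rewrite expr1.
by rewrite exprS; apply: word_spanM.
Qed.

Lemma word_span_subspace : subspace word_span.
Proof.
split; first by exists [::]; rewrite big_nil.
by move=> c x y sx sy; apply: word_spanD => //; exact: word_spanZ.
Qed.

Lemma word_span_nilpotent x : word_span x -> nilpotent_mx x.
Proof.
move=> sx; apply: (nilpotent_of_traces char0) => k.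
have [ws [wsP ->]] := word_span_exp k sx.
rewrite raddf_sum big_seq big1 // => w /wsP[w0 aw]; exact: word_trace.
Qed.

Lemma word_span_conj (g h : 'M[K]_n) x : h *m g = 1%:M ->
  (forall y, a y -> a (g *m y *m h)) -> word_span x -> word_span (g *m x *m h).
Proof.
move=> hg ag [ws [wsP ->]]; rewrite mulmx_sumr mulmx_suml big_seq.
apply: word_span_sum => w /wsP[w0 aw].
have -> : g *m word_prod w *m h = word_prod [seq g *m y *m h | y <- w].
  case: w w0 {aw} => // y w _; elim: w y => [|z w IHw] y.
    by rewrite /= !word_prod_cons [word_prod [::]]big_nil !mulr1.
  rewrite word_prod_cons [RHS]word_prod_cons -IHw.
  rewrite -[y * _]/(y *m _) -[RHS]/(g *m y *m h *m (g *m word_prod (z :: w) *m h)).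
  by rewrite !mulmxA -[g *m y *m h *m g]mulmxA hg mulmx1.
apply: word_span_word; first by rewrite size_map.
by move=> _ /mapP[y /aw/ag ? ->].
Qed.

End Words.

(** * Nilpotent ideals of the Lie algebra *)

Section Curves.
Variables (K : fieldType) (N : nat) (c : 'I_N -> {poly K}).

Definition along (p : {mpoly K[N]}) : {poly K} := mmap (@polyC K) c p.

Lemma alongD p q : along (p + q) = along p + along q. Proof. exact: mmapD. Qed.

Lemma alongM p q : along (p * q) = along p * along q.
Proof. exact: (rmorphM (mmap (@polyC K) c)). Qed.

Lemma alongC a : along a%:MP = a%:P. Proof. exact: mmapC. Qed.

Lemma alongX i : along 'X_i = c i. Proof. by rewrite /along mmapX mmap1U. Qed.

Lemma along_horner p t : (along p).[t] = p.@[fun i => (c i).[t]].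
Proof.
elim/mpoly_generated: p => [a|i|p q IHp IHq|p q IHp IHq].
- by rewrite alongC hornerC mevalC.
- by rewrite alongX mevalXU.
- by rewrite alongD hornerD IHp IHq mevalD.
- by rewrite alongM hornerM IHp IHq mevalM.
Qed.

Lemma along_sum (I : finType) (F : I -> {mpoly K[N]}) :
  along (\sum_i F i) = \sum_i along (F i).
Proof. exact: (raddf_sum (mmap (@polyC K) c)). Qed.

Lemma along_deriv p : (along p)^`() = \sum_i along p^`M(i) * (c i)^`().
Proof.
elim/mpoly_generated: p => [a|i|p q IHp IHq|p q IHp IHq].
- rewrite alongC derivC big1 // => j _; rewrite mderivC -mpolyC0 alongC.
  by rewrite polyC0 mul0r.
- rewrite alongX (bigD1 i) //= big1 => [|j ji]; last first.
    by rewrite mderivX mnm1E eq_sym (negPf ji) scale0r -mpolyC0 alongC polyC0 mul0r.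
  rewrite mderivX mnm1E eqxx scale1r addr0.
  have -> : (U_(i) - U_(i) = 0)%MM by apply/mnmP => j; rewrite mnmBE subnn mnm0E.
  by rewrite mpolyX0 -mpolyC1 alongC polyC1 mul1r.
- rewrite alongD derivD IHp IHq -big_split; apply: eq_bigr => i _ /=.
  by rewrite mderivD alongD mulrDl.
- rewrite alongM derivM IHp IHq mulr_suml mulr_sumr -big_split; apply: eq_bigr => i _ /=.
  by rewrite mderivM alongD !alongM; ring.
Qed.

End Curves.

Section MatrixCurves.
Variables (K : fieldType) (n : nat).

(** The curve [t |-> \sum_k b_k(t) z^k], cut at [k < M]. For nilpotent [z], the
    coefficients below give the exponential of [t z], and the powers of [1 + z]
    with exponent [t]. *)
Definition matrix_curve (b : nat -> {poly K}) (z : 'M[K]_n) (M : nat) (i : 'I_(n * n)) : {poly K} :=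
  \sum_(k < M) mxvec (z ^+ k) 0 i *: b k.

Lemma matrix_curve_horner b z M t i :
  (matrix_curve b z M i).[t] = mxvec (\sum_(k < M) (b k).[t] *: z ^+ k) 0 i.
Proof.
rewrite horner_sum linear_sum summxE; apply: eq_bigr => k _.
by rewrite hornerZ linearZ /= [RHS]mxE mulrC.
Qed.

Lemma along_matrix_curve b z M p t :
  (along (matrix_curve b z M) p).[t] = peval_mx p (\sum_(k < M) (b k).[t] *: z ^+ k).
Proof.
rewrite along_horner; apply: meval_eq => i.
exact: matrix_curve_horner.
Qed.

Definition exp_coef (k : nat) : {poly K} := (k`!%:R^-1 : K) *: 'X^k.

Definition binomial_coef (k : nat) : {poly K} :=
  (k`!%:R^-1 : K) *: \prod_(i < k) ('X - (i%:R)%:P).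

Hypothesis char0 : [pchar K] =i pred0.

Lemma fact_neq0 k : k`!%:R != 0 :> K.
Proof. by move/pcharf0P : char0 => ->; rewrite -lt0n fact_gt0. Qed.

Lemma binomial_coef_nat k s : (binomial_coef k).[s%:R] = 'C(s, k)%:R.
Proof.
rewrite hornerZ horner_prod; apply: (mulfI (fact_neq0 k)).
rewrite mulrA mulfV ?fact_neq0 // mul1r mulrC -natrM bin_ffact.
elim: k => [|k IHk]; first by rewrite big_ord0.
rewrite big_ord_recr /= IHk hornerXsubC ffactnSr natrM.
have [ks|sk] := leqP k s; first by rewrite natrB.
by rewrite ffact_small // !mul0r.
Qed.

End MatrixCurves.

Lemma expr_nilpotent_binomial (K : fieldType) n (z : 'M[K]_n) M s : z ^+ M = 0 ->
  (1 + z) ^+ s = \sum_(k < M) 'C(s, k)%:R *: z ^+ k.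
Proof.
move=> zM; have z0 k : (M <= k)%N -> z ^+ k = 0.
  by move=> Mk; rewrite -(subnKC Mk) exprD zM mul0r.
have -> : \sum_(k < M) 'C(s, k)%:R *: z ^+ k = \sum_(k < maxn M s.+1) 'C(s, k)%:R *: z ^+ k.
  rewrite (big_ord_widen _ (fun k => 'C(s, k)%:R *: z ^+ k) (leq_maxl M s.+1)).
  rewrite big_mkcond; apply: eq_bigr => k _; case: ltnP => // Mk.
  by rewrite z0 // scaler0.
rewrite exprDn_comm; last by exact: GRing.commr_sym (GRing.commr1 z).
have -> : \sum_(i < s.+1) (1 : 'M[K]_n) ^+ (s - i) * z ^+ i *+ 'C(s, i) =
    \sum_(i < s.+1) 'C(s, i)%:R *: z ^+ i.
  by apply: eq_bigr => i _; rewrite expr1n mul1r scaler_nat.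
rewrite (big_ord_widen _ (fun k => 'C(s, k)%:R *: z ^+ k) (leq_maxr M s.+1)).
rewrite big_mkcond; apply: eq_bigr => k _; case: ltnP => // sk.
by rewrite bin_small // scale0r.
Qed.

Section NilpotentIdeals.
Variables (K : closedFieldType) (char0 : [pchar K] =i pred0) (n : nat).
Variables (G : set 'M[K]_n) (G_group : algebraic_group G).
Hypothesis G_nochar : no_nontrivial_characters G.
Hypothesis G_reductive : reductive G.
Local Notation peval_mx := (@peval_mx K n).

(** The one-parameter subgroup generated by a nilpotent element of the Lie
    algebra lies in the group: the derivative of [p (exp (t x))] is
    [(D_x p) (exp (t x))], so all its Taylor coefficients at 0 vanish. *)
Lemma group_exp x M t : lie G x -> x ^+ M = 0 ->
  G (\sum_(k < M) (exp_coef K k).[t] *: x ^+ k).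
Proof.
move=> Lx xM; apply: (group_of_vanishing G_group G_nochar) => p vp.
rewrite -along_matrix_curve; set c := matrix_curve _ _ _.
have x0 k : (M <= k)%N -> x ^+ k = 0.
  by move=> Mk; rewrite -(subnKC Mk) exprD xM mul0r.
have cE i k : (c i)`_k = k`!%:R^-1 * mxvec (x ^+ k) 0 i.
  rewrite coef_sum; have [kM|Mk] := ltnP k M; last first.
    rewrite x0 // linear0 mxE mulr0 big1 // => l _.
    by rewrite !coefZ coefXn gtn_eqF ?mulr0 // (leq_trans (ltn_ord l)).
  rewrite (bigD1 (Ordinal kM)) //= !coefZ coefXn eqxx mulr1 mulrC big1 ?addr0 // => l lk.
  rewrite !coefZ coefXn; rewrite -val_eqE /= eq_sym in lk.
  by rewrite (negPf lk) !mulr0.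
have c' i : (c i)^`() = along c (coordinate_mul x i).
  rewrite along_sum; apply/polyP => k; rewrite coef_deriv cE coef_sum.
  rewrite exprSr -[x ^+ k * x]/(mulmxr x (x ^+ k)).
  rewrite -[X in mulmxr x X]mxvecK -(mul_rV_lin (mulmxr x)) mxE -[LHS]mulr_natr mulrAC.
  rewrite factS natrM invfM.
  have -> : k.+1%:R^-1 * k`!%:R^-1 * k.+1%:R = k`!%:R^-1 :> K; last first.
    rewrite mulr_sumr; apply: eq_bigr => j _.
    rewrite -mul_mpolyC alongM alongC alongX coefCM cE; ring.
  by rewrite mulrAC mulVf ?mul1r //; move/pcharf0P : char0 => ->.
have along' q : (along c q)^`() = along c (linv_deriv x q).
  rewrite along_deriv along_sum; apply: eq_bigr => i _.
  by rewrite alongM c'.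
have along0 q : vanishing G q -> (along c q).[0] = 0.
  move=> vq; rewrite along_matrix_curve.
  have -> : \sum_(k < M) (exp_coef K k).[0] *: x ^+ k = 1%:M; last exact: (vq _ (group1 G_group)).
  case: M xM {x0 c cE c' along'} => [/matrixP E|M _].
    by rewrite big_ord0; apply/matrixP => i j; rewrite -[RHS]/((1 : 'M[K]_n) i j) -E expr0.
  rewrite big_ord_recl hornerZ hornerXn expr0 fact0 invr1 mulr1 scale1r big1 ?addr0 //.
  by move=> k _; rewrite hornerZ hornerXn lift0 expr0n mulr0 scale0r.
suff -> : along c p = 0 by rewrite horner0.
apply/polyP => k; rewrite coef0.
elim: k p vp => [|k IHk] p vp; first by rewrite -horner_coef0 along0.
have := IHk _ (linv_deriv_vanishing char0 G_group Lx vp).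
rewrite -along' coef_deriv -[X in X = _ -> _]mulr_natr => /eqP; rewrite mulf_eq0.
by move/pcharf0P : char0 => -> /orP[/eqP|].
Qed.

(** The associative algebra generated by [a] consists of nilpotent matrices. The
    group elements [u] for which it contains [u - 1] form a closed normal
    unipotent subgroup [U]; it is connected, because the powers of [u] with
    exponent in [K] form a curve in [U] through 1 and [u]. So [U] is trivial by
    reductivity; since it contains the exponentials of the elements of [a],
    these are 0. *)
Lemma lie_nilpotent_eq0 (a : 'M[K]_n -> Prop) : subspace a ->
  (forall x, a x -> lie G x) -> (forall x, a x -> nilpotent_mx x) ->
  (forall g x, G g -> a x -> a (g *m x *m invmx g)) ->
  forall x, a x -> x = 0.
Proof.
move=> sa aL anil aG.
have abr x y : a x -> a y -> a (x * y - y * x).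
  by move=> ax ay; apply: (lie_bracket_stable char0 G_group G_nochar sa aG) => //; exact: aL.
have snil := word_span_nilpotent char0 sa abr anil.
pose W := word_span a; have sW : subspace W by exact: word_span_subspace.
have WM : forall x y, W x -> W y -> W (x * y) by exact: word_spanM.
have WX : forall x k, W x -> W (x ^+ k.+1) by exact: word_span_exp.
pose U : set 'M[K]_n := [set g | G g /\ W (g - 1)]%classic.
have U1 : U 1%:M by split; [exact: group1|rewrite subrr; case: sW].
have UM g h : U g -> U h -> U (g *m h).
  move=> [Gg Wg] [Gh Wh]; split; first exact: groupM.
  have -> : g *m h - 1 = (g - 1) * (h - 1) + (g - 1) + (h - 1).
    rewrite -[g *m h]/(g * h) mulrBr mulr1 mulrBl mul1r.
    by rewrite subrK addrA subrK.
  by apply: subspaceD => //; apply: subspaceD => //; exact: WM.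
have UV g : U g -> U (invmx g).
  move=> [Gg Wg]; split; first exact: groupV.
  pose z := g - 1; have [M zM] := snil _ Wg.
  have gV : g *m (\sum_(i < M) (- z) ^+ i) = 1%:M.
    have zg : - z - 1 = - g by rewrite /z opprB addrAC subrr sub0r.
    by have := subrX1 (- z) M; rewrite exprNn zM mulr0 sub0r zg mulNr => /oppr_inj.
  have -> : invmx g - 1 = - (z * invmx g).
    rewrite mulrBl -[g * invmx g]/(g *m invmx g) (mulmx_groupV G_group) // mul1r opprB.
    by [].
  have -> : invmx g = \sum_(i < M) (- z) ^+ i.
    by rewrite -[LHS]mulmx1 -gV mulKmx // (group_unitmx G_group).
  rewrite -mulNr mulr_sumr; apply: (subspace_sum sW) => i _.
  by rewrite -exprS; apply: WX; rewrite -scaleN1r; apply: subspaceZ.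
have UT u t M : U u -> (u - 1) ^+ M = 0 ->
    U (\sum_(k < M) (binomial_coef K k).[t] *: (u - 1) ^+ k).
  move=> [Gu Wu] uM; split.
    apply: (group_of_vanishing G_group G_nochar) => p vp.
    rewrite -along_matrix_curve (_ : along _ p = 0) ?horner0 //.
    apply: (poly_ext char0) => s; rewrite horner0 along_matrix_curve.
    apply: vp; rewrite (eq_bigr (fun k : 'I_M => 'C(s, k)%:R *: (u - 1) ^+ k)); last first.
      by move=> k _; rewrite binomial_coef_nat.
    rewrite -expr_nilpotent_binomial // addrC subrK.
    by elim: s => [|s IHs]; rewrite ?exprS; [exact: group1|exact: groupM].
  case: M uM => [uM|M uM].
    by move: uM; rewrite expr0 big_ord0 => ->; rewrite subrr; case: sW.
  rewrite big_ord_recl hornerZ big_ord0 hornerC fact0 invr1 mulr1 scale1r expr0 addrC addKr.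
  apply: (subspace_sum sW) => k _; apply: subspaceZ => //.
  by rewrite lift0; exact: WX.
have U_alg : algebraic_group U.
  split=> //; exists [set g | forall p, (forall u, U u -> peval_mx p u = 0) ->
      peval_mx p g = 0]%classic.
    by exists [set p | forall u, U u -> peval_mx p u = 0]%classic.
  apply/seteqP; split=> [u Uu|g [gU gu]].
    by split=> [p|]; [exact|case: Uu => /(group_unitmx G_group)].
  split.
    apply: (group_of_vanishing G_group G_nochar) => p vp.
    by apply: gU => u [Gu _]; exact: vp.
  apply: contrapT => nW.
  have [l [lW]] := subspace_separation_mx sW nW; case/eqP.
  have [p pE] : polyfun (fun h : 'M[K]_n => \sum_k mxvec (h - 1) 0 k * l k).
    apply: polyfun_sum => k _; case/mxvec_indexP: k => i j.
    apply: polyfunM; last exact: polyfun_const.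
    have := polyfunB (polyfun_coord K i j) (polyfun_const n ((1 : 'M[K]_n) i j)).
    by apply: polyfun_eq => h; rewrite mxvecE !mxE.
  by rewrite pE; apply: gU => u [_ /lW]; rewrite -pE.
have U_conn : connected_set (@closed_mx K n) U.
  split; first by exists 1%:M.
  have key A B : closed_mx A -> closed_mx B -> (U `<=` A `|` B)%classic ->
      (U `&` A `&` B = set0)%classic -> A 1%:M -> (U `<=` A)%classic.
    move=> [SA ->] [SB ->] UAB UI A1 u Uu; apply: contrapT => nA.
    have [p SAp pu] : exists2 p, SA p & peval_mx p u != 0.
      apply: contrapT => nop; apply: nA => p SAp; apply: contrapT => /eqP pu.
      by apply: nop; exists p.
    have nB1 : ~ forall p, SB p -> peval_mx p 1%:M = 0.
      move=> B1; suff : (set0 : set 'M[K]_n) 1%:M by [].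
      by rewrite -UI; split; first split.
    have [q SBq q1] : exists2 q, SB q & peval_mx q 1%:M != 0.
      apply: contrapT => nop; apply: nB1 => q SBq; apply: contrapT => /eqP q1.
      by apply: nop; exists q.
    have [M uM] := snil _ (proj2 Uu).
    pose c := matrix_curve (binomial_coef K) (u - 1) M.
    have cs s : (\sum_(k < M) (binomial_coef K k).[s%:R] *: (u - 1) ^+ k) = u ^+ s.
      rewrite (eq_bigr (fun k : 'I_M => 'C(s, k)%:R *: (u - 1) ^+ k)); last first.
        by move=> k _; rewrite binomial_coef_nat.
      by rewrite -expr_nilpotent_binomial // addrC subrK.
    have p0 : along c p != 0.
      apply: contraNneq pu => p0; have := along_matrix_curve (binomial_coef K) (u - 1) M p 1%:R.
      by rewrite cs expr1 -/c p0 horner0 => <-.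
    have q0 : along c q != 0.
      apply: contraNneq q1 => q0; have := along_matrix_curve (binomial_coef K) (u - 1) M q 0%:R.
      by rewrite cs expr0 -/c q0 horner0 => <-.
    have [t] := exists_nonroot char0 (mulf_neq0 p0 q0).
    rewrite hornerM mulf_eq0 negb_or !along_matrix_curve => /andP[pt qt].
    case: (UAB _ (UT u t%:R M Uu uM)) => [/(_ p SAp)|/(_ q SBq)] /eqP.
      by rewrite (negPf pt).
    by rewrite (negPf qt).
  move=> A B cA cB UAB UI; case: (UAB _ U1) => [A1|B1].
    by left; exact: key cA cB UAB UI A1.
  by right; apply: key cB cA _ _ B1; rewrite 1?setUC // -setIA [(B `&` A)%classic]setIC setIA.
have U_normal : normal_in G U.
  split=> [u []//|g u Gg [Gu Wu]]; split.
    by apply: groupM => //; [exact: groupM|exact: groupV].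
  have -> : g *m u *m invmx g - 1 = g *m (u - 1) *m invmx g.
    by rewrite mulmxBr mulmxBl mulmx1 (mulmx_groupV G_group).
  apply: word_span_conj => //; first exact: (mulmx_Vgroup G_group).
  by move=> y; exact: aG.
have UE := G_reductive U_alg U_conn U_normal (fun u Uu => snil _ (proj2 Uu)).
move=> x ax; have [M xM] := anil _ ax.
pose c := matrix_curve (exp_coef K) x M.+2.
have xM2 : x ^+ M.+2 = 0 by rewrite -addn2 exprD xM mul0r.
have c1 t : \sum_(k < M.+2) (exp_coef K k).[t] *: x ^+ k = 1%:M.
  suff : U (\sum_(k < M.+2) (exp_coef K k).[t] *: x ^+ k) by rewrite UE.
  split; first by apply: group_exp xM2; exact: aL.
  rewrite big_ord_recl hornerZ hornerXn expr0 fact0 invr1 mulr1 scale1r expr0 addrC addKr.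
  apply: (subspace_sum sW) => k _; apply: subspaceZ => //.
  by rewrite lift0; apply/WX/word_span_gen.
have cC i : c i = (mxvec (1%:M : 'M[K]_n) 0 i)%:P.
  by apply: (poly_ext char0) => t; rewrite matrix_curve_horner c1 hornerC.
apply/(can_inj mxvecK)/rowP => i; rewrite linear0 [RHS]mxE.
have := congr1 (fun p : {poly K} => p`_1) (cC i); rewrite coefC /= coef_sum.
rewrite big_ord_recl big_ord_recl !coefZ !coefXn /= mulr0 mulr0 add0r invr1 mulr1.
rewrite expr1 mulr1 big1 ?addr0 // => k _.
by rewrite !coefZ coefXn !mulr0.
Qed.

End NilpotentIdeals.

(** * Generalized eigenvectors modulo a stable subspace *)

Section GeneralizedEigenvectors.
Variables (K : fieldType) (V : lmodType K) (T : {linear V -> V}).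
Variables (I : V -> Prop) (sI : subspace I) (IT : forall v, I v -> I (T v)).

Definition shift_op (mu : K) (v : V) : V := T v - mu *: v.

Lemma shift_op_linear mu c u v :
  shift_op mu (c *: u + v) = c *: shift_op mu u + shift_op mu v.
Proof.
rewrite /shift_op linearP scalerBr scalerDr opprD addrACA; congr (_ - _ + _).
by rewrite !scalerA mulrC.
Qed.

HB.instance Definition _ mu := GRing.isLinear.Build K V V _ (shift_op mu) (shift_op_linear mu).

Lemma shift_op_stable mu v : I v -> I (shift_op mu v).
Proof. by move=> Iv; apply: subspaceB => //; [exact: IT|exact: subspaceZ]. Qed.

Lemma iter_shift_op_stable mu k v : I v -> I (iter k (shift_op mu) v).
Proof. by move=> Iv; elim: k => //= k; exact: shift_op_stable. Qed.

Lemma iter_shift_op_linear mu k c u v : iter k (shift_op mu) (c *: u + v) =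
  c *: iter k (shift_op mu) u + iter k (shift_op mu) v.
Proof. by elim: k => //= k ->; rewrite linearP. Qed.

(** Eigenvectors are taken modulo [I] in order to deal with functions on the
    group, which are polynomials modulo the ideal of the group. *)
Definition geigenvector (mu : K) (v : V) : Prop := exists k, I (iter k (shift_op mu) v).

Lemma geigenvector_leq mu k l v : (k <= l)%N ->
  I (iter k (shift_op mu) v) -> I (iter l (shift_op mu) v).
Proof. by move=> kl Iv; rewrite -(subnK kl) iterD; exact: iter_shift_op_stable. Qed.

Lemma geigenvector_subspace mu : subspace (geigenvector mu).
Proof.
split; first by exists 0%N; case: sI.
move=> c u v [k Iu] [l Iv]; exists (maxn k l); rewrite iter_shift_op_linear.
apply: subspaceD => //; first apply: subspaceZ => //.
  exact: geigenvector_leq (leq_maxl _ _) Iu.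
exact: geigenvector_leq (leq_maxr _ _) Iv.
Qed.

Lemma geigenvector_shift mu v : geigenvector mu (shift_op mu v) -> geigenvector mu v.
Proof. by move=> [k Ik]; exists k.+1; rewrite iterSr. Qed.

Lemma geigenvector_sub v mu : I v -> geigenvector mu v.
Proof. by move=> Iv; exists 0%N. Qed.

(** By induction on [j]: modulo [I], [shift_op] maps [y j] into the span of
    earlier vectors with the same eigenvalue. *)
Lemma geigenvector_triangular n (M : 'M[K]_n) (y : 'I_n -> V) : block_triangular M ->
  (forall j, I (T (y j) - \sum_i M i j *: y i)) -> forall j, geigenvector (M j j) (y j).
Proof.
move=> Mtri Ty j; elim: {j}(val j).+1 {-2}j (ltnSn (val j)) => // k IHk j jk.
apply: geigenvector_shift; have [_ gD] := geigenvector_subspace (M j j).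
have -> : shift_op (M j j) (y j) = 1 *: (T (y j) - \sum_i M i j *: y i) +
    \sum_(i | i != j) M i j *: y i.
  rewrite scale1r /shift_op [\sum_i _](bigD1 j) //= opprD addrA.
  by rewrite subrK.
apply: gD; first exact: geigenvector_sub.
apply: (subspace_sum (geigenvector_subspace (M j j))) => i ij.
have [->|Mij] := eqVneq (M i j) 0; first by rewrite scale0r; case: (geigenvector_subspace (M j j)).
have [le_ij Eij] := Mtri _ _ Mij.
apply: (subspaceZ (geigenvector_subspace (M j j))); rewrite -Eij; apply: IHk.
by rewrite (leq_trans _ (_ : j <= k)%N) // ltn_neqAle le_ij andbT.
Qed.

Definition poly_op (s : {poly K}) (v : V) : V := \sum_(i < size s) s`_i *: iter i T v.

Implicit Types (s t : {poly K}) (v : V).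

Lemma poly_op_widen N s v : (size s <= N)%N ->
  poly_op s v = \sum_(i < N) s`_i *: iter i T v.
Proof.
move=> sN; rewrite /poly_op (big_ord_widen _ (fun i => s`_i *: iter i T v) sN).
rewrite big_mkcond; apply: eq_bigr => i _; case: ltnP => // si.
by rewrite nth_default // scale0r.
Qed.

Lemma poly_opD s t v : poly_op (s + t) v = poly_op s v + poly_op t v.
Proof.
set N := maxn (size s) (size t).
rewrite !(@poly_op_widen N) ?leq_maxl ?leq_maxr ?size_polyD // -big_split.
by apply: eq_bigr => i _; rewrite coefD scalerDl.
Qed.

Lemma poly_opC c v : poly_op c%:P v = c *: v.
Proof. by rewrite (@poly_op_widen 1) ?size_polyC_leq1 // big_ord1 coefC. Qed.

Lemma poly_op_linear s c u v : poly_op s (c *: u + v) = c *: poly_op s u + poly_op s v.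
Proof.
rewrite /poly_op scaler_sumr -big_split; apply: eq_bigr => i _ /=.
have -> : iter i T (c *: u + v) = c *: iter i T u + iter i T v.
  by elim: {i}(nat_of_ord i) => //= i ->; rewrite linearP.
by rewrite scalerDr !scalerA mulrC.
Qed.

HB.instance Definition _ s := GRing.isLinear.Build K V V _ (poly_op s) (poly_op_linear s).

Lemma poly_opXM s v : poly_op (s * 'X) v = poly_op s (T v).
Proof.
rewrite (@poly_op_widen (size s).+1); last first.
  by rewrite (leq_trans (size_polyMleq _ _)) // size_polyX addn2.
rewrite big_ord_recl coefMX scale0r add0r; apply: eq_bigr => i _.
by rewrite coefMX lift0 iterSr.
Qed.

Lemma poly_opM s t v : poly_op (s * t) v = poly_op s (poly_op t v).
Proof.
have comT u : poly_op t (T u) = T (poly_op t u).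
  rewrite /poly_op linear_sum; apply: eq_bigr => i _.
  by rewrite linearZ -iterSr.
have Ct c u : poly_op (c%:P * t) u = c *: poly_op t u.
  have [->|c0] := eqVneq c 0; first by rewrite polyC0 mul0r scale0r -polyC0 poly_opC scale0r.
  rewrite /poly_op size_Cmul // scaler_sumr; apply: eq_bigr => i _.
  by rewrite coefCM scalerA.
elim/poly_ind: s v => [|s c IHs] v; first by rewrite mul0r -polyC0 !poly_opC !scale0r.
rewrite mulrDl !poly_opD Ct poly_opC -mulrA ['X * t]mulrC mulrA !poly_opXM.
by rewrite IHs comT.
Qed.

Lemma poly_op_exp mu k v : poly_op (('X - mu%:P) ^+ k) v = iter k (shift_op mu) v.
Proof.
elim: k v => [|k IHk] v; first by rewrite expr0 -polyC1 poly_opC scale1r.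
rewrite exprSr poly_opM IHk iterSr; congr (iter _ _ _).
by rewrite poly_opD -[X in poly_op X]mul1r poly_opXM -polyC1 poly_opC scale1r -polyCN poly_opC scaleNr.
Qed.

Lemma poly_op_stable s v : I v -> I (poly_op s v).
Proof.
move=> Iv; apply: subspace_sum => // i _; apply: subspaceZ => //.
by elim: (nat_of_ord i) => //= k; exact: IT.
Qed.

End GeneralizedEigenvectors.

Section Projections.
Variables (K : fieldType) (V : lmodType K) (T : {linear V -> V}).
Variables (I : V -> Prop) (sI : subspace I) (IT : forall v, I v -> I (T v)).
Variables (J : finType) (mu : J -> K) (F : J -> V).
Local Notation is0 := (fun v : V => v = 0).
Hypothesis F_eig : forall j, geigenvector T is0 (mu j) (F j).

Let s0 : subspace is0.
Proof. by split=> // c u v -> ->; rewrite scaler0 addr0. Qed.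

Let T0 v : is0 v -> is0 (T v).
Proof. by move=> ->; rewrite linear0. Qed.

(** A polynomial in [T] that kills the components for the other eigenvalues and
    is invertible on the generalized eigenspace of [m]. *)
Lemma annihilate_other m (r : seq J) : exists2 h : {poly K}, coprimep h ('X - m%:P) &
  poly_op T h (\sum_(j <- r | mu j != m) F j) = 0.
Proof.
elim: r => [|j r [h hm h0]].
  by exists 1; [exact: coprime1p|rewrite big_nil linear0].
have [jm|jm] := eqVneq (mu j) m; first by exists h; rewrite // big_cons jm eqxx.
have [k k0] := F_eig j; exists (('X - (mu j)%:P) ^+ k * h).
  rewrite coprimepMl hm andbT coprimep_expl //.
  by rewrite coprimep_XsubC root_XsubC eq_sym.
rewrite big_cons jm linearD /= [X in _ + X]poly_opM h0 linear0 addr0.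
by rewrite mulrC poly_opM poly_op_exp [iter _ _ _]k0 linear0.
Qed.

Let f_in m := \sum_(j | mu j == m) F j.
Let f_out m := \sum_(j | mu j != m) F j.

Let sum_split m : \sum_j F j = f_in m + f_out m.
Proof. by rewrite (bigID (fun j => mu j == m)). Qed.

Let bezout m l : exists a b h, [/\ a * h + b * ('X - m%:P) ^+ l = 1 :> {poly K} &
  poly_op T h (f_out m) = 0].
Proof.
have [h hm h0] := annihilate_other m (index_enum J).
have /Bezout_eq1_coprimepP[[a b] /= ab] : coprimep h (('X - m%:P) ^+ l).
  by rewrite coprimep_expr.
by exists a, b, h.
Qed.

Let f_in_eig m : geigenvector T is0 m (f_in m).
Proof.
apply: (subspace_sum (geigenvector_subspace s0 T0 m)) => j /eqP <-.
exact: F_eig.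
Qed.

Lemma eigen_component m : I (\sum_j F j) -> I (\sum_(j | mu j == m) F j).
Proof.
move=> If; have [l l0] := f_in_eig m; have [a [b [h [ab h0]]]] := bezout m l.
have -> : \sum_(j | mu j == m) F j = poly_op T (a * h) (\sum_j F j).
  rewrite (sum_split m) linearD /= [X in _ + X]poly_opM h0 linear0 addr0.
  have := poly_opC T 1 (f_in m); rewrite polyC1 -ab poly_opD scale1r.
  by rewrite [X in _ + X]poly_opM poly_op_exp [iter _ _ _]l0 linear0 addr0.
exact: poly_op_stable.
Qed.

Lemma eigen_complement m : geigenvector T I m (\sum_j F j) ->
  I (\sum_(j | mu j != m) F j).
Proof.
move=> [k Ik]; have [l' l0'] := f_in_eig m; set l := maxn k l'.
have l0 := geigenvector_leq s0 T0 (leq_maxr k l') l0'.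
have {}Ik := geigenvector_leq sI IT (leq_maxl k l') Ik.
have [a [b [h [ab h0]]]] := bezout m l.
have -> : \sum_(j | mu j != m) F j = poly_op T b (iter l (shift_op T m) (\sum_j F j)).
  rewrite (sum_split m) -poly_op_exp linearD /= poly_op_exp [iter _ _ (f_in _)]l0 add0r.
  have := poly_opC T 1 (f_out m); rewrite polyC1 -ab poly_opD scale1r.
  by rewrite poly_opM h0 linear0 add0r poly_opM.
exact: poly_op_stable.
Qed.

End Projections.

(** * Replicas and Cartan's criterion *)

Lemma peval_mx_ext (K : closedFieldType) (char0 : [pchar K] =i pred0) n
    (p q : {mpoly K[n * n]}) : (forall g, peval_mx p g = peval_mx q g) -> p = q.
Proof.
move=> pq; apply: (mpoly_ext char0) => v.
have := pq (vec_mx (\row_i v i)); rewrite /peval_mx vec_mxK.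
by under meval_eq do rewrite mxE; under [in RHS]meval_eq do rewrite mxE.
Qed.

Section Weights.
Import Order.TTheory Num.Theory.
Variables (K : closedFieldType) (char0 : [pchar K] =i pred0) (n : nat).
Local Notation peval_mx := (@peval_mx K n).
Local Notation A := {mpoly K[n * n]}.

Lemma linv_derivX (x : 'M[K]_n) i : linv_deriv x 'X_i = coordinate_mul x i.
Proof.
rewrite /linv_deriv (bigD1 i) //= big1 => [|j ji]; last first.
  by rewrite mderivX mnm1E eq_sym (negPf ji) scale0r mul0r.
rewrite mderivX mnm1E eqxx scale1r addr0.
have -> : (U_(i) - U_(i) = 0)%MM by apply/mnmP => j; rewrite mnmBE subnn mnm0E.
by rewrite mpolyX0 mul1r.
Qed.

Lemma peval_linv_derivX x g i j :
  peval_mx (linv_deriv x 'X_(mxvec_index i j)) g = (g *m x) i j.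
Proof. by rewrite linv_derivX peval_coordinate_mul mxvecE. Qed.

Variables (x P : 'M[K]_n) (Pu : P \in unitmx).
Let T := invmx P *m x *m P.
Hypothesis Ttri : block_triangular T.
Let lam j := T j j.

(** The replicas of [x]: semisimple matrices with the same generalized
    eigenvectors, whose eigenvalues satisfy the integer relations between the
    eigenvalues of [x] when [q] is orthogonal to these relations. *)
Definition replica (q : 'I_n -> int) : 'M[K]_n :=
  P *m diag_mx (\row_j (q j)%:~R) *m invmx P.

Definition weight_value (k : 'I_n -> nat) : K := \sum_j (k j)%:R * lam j.

Definition weight_pairing (k : 'I_n -> nat) (q : 'I_n -> int) : int := \sum_j (k j)%:Z * q j.

Lemma weight_pairing_eq k l q : relation_orthogonal lam q ->
  weight_value k = weight_value l -> weight_pairing k q = weight_pairing l q.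
Proof.
move=> qo kl; apply/eqP; rewrite -subr_eq0 -sumrB; apply/eqP.
apply: etrans (qo (fun j => (k j)%:Z - (l j)%:Z) _).
  by apply: eq_bigr => j _; rewrite mulrBl.
rewrite /relation (eq_bigr (fun j => (k j)%:R * lam j - (l j)%:R * lam j)).
  by rewrite sumrB [X in X - _]kl subrr.
by move=> j _; rewrite rmorphB /= mulrBl.
Qed.

Let is0 : A -> Prop := fun v => v = 0.

Let s0 : subspace is0.
Proof. by split=> // c u v -> ->; rewrite scaler0 addr0. Qed.

Let D : {linear A -> A} := linv_deriv x.

Let D0 v : is0 v -> is0 (D v).
Proof. by move=> ->; rewrite linear0. Qed.

(** The polynomials of weight [k] for the diagonal torus in the basis [P] are
    generalized eigenvectors of the derivation of [x]; this derivation sees only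
    the value of the weight on the eigenvalues of [x]. *)
Definition has_weight (k : 'I_n -> nat) (p : A) : Prop :=
  geigenvector D is0 (weight_value k) p /\
  forall q, linv_deriv (replica q) p = (weight_pairing k q)%:~R *: p.

Lemma geigenvectorM mu nu p q : geigenvector D is0 mu p -> geigenvector D is0 nu q ->
  geigenvector D is0 (mu + nu) (p * q).
Proof.
move=> [k pk] [l ql]; elim: {k l}(k + l)%N {-2}k {-2}l (leqnn (k + l)) p pk q ql.
  move=> [|k] [|l] // _ p pk q _; exists 0%N.
  by rewrite /is0 /= [p]pk mul0r.
move=> N IHN [|k] l klN p pk q ql; first by exists 0%N; rewrite /is0 /= [p]pk mul0r.
case: l klN ql => [|l] klN ql; first by exists 0%N; rewrite /is0 /= [q]ql mulr0.
apply: geigenvector_shift.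
have -> : shift_op D (mu + nu) (p * q) = shift_op D mu p * q + p * shift_op D nu q.
  rewrite /shift_op /= linv_derivM scalerDl mulrBl mulrBr -scalerAl -scalerAr; ring.
apply: (subspaceD (geigenvector_subspace s0 D0 (mu + nu))).
  by apply: (IHN k l.+1) => //; rewrite -?iterSr // -ltnS -addSn.
by apply: (IHN k.+1 l) => //; rewrite -?iterSr // -ltnS -addnS.
Qed.

Lemma has_weightM k l p q : has_weight k p -> has_weight l q ->
  has_weight (fun j => k j + l j)%N (p * q).
Proof.
move=> [pk kp] [ql lq]; split.
  have -> : weight_value (fun j => k j + l j)%N = weight_value k + weight_value l.
    by rewrite -big_split; apply: eq_bigr => j _; rewrite natrD mulrDl.
  exact: geigenvectorM.
move=> r; rewrite linv_derivM kp lq.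
have -> : weight_pairing (fun j => k j + l j)%N r = weight_pairing k r + weight_pairing l r.
  by rewrite -big_split; apply: eq_bigr => j _; rewrite PoszD mulrDl.
by rewrite rmorphD /= scalerDl -scalerAl -scalerAr.
Qed.

Lemma has_weightZ k c p : has_weight k p -> has_weight k (c *: p).
Proof.
move=> [pk kp]; split; first exact: (subspaceZ (geigenvector_subspace s0 D0 _)).
by move=> q; rewrite linearZ /= kp !scalerA mulrC.
Qed.

Let zero_weight : 'I_n -> nat := fun=> 0%N.

Lemma has_weightC c : has_weight zero_weight c%:MP.
Proof.
have wv : weight_value zero_weight = 0 by apply: big1 => j _; rewrite mul0r.
split=> [|q]; last first.
  by rewrite linv_derivC [weight_pairing _ _]big1 ?scale0r // => j _; rewrite mul0r.
by exists 1%N; rewrite /is0 wv /= /shift_op /= linv_derivC scale0r subrr.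
Qed.

(** The entries of [g *m P], on which right multiplication by a replica of [x]
    acts diagonally. *)
Definition adapted_coord (a j : 'I_n) : A := \sum_b P b j *: 'X_(mxvec_index a b).

Lemma peval_adapted_coord a j g : peval_mx (adapted_coord a j) g = (g *m P) a j.
Proof.
rewrite /Defs.peval_mx raddf_sum mxE; apply: eq_bigr => b _ /=.
by rewrite mevalZ mevalXU mxvecE mulrC.
Qed.

Lemma peval_linv_deriv_adapted y a j g :
  peval_mx (linv_deriv y (adapted_coord a j)) g = (g *m y *m P) a j.
Proof.
rewrite linear_sum /Defs.peval_mx raddf_sum mxE; apply: eq_bigr => b _ /=.
by rewrite linearZ /= mevalZ [X in _ * X]peval_linv_derivX mulrC.
Qed.

Let unit_weight (j : 'I_n) : 'I_n -> nat := fun i => (i == j) : nat.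

Lemma has_weight_adapted a j : has_weight (unit_weight j) (adapted_coord a j).
Proof.
have wv : weight_value (unit_weight j) = lam j.
  rewrite /weight_value (bigD1 j) //= /unit_weight eqxx mul1r big1 ?addr0 // => i ij.
  by rewrite (negPf ij) mul0r.
have wp q : weight_pairing (unit_weight j) q = q j.
  rewrite /weight_pairing (bigD1 j) //= /unit_weight eqxx mul1r big1 ?addr0 // => i ij.
  by rewrite (negPf ij) mul0r.
split; last first.
  move=> q; apply: (peval_mx_ext char0) => g; rewrite peval_linv_deriv_adapted wp.
  rewrite /Defs.peval_mx mevalZ [X in _ * X]peval_adapted_coord.
  rewrite /replica !mulmxA mulmxKV // mxE (bigD1 j) //= big1 => [|i ij].
    by rewrite !mxE eqxx mulr1n addr0 mulrC.
  by rewrite !mxE (negPf ij) mulr0n mulr0.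
rewrite wv; move: {wv wp}j; apply: (geigenvector_triangular s0 D0 Ttri) => j.
apply/eqP; rewrite subr_eq0; apply/eqP; apply: (peval_mx_ext char0) => g.
rewrite peval_linv_deriv_adapted /Defs.peval_mx raddf_sum /=.
have -> : g *m x *m P = g *m P *m T by rewrite /T !mulmxA mulmxK.
rewrite mxE; apply: eq_bigr => i _.
by rewrite mevalZ [X in _ = _ * X]peval_adapted_coord mulrC.
Qed.

Lemma weight_decomposition p : exists (J : finType) (k : J -> 'I_n -> nat) (F : J -> A),
  (forall j, has_weight (k j) (F j)) /\ p = \sum_j F j.
Proof.
elim/mpoly_generated: p => [c|i|p q [J [k [F [Fk ->]]]] [L [l [H [Hl ->]]]]
    |p q [J [k [F [Fk ->]]]] [L [l [H [Hl ->]]]]].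
- exists unit, (fun=> zero_weight), (fun=> c%:MP); split=> [_|]; first exact: has_weightC.
  by rewrite big_const card_unit /= addr0.
- case/mxvec_indexP: i => a b.
  exists 'I_n, unit_weight, (fun j => invmx P j b *: adapted_coord a j); split.
    by move=> j; apply: has_weightZ; exact: has_weight_adapted.
  apply: (peval_mx_ext char0) => g.
  rewrite /Defs.peval_mx raddf_sum mevalXU mxvecE -[in LHS](mulmxK Pu g) mxE.
  by apply: eq_bigr => j _ /=; rewrite mevalZ [X in _ = _ * X]peval_adapted_coord mulrC.
- exists (J + L)%type, (fun s => match s with inl j => k j | inr j => l j end),
    (fun s => match s with inl j => F j | inr j => H j end).
  by split; [case|rewrite big_sumType].
- exists (J * L)%type, (fun s i => k s.1 i + l s.2 i)%N, (fun s => F s.1 * H s.2).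
  split=> [s|]; first exact: has_weightM.
  by rewrite mulr_suml -(pair_bigA _ (fun i j => F i * H j)); apply: eq_bigr => j _;
    rewrite mulr_sumr.
Qed.

Variable G : set 'M[K]_n.
Hypothesis G_group : algebraic_group G.
Hypothesis Lx : lie G x.

Let vS : subspace (vanishing G). Proof. exact: vanishing_subspace. Qed.

Let DV p : vanishing G p -> vanishing G (D p).
Proof. exact: linv_deriv_vanishing. Qed.

(** The derivation of the replica is scalar on each generalized eigenspace of
    the derivation of [x], and the ideal of the group contains the components of
    its elements in these eigenspaces. *)
Lemma replica_lie q : relation_orthogonal lam q -> lie G (replica q).
Proof.
move=> qo p vp; suff vDp : vanishing G (linv_deriv (replica q) p).
  by have := vDp _ (group1 G_group); rewrite peval_linv_deriv mul1mx.
have [J [k [F [Fk Ep]]]] := weight_decomposition p.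
pose mu j := weight_value (k j).
pose rep j := odflt j [pick i | mu i == mu j].
have rep_mu j : mu (rep j) = mu j.
  by rewrite /rep; case: pickP => //= i /eqP.
have rep_eq i j : mu i = mu j -> rep i = rep j.
  move=> ij; rewrite /rep ij; case: pickP => //= /(_ j).
  by rewrite eqxx.
rewrite Ep linear_sum (partition_big rep predT) //=.
apply: (subspace_sum vS) => i _.
have [/existsP[j0 /eqP rj0]|/existsPn noj] := boolP [exists j, rep j == i]; last first.
  by rewrite big_pred0 => [|j]; [case: vS|apply/negbTE/noj].
have repE j : (rep j == i) = (mu j == mu i).
  apply/eqP/eqP => [<-|ji]; first by rewrite rep_mu.
  by rewrite -rj0; apply: rep_eq; rewrite ji -rj0 rep_mu.
rewrite (eq_bigr (fun j => (weight_pairing (k i) q)%:~R *: F j)); last first.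
  move=> j; rewrite repE => /eqP ji; have [_ Fq] := Fk j.
  rewrite -[LHS]/(linv_deriv (replica q) (F j)) Fq; congr (_%:~R *: _).
  exact: weight_pairing_eq.
rewrite -scaler_sumr; apply: (subspaceZ vS); rewrite (eq_bigl _ _ repE).
apply: (eigen_component (mu := mu) vS DV); last by rewrite -Ep.
by move=> j; case: (Fk j).
Qed.

(** Modulo the ideal of the group, a generalized eigenvector of [D_x] for [mu]
    only involves weights of value [mu], so the replicas act on it by scalars. *)
Lemma replica_geigenvector mu p : geigenvector D (vanishing G) mu p ->
  (forall k q, weight_value k = mu -> relation_orthogonal lam q ->
     vanishing G (linv_deriv (replica q) p - (weight_pairing k q)%:~R *: p)) /\
  ((forall k, weight_value k <> mu) -> vanishing G p).
Proof.
have [J [k [F [Fk Ep]]]] := weight_decomposition p.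
move=> pmu; pose nu j := weight_value (k j).
have : vanishing G (\sum_(j | nu j != mu) F j).
  apply: (eigen_complement (mu := nu) vS DV) => [j|]; first by case: (Fk j).
  by rewrite -Ep.
rewrite (bigID (fun j => nu j == mu)) /= in Ep; set f := \sum_(j | nu j != mu) _ in Ep *.
move=> vf; split=> [l q lmu qo|nomu]; last first.
  rewrite Ep big_pred0 ?add0r // => j; apply/negbTE/eqP; exact: nomu.
have Lq := replica_lie qo.
rewrite Ep linearD scalerDr opprD addrACA; apply: (subspaceD vS).
  rewrite linear_sum scaler_sumr -sumrB big1 => [|j /eqP jmu]; first by case: vS.
  have [_ Fq] := Fk j.
  rewrite -[X in X - _]/(linv_deriv (replica q) (F j)) Fq.
  rewrite (@weight_pairing_eq (k j) l q) ?subrr //.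
  by rewrite lmu.
apply: (subspaceB vS); first exact: linv_deriv_vanishing.
exact: (subspaceZ vS).
Qed.

Section ReplicaRepresentation.
Variables (m : nat) (R : 'I_m -> 'I_m -> A).
Hypothesis R_mul : multiplicative_rep G R.
Hypothesis R_unit : rep_at R 1%:M = 1%:M.

(** The columns of [rep_at R *m P2] are generalized eigenvectors, modulo the
    ideal of the group, of the derivation of [x]. So the eigenvalues of [drep R x]
    are values of weights, and the replicas act through these weights. *)
Lemma replica_representation : exists (P2 : 'M[K]_m) (k : 'I_m -> 'I_n -> nat),
  [/\ P2 \in unitmx, block_triangular (invmx P2 *m drep R x *m P2),
   forall j, (invmx P2 *m drep R x *m P2) j j = weight_value (k j) &
   forall q, relation_orthogonal lam q -> drep R (replica q) =
     P2 *m diag_mx (\row_j (weight_pairing (k j) q)%:~R) *m invmx P2].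
Proof.
have [P2 P2u T2tri] := block_triangularization (drep R x).
set T2 := invmx P2 *m drep R x *m P2 in T2tri.
have T2E : drep R x *m P2 = P2 *m T2 by rewrite /T2 !mulmxA mulmxV // mul1mx.
clearbody T2.
pose f i j : A := \sum_l P2 l j *: R i l.
have fE i j g : peval_mx (f i j) g = (rep_at R g *m P2) i j.
  rewrite /Defs.peval_mx raddf_sum mxE; apply: eq_bigr => l _ /=.
  by rewrite mevalZ mxE mulrC.
have DfE y i j g : G g -> lie G y ->
    peval_mx (linv_deriv y (f i j)) g = (rep_at R g *m drep R y *m P2) i j.
  move=> Gg Ly; rewrite linear_sum /Defs.peval_mx raddf_sum [RHS]mxE.
  apply: eq_bigr => l _ /=; rewrite linearZ /= mevalZ [LHS]mulrC; congr (_ * _).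
  exact: (linv_deriv_rep char0 R_mul).
have f_eig i j : geigenvector D (vanishing G) (T2 j j) (f i j).
  apply: (geigenvector_triangular vS DV T2tri (y := f i)) => {}j g Gg.
  rewrite /Defs.peval_mx mevalB [X in X - _]DfE // -mulmxA T2E mulmxA.
  apply/eqP; rewrite subr_eq0; apply/eqP; rewrite raddf_sum /= mxE; apply: eq_bigr => l _.
  by rewrite mevalZ [X in _ = _ * X]fE mulrC.
have /choice[k kE] : forall j, exists k, T2 j j = weight_value k.
  move=> j; apply: contrapT => nok.
  have fj i : vanishing G (f i j).
    by have [_ +] := replica_geigenvector (f_eig i j); apply => k E; apply: nok; exists k.
  have : P2 *m delta_mx j (0 : 'I_1) = 0.
    rewrite -colE; apply/matrixP => i b; rewrite !mxE -[RHS](fj i _ (group1 G_group)) fE.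
    by rewrite R_unit mul1mx.
  move/(canRL (mulKmx P2u)); rewrite mulmx0 => /matrixP/(_ j 0)/eqP.
  by rewrite !mxE !eqxx oner_eq0.
exists P2, k; split=> // [||q qo].
- by rewrite -mulmxA T2E mulKmx.
- by move=> j; rewrite -mulmxA T2E mulKmx.
have Lq := replica_lie qo.
apply: (canRL (mulmxK P2u)); apply/matrixP => i j.
have [+ _] := replica_geigenvector (f_eig i j) => /(_ _ q (esym (kE j)) qo).
move=> /(_ _ (group1 G_group)); rewrite /Defs.peval_mx mevalB mevalZ.
rewrite [X in X - _]DfE //; last exact: group1.
rewrite [X in _ - _ * X]fE R_unit !mul1mx => /eqP; rewrite subr_eq0 => /eqP ->.
rewrite mxE (bigD1 j) //= big1 => [|l lj]; last by rewrite !mxE (negPf lj) mulr0n mulr0.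
by rewrite !mxE eqxx mulr1n addr0 mulrC.
Qed.

(** Cartan's criterion: with [k j] the weights of the representation, the
    vanishing traces say that [sum (k j . q) k j] is a relation, so it pairs to 0
    with [q], which makes [sum (k j . q)^2] vanish. *)
Lemma replica_trace_eq0 :
  (forall q, relation_orthogonal lam q -> \tr (drep R x *m drep R (replica q)) = 0) ->
  forall q, relation_orthogonal lam q -> drep R (replica q) = 0.
Proof.
move=> tr0 q qo; have [P2 [k [P2u T2tri kE repE]]] := replica_representation.
have : \tr (drep R x *m drep R (replica q)) =
    \sum_j weight_value (k j) * (weight_pairing (k j) q)%:~R.
  rewrite (repE q qo) !mulmxA mxtrace_mulC !mulmxA; apply: eq_bigr => j _.
  rewrite mxE (bigD1 j) //= big1 => [|l lj]; last by rewrite !mxE (negPf lj) mulr0n mulr0.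
  by rewrite addr0 kE; congr (_ * _); rewrite !mxE eqxx mulr1n.
rewrite tr0 // => /esym E.
have : relation lam (fun i => \sum_j (k j i)%:Z * weight_pairing (k j) q).
  rewrite /relation -[RHS]E.
  under eq_bigr => i _ do rewrite rmorph_sum /= mulr_suml.
  rewrite exchange_big; apply: eq_bigr => j _; rewrite mulr_suml; apply: eq_bigr => i _.
  by rewrite rmorphM /= mulrAC.
move/qo => E2.
have sq0 : \sum_j weight_pairing (k j) q ^+ 2 = 0.
  rewrite -[RHS]E2; under [RHS]eq_bigr => i _ do rewrite mulr_suml.
  rewrite exchange_big; apply: eq_bigr => j _; rewrite expr2 {1}/weight_pairing mulr_suml.
  by apply: eq_bigr => i _; rewrite mulrAC.
have wp0 j : weight_pairing (k j) q = 0.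
  apply/eqP; rewrite -sqrf_eq0; move/eqP: sq0; rewrite psumr_eq0 => [/allP/(_ j)|i _].
    by rewrite mem_index_enum => /(_ isT).
  exact: sqr_ge0.
rewrite (repE q qo) (_ : diag_mx _ = 0) ?mulmx0 ?mul0mx //.
by apply/matrixP => a b; rewrite !mxE wp0 mul0rn.
Qed.

End ReplicaRepresentation.

(** The traces say that each [q] orthogonal to the relations is itself a
    relation, so that [\sum_j q j ^+ 2 = 0]. *)
Lemma nilpotent_of_replica_traces :
  (forall q, relation_orthogonal lam q -> \tr (x *m replica q) = 0) -> nilpotent_mx x.
Proof.
move=> tr0; suff lam0 j : lam j = 0.
  exists n; have := block_triangular_nilpotent Ttri lam0.
  rewrite conjmx_exp // => /(congr1 (fun B => P *m B *m invmx P)).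
  by rewrite !mulmxA mulmxV // mul1mx mulmxK // mulmx0 mul0mx.
apply: (relation_orthogonal_eq0 char0) => q qo.
have : relation lam q.
  rewrite /relation -[RHS](tr0 q qo) /replica !mulmxA mxtrace_mulC !mulmxA.
  apply: eq_bigr => j' _; rewrite mxE (bigD1 j') //= big1 => [|l lj].
    by rewrite addr0 mulrC; congr (_ * _); rewrite !mxE eqxx mulr1n.
  by rewrite !mxE (negPf lj) mulr0n mulr0.
move/qo => sq0 i; apply/eqP; rewrite -sqrf_eq0.
move/eqP: sq0; rewrite psumr_eq0 => [/allP/(_ i)|l _].
  by rewrite mem_index_enum => /(_ isT).
exact: sqr_ge0.
Qed.

End Weights.

(** * Representations with zero differential *)

Section IdealPowers.
Variables (R : comNzRingType) (N : nat) (Y : 'I_N -> R).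

Fixpoint ideal_pow (k : nat) (p : R) : Prop :=
  if k is k'.+1 then exists2 c : 'I_N -> R, (forall i, ideal_pow k' (c i)) & p = \sum_i c i * Y i
  else True.

Lemma ideal_pow_ideal k : ideal (ideal_pow k).
Proof.
elim: k => [|k [IH0 IHD IHM]]; first by split.
split=> [|x y [c cP ->] [d dP ->]|x y [c cP ->]].
- by exists (fun=> 0) => //; rewrite big1 // => i _; rewrite mul0r.
- exists (fun i => c i + d i) => [i|]; first by apply: (IHD); [exact: cP|exact: dP].
  by rewrite -big_split; apply: eq_bigr => i _; rewrite mulrDl.
- exists (fun i => x * c i) => [i|]; first by apply: (IHM); exact: cP.
  by rewrite mulr_sumr; apply: eq_bigr => i _; rewrite mulrA.
Qed.

Lemma ideal_powM k l p q : ideal_pow k p -> ideal_pow l q -> ideal_pow (k + l)%N (p * q).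
Proof.
elim: k p => [|k IHk] p.
  by move=> _ lq; rewrite add0n; have [_ _ IM] := ideal_pow_ideal l; apply: IM.
move=> [c cP ->] lq; exists (fun i => c i * q) => [i|]; first by apply: (IHk) => //; exact: cP.
by rewrite mulr_suml; apply: eq_bigr => i _; rewrite mulrAC.
Qed.

Lemma ideal_pow_gen i : ideal_pow 1 (Y i).
Proof.
exists (fun j => (j == i)%:R) => //; rewrite (bigD1 i) //= eqxx mul1r big1 ?addr0 // => j ji.
by rewrite (negPf ji) mul0r.
Qed.

Lemma ideal_powS k p : ideal_pow k.+1 p -> ideal_pow k p.
Proof.
move=> [c cP ->]; apply: (ideal_sum (ideal_pow_ideal k)) => i.
by rewrite mulrC; have [_ _ IM] := ideal_pow_ideal k; apply: IM; exact: cP.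
Qed.

End IdealPowers.

(** Krull's intersection theorem, by noetherianity of the Rees algebra: if [f]
    is in [Y^k + I] for all [k], then a relation between the elements [f T^k]
    of the Rees algebra yields [s f \in I] with [1 - s] in the ideal of [Y]. *)
Lemma krull_intersection (R : idomainType) N (Y : 'I_N -> R) (I : R -> Prop) f :
  noetherian R -> ideal I ->
  (forall k, exists2 p, ideal_pow Y k p & I (f - p)) ->
  exists2 s, ideal_pow Y 1 (1 - s) & I (s * f).
Proof.
move=> noethR iI fk; have [I0 ID IM] := iI.
pose phi : {mpoly R[N]} -> {poly R} := mmap (@polyC R) (fun i => Y i *: 'X).
have phiC c : phi c%:MP = c%:P by exact: mmapC.
have phiX i : phi 'X_i = Y i *: 'X by rewrite /phi mmapX mmap1U.
have phiD p q : phi (p + q) = phi p + phi q by exact: mmapD.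
have phiM p q : phi (p * q) = phi p * phi q by exact: (rmorphM (mmap (@polyC R) _)).
have phi_sum (J : finType) (F : J -> {mpoly R[N]}) : phi (\sum_i F i) = \sum_i phi (F i).
  exact: (raddf_sum (mmap (@polyC R) _)).
have phi_coef a j : ideal_pow Y j (phi a)`_j.
  elim/mpoly_generated: a j => [c|i|p q IHp IHq|p q IHp IHq] j.
  - rewrite phiC coefC; case: j => //= j.
    by have [+ _ _] := ideal_pow_ideal Y j.+1.
  - rewrite phiX coefZ coefX; case: j => [|[|j]] //=.
      by rewrite mulr1; exact: ideal_pow_gen.
    by rewrite mulr0; have [+ _ _] := ideal_pow_ideal Y j.+2.
  - by rewrite phiD coefD; have [_ + _] := ideal_pow_ideal Y j; apply.
  - rewrite phiM coefM; apply: (ideal_sum (ideal_pow_ideal Y j)) => i.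
    by rewrite -{1}(subnKC (ltn_ord i : (i <= j)%N)); apply: ideal_powM.
have phi_surj k p : ideal_pow Y k p -> exists a, phi a = p *: 'X^k.
  elim: k p => [|k IHk] p; first by exists p%:MP; rewrite phiC expr0 alg_polyC.
  move=> [c /(fun cP i => IHk _ (cP i))/choice[b bE] ->].
  exists (\sum_i b i * 'X_i); rewrite phi_sum scaler_suml; apply: eq_bigr => i _.
  by rewrite phiM bE phiX -scalerAl -scalerAr scalerA exprSr.
have /choice[p pP] : forall k, exists p, ideal_pow Y k p /\ I (f - p).
  by move=> k; have [p] := fk k; exists p.
have /choice[a aE] : forall k, exists a, phi a = p k *: 'X^k.
  by move=> k; apply: phi_surj; case: (pP k).
have [M [c cE]] := noetherian_mpoly noethR a.
have pM : p M = \sum_(i < M) (phi (c i))`_(M - i) * p i.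
  have := congr1 (fun b => (phi b)`_M) cE.
  rewrite aE coefZ coefXn eqxx mulr1 phi_sum coef_sum => ->; apply: eq_bigr => i _.
  rewrite phiM aE -scalerAr coefZ coefMXn ltnNge (ltnW (ltn_ord i)) /=.
  by rewrite mulrC.
exists (1 - \sum_(i < M) (phi (c i))`_(M - i)).
  rewrite opprB addrC subrK; apply: (ideal_sum (ideal_pow_ideal Y 1)) => i.
  have : ideal_pow Y (M - i) (phi (c i))`_(M - i) by exact: phi_coef.
  have : (0 < M - i)%N by rewrite subn_gt0.
  elim: (M - i)%N (phi (c i))`_(M - i) => // -[|k] IHk z _ //.
  by move/ideal_powS/IHk; apply.
have -> : (1 - \sum_(i < M) (phi (c i))`_(M - i)) * f =
    (f - p M) - \sum_(i < M) (phi (c i))`_(M - i) * (f - p i).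
  rewrite mulrBl mul1r mulr_suml.
  have -> : \sum_(i < M) (phi (c i))`_(M - i) * (f - p i) =
      \sum_(i < M) (phi (c i))`_(M - i) * f - p M.
    by rewrite pM -sumrB; apply: eq_bigr => i _; rewrite mulrBr.
  by rewrite opprB addrA subrK.
apply: (idealB iI); first by case: (pP M).
by apply: (ideal_sum iI) => i; apply: IM; case: (pP i).
Qed.

Section ConstantRepresentations.
Variables (K : closedFieldType) (char0 : [pchar K] =i pred0) (n : nat).
Variables (G : set 'M[K]_n) (G_group : algebraic_group G).
Hypothesis G_connected : connected_set (@closed_mx K n) G.
Local Notation peval_mx := (@peval_mx K n).
Local Notation A := {mpoly K[n * n]}.

(** Coordinates centred at the identity. *)
Let Y (i : 'I_(n * n)) : A := 'X_i - (mxvec (1%:M : 'M[K]_n) 0 i)%:MP.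
Local Notation mpow := (ideal_pow Y).

Lemma peval_Y i g : peval_mx (Y i) g = mxvec (g - 1%:M) 0 i.
Proof. by rewrite /Defs.peval_mx mevalB mevalXU mevalC raddfB !mxE. Qed.

Lemma mpow1_peval1 p : mpow 1 p -> peval_mx p 1%:M = 0.
Proof.
move=> [c _ ->]; rewrite /Defs.peval_mx raddf_sum big1 // => i _ /=.
by rewrite mevalM [X in _ * X]peval_Y subrr linear0 mxE mulr0.
Qed.

Lemma taylor p :
  mpow 2 (p - (peval_mx p 1%:M)%:MP - \sum_i peval_mx p^`M(i) 1%:M *: Y i).
Proof.
have [m0 mD mM] := ideal_pow_ideal Y 2.
elim/mpoly_generated: p => [c|i|p q IHp IHq|p q IHp IHq].
- rewrite big1 => [|i _]; last by rewrite mderivC /Defs.peval_mx meval0 scale0r.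
  by rewrite /Defs.peval_mx mevalC subrr subr0.
- rewrite (bigD1 i) //= big1 => [|j ji]; last first.
    by rewrite mderivX mnm1E eq_sym (negPf ji) scale0r /Defs.peval_mx meval0 scale0r.
  rewrite mderivX mnm1E eqxx scale1r addr0.
  have -> : (U_(i) - U_(i) = 0)%MM by apply/mnmP => j; rewrite mnmBE subnn mnm0E.
  rewrite mpolyX0 {2}/Defs.peval_mx meval1 scale1r.
  by rewrite /Defs.peval_mx mevalXU subrr.
- have -> : p + q - (peval_mx (p + q) 1%:M)%:MP - \sum_i peval_mx (p + q)^`M(i) 1%:M *: Y i
    = (p - (peval_mx p 1%:M)%:MP - \sum_i peval_mx p^`M(i) 1%:M *: Y i) +
      (q - (peval_mx q 1%:M)%:MP - \sum_i peval_mx q^`M(i) 1%:M *: Y i); last exact: mD.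
  have -> : \sum_i peval_mx (p + q)^`M(i) 1%:M *: Y i =
      \sum_i peval_mx p^`M(i) 1%:M *: Y i + \sum_i peval_mx q^`M(i) 1%:M *: Y i.
    rewrite -big_split; apply: eq_bigr => i _ /=.
    by rewrite mderivD /Defs.peval_mx mevalD scalerDl.
  by rewrite {1}/Defs.peval_mx mevalD mpolyCD; ring.
- set p1 := \sum_i _ in IHp; set q1 := \sum_i _ in IHq.
  set p0 := peval_mx p _ in IHp; set q0 := peval_mx q _ in IHq.
  have -> : \sum_i peval_mx (p * q)^`M(i) 1%:M *: Y i = q0%:MP * p1 + p0%:MP * q1.
    rewrite !mulr_sumr -big_split; apply: eq_bigr => i _ /=.
    by rewrite mderivM /Defs.peval_mx mevalD !mevalM scalerDl !mul_mpolyC !scalerA mulrC.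
  have -> : peval_mx (p * q) 1%:M = p0 * q0 by rewrite /Defs.peval_mx mevalM.
  have m1 : forall c : 'I_(n * n) -> K, mpow 1 (\sum_i c i *: Y i).
    by move=> c; exists (fun i => (c i)%:MP) => //; apply: eq_bigr => i _; rewrite mul_mpolyC.
  have -> : p * q - (p0 * q0)%:MP - (q0%:MP * p1 + p0%:MP * q1) =
     q * (p - p0%:MP - p1) + (p0%:MP + p1) * (q - q0%:MP - q1) + p1 * q1.
    by rewrite mpolyCM; ring.
  apply: (mD); last by apply: (@ideal_powM _ _ _ 1 1); exact: m1.
  by apply: (mD); exact: mM.
Qed.

(** Biduality: the Lie algebra is by definition the orthogonal of the space of
    linear parts of equations of the group. *)
Lemma lie_annihilator (l : 'I_(n * n) -> K) :
  (forall x, lie G x -> \sum_i mxvec x 0 i * l i = 0) ->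
  exists2 p, vanishing G p & forall i, peval_mx p^`M(i) 1%:M = l i.
Proof.
move=> lL; pose S (u : 'rV[K]_(n * n)) := exists2 p, vanishing G p &
  forall i, peval_mx p^`M(i) 1%:M = u 0 i.
have sS : subspace S.
  have vS := vanishing_subspace G.
  split=> [|c u v [p vp pu] [q vq qv]].
    exists 0; first by case: vS.
    by move=> i; rewrite mderiv0 /Defs.peval_mx meval0 mxE.
  exists (c *: p + q); first by case: vS => _; apply.
  by move=> i; rewrite mderivD mderivZ /Defs.peval_mx mevalD mevalZ [X in c * X]pu
    [X in _ + X]qv !mxE.
have [[p vp pl]|nS] := pselect (S (\row_i l i)).
  by exists p => // i; rewrite pl mxE.
have [v [vS]] := subspace_separation sS nS; case/eqP.
apply/matrixP => a b; rewrite !ord1 [RHS]mxE mxE.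
rewrite -[RHS](lL (vec_mx v^T)).
  by rewrite vec_mxK; apply: eq_bigr => i _; rewrite !mxE mulrC.
move=> p vp; have : (\row_i peval_mx p^`M(i) 1%:M) *m v = 0.
  by apply: vS; exists p => // i; rewrite mxE.
move/matrixP/(_ 0 0); rewrite [LHS]mxE [RHS]mxE => Epv; rewrite -[RHS]Epv /directional vec_mxK.
by apply: eq_bigr => i _; rewrite !mxE.
Qed.

Lemma mpow1_sub p : mpow 1 (p - (peval_mx p 1%:M)%:MP).
Proof.
have [_ mD _] := ideal_pow_ideal Y 1.
rewrite -[_ - _](subrK (\sum_i peval_mx p^`M(i) 1%:M *: Y i)); apply: mD.
  exact/ideal_powS/taylor.
by exists (fun i => (peval_mx p^`M(i) 1%:M)%:MP) => //; apply: eq_bigr => i _;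
  rewrite mul_mpolyC.
Qed.

Lemma ideal_sum2 (P Q : A -> Prop) : ideal P -> ideal Q ->
  ideal (fun x => exists2 y, P y & Q (x - y)).
Proof.
move=> [P0 PD PM] [Q0 QD QM]; split=> [|x y [u Pu Qu] [v Pv Qv]|x y [u Pu Qu]].
- by exists 0; rewrite ?subr0.
- by exists (u + v); [exact: PD|rewrite opprD addrACA; exact: QD].
- by exists (x * u); [exact: PM|rewrite -mulrBr; exact: QM].
Qed.

(** The Euler field [Delta], tangent to the group, acts on functions of order [k]
    at 1 as multiplication by [k], modulo higher order and the ideal of the
    group. So [f], killed by [Delta] on the group, has no part of positive
    order. *)
Lemma infinite_order_vanishing (f : A) : peval_mx f 1%:M = 0 ->
  (forall x, lie G x -> vanishing G (linv_deriv x f)) ->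
  forall k, exists2 p, mpow k p & vanishing G (f - p).
Proof.
move=> f1 Df; have iV := vanishing_ideal G; have [V0 VD VM] := iV.
have [lS0 lSD] := lie_subspace G.
have [|L LE] := @subspace_rowspace K (n * n) (fun u => lie G (vec_mx u)).
  by split=> [|c u v]; rewrite ?linear0 ?linearP //; exact: lSD.
(* The rows of the projection [E] onto the Lie algebra provide the tangent
   directions of [Delta], with coefficients the coordinates [Y]. *)
pose E := proj_mx L (L^C)%MS.
have EL j : lie G (vec_mx (row j E)).
  apply/LE; have -> : row j E = row j 1%:M *m E by rewrite -row_mul mul1mx.
  exact: proj_mx_sub.
have Eid x : lie G x -> mxvec x *m E = mxvec x.
  by move=> Lx; apply: proj_mx_id; [exact: capmx_compl|apply/LE; rewrite mxvecK].
pose Delta (p : A) := \sum_j Y j * linv_deriv (vec_mx (row j E)) p.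
have DeltaD p q : Delta (p + q) = Delta p + Delta q.
  by rewrite -big_split; apply: eq_bigr => j _; rewrite linearD mulrDr.
have DeltaM p q : Delta (p * q) = Delta p * q + p * Delta q.
  rewrite mulr_suml mulr_sumr -big_split; apply: eq_bigr => j _ /=.
  by rewrite linv_derivM; ring.
have DeltaV p : vanishing G p -> vanishing G (Delta p).
  move=> vp; apply: (ideal_sum iV) => j; apply: VM.
  exact: linv_deriv_vanishing.
pose M k := fun p : A => exists2 q, mpow k q & vanishing G (p - q).
have iM k : ideal (M k) by apply: ideal_sum2 => //; exact: ideal_pow_ideal.
have powM k p : mpow k p -> M k p by exists p; rewrite ?subrr.
have MM k l p q : M k p -> mpow l q -> M (k + l)%N (p * q).
  move=> [u ku vu] lq; exists (u * q); first exact: ideal_powM.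
  by rewrite -mulrBl mulrC; exact: VM.
have DeltaY i : M 2 (Delta (Y i) - Y i).
  have dY j : mpow 1 (linv_deriv (vec_mx (row j E)) (Y i) - (E j i)%:MP).
    have -> : E j i = peval_mx (linv_deriv (vec_mx (row j E)) (Y i)) 1%:M.
      rewrite linearB /= linv_derivC subr0 linv_derivX peval_coordinate_mul mul1mx.
      by rewrite vec_mxK [RHS]mxE.
    exact: mpow1_sub.
  have m1 : mpow 2 (Delta (Y i) - \sum_j (E j i)%:MP * Y j).
    rewrite -sumrB; apply: (ideal_sum (ideal_pow_ideal Y 2)) => j.
    rewrite [_%:MP * _]mulrC -mulrBr.
    by apply: (@ideal_powM _ _ _ 1 1); [exact: ideal_pow_gen|exact: dY].
  have [p vp pl] : exists2 p, vanishing G p &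
      forall j, peval_mx p^`M(j) 1%:M = (j == i)%:R - E j i.
    apply: lie_annihilator => x Lx; under eq_bigr => j _ do rewrite mulrBr.
    rewrite sumrB (bigD1 i) //= eqxx mulr1 big1 ?addr0 => [|j ji]; last first.
      by rewrite (negPf ji) mulr0.
    have := Eid x Lx => /rowP/(_ i); rewrite mxE => ->.
    by rewrite subrr.
  have m2 : M 2 (Y i - \sum_j (E j i)%:MP * Y j).
    have -> : Y i - \sum_j (E j i)%:MP * Y j = \sum_j peval_mx p^`M(j) 1%:M *: Y j.
      rewrite [RHS](eq_bigr (fun j => (j == i)%:R *: Y j - (E j i)%:MP * Y j)).
        rewrite sumrB; congr (_ - _); rewrite (bigD1 i) //= eqxx scale1r big1 ?addr0 // => j ji.
        by rewrite (negPf ji) scale0r.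
      by move=> j _; rewrite pl scalerBl mul_mpolyC.
    have := taylor p; rewrite (vp _ (group1 G_group)) mpolyC0 subr0 => tp.
    exists (- (p - \sum_j peval_mx p^`M(j) 1%:M *: Y j)).
      exact: (idealN (ideal_pow_ideal Y 2)).
    by rewrite opprK addrC subrK.
  have -> : Delta (Y i) - Y i = (Delta (Y i) - \sum_j (E j i)%:MP * Y j) -
    (Y i - \sum_j (E j i)%:MP * Y j) by ring.
  by apply: (idealB (iM 2)) => //; exact: powM.
have DeltaP k : forall q, mpow k q -> M k.+1 (Delta q - k%:R *: q).
  elim: k => [q _|k IHk _ [c cP ->]].
    rewrite scale0r subr0; apply: powM; exists (fun j => linv_deriv (vec_mx (row j E)) q) => //.
    by apply: eq_bigr => j _; rewrite mulrC.
  have -> : Delta (\sum_i c i * Y i) - k.+1%:R *: \sum_i c i * Y i =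
      \sum_i ((Delta (c i) - k%:R *: c i) * Y i + (Delta (Y i) - Y i) * c i).
    have -> : Delta (\sum_i c i * Y i) = \sum_i Delta (c i * Y i).
      elim/big_rec2: _ => [|i y1 y2 _ <-]; last exact: DeltaD.
      by apply: big1 => j _; rewrite linear0 mulr0.
    rewrite scaler_sumr -sumrB; apply: eq_bigr => i _.
    rewrite DeltaM -[k.+1]addn1 natrD scalerDl scale1r mulrBl scalerAl; ring.
  apply: (ideal_sum (iM k.+2)) => i; have [_ MD _] := iM k.+2; apply: MD.
    by rewrite -addn1; apply: MM; [apply: IHk; exact: cP|exact: ideal_pow_gen].
  by rewrite -add2n; apply: MM => //; exact: cP.
elim=> [|k [p mp vp]]; first by exists f; rewrite ?subrr.
case: k p mp vp => [p _ _|k p mp vp].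
  exists f; last by rewrite subrr.
  by have := mpow1_sub f; rewrite f1 mpolyC0 subr0.
have VDp : vanishing G (Delta p).
  have -> : Delta p = Delta f + - Delta (f - p) by rewrite -{1}[f](subrK p) (DeltaD (f - p) p) [RHS]addrC addKr.
  apply: VD; last by apply: (idealN iV); exact: DeltaV.
  by apply: (ideal_sum iV) => j; apply/VM/Df.
have Mp : M k.+2 p.
  have k0 : k.+1%:R != 0 :> K by move/pcharf0P : char0 => ->.
  have -> : p = (k.+1%:R^-1)%:MP * (k.+1%:R *: p) by rewrite mul_mpolyC scalerA mulVf ?scale1r.
  have [_ _] := iM k.+2; apply.
  have -> : k.+1%:R *: p = Delta p - (Delta p - k.+1%:R *: p) by rewrite subKr.
  apply: (idealB (iM k.+2)); last exact: DeltaP.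
  by exists 0; [case: (ideal_pow_ideal Y k.+2)|rewrite subr0].
case: Mp => q mq vq; exists q => //.
by rewrite -[f](subrK p) -addrA; exact: VD.
Qed.

(** The entries of the representation are constant to infinite order at 1, so by
    Krull's theorem they are constant where some [S] with [S 1 = 1] does not
    vanish. The kernel of the representation is closed, and so is its complement:
    there all translates of [S] by elements of the kernel vanish. *)
Lemma rep_constant m (R : 'I_m -> 'I_m -> A) : multiplicative_rep G R ->
  (forall x, lie G x -> drep R x = 0) -> forall g, G g -> rep_at R g = rep_at R 1%:M.
Proof.
move=> R_mul dR0.
have /choice[s sP] : forall ij : 'I_m * 'I_m, exists s, peval_mx s 1%:M = 1 /\
    vanishing G (s * (R ij.1 ij.2 - (peval_mx (R ij.1 ij.2) 1%:M)%:MP)).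
  move=> [i j] /=; set f := _ - _.
  have f1 : peval_mx f 1%:M = 0 by rewrite /Defs.peval_mx mevalB mevalC subrr.
  have Df x : lie G x -> vanishing G (linv_deriv x f).
    move=> Lx g Gg; rewrite linearB /= linv_derivC subr0 (linv_deriv_rep char0 R_mul) //.
    by rewrite dR0 // mulmx0 mxE.
  have noethA : noetherian A := noetherian_mpoly (@noetherian_field K).
  have [s s1 vs] := krull_intersection noethA (vanishing_ideal G) (infinite_order_vanishing f1 Df).
  exists s; split=> //; have := mpow1_peval1 s1.
  rewrite /Defs.peval_mx mevalB meval1 => /eqP; rewrite subr_eq0 => /eqP <-.
  by [].
pose S := \prod_ij s ij.
have S1 : peval_mx S 1%:M = 1.
  by rewrite /Defs.peval_mx rmorph_prod big1 // => ij _; case: (sP ij).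
have Sg g : G g -> peval_mx S g != 0 -> rep_at R g = rep_at R 1%:M.
  move=> Gg; rewrite /Defs.peval_mx rmorph_prod => /prodf_neq0 nz.
  apply/matrixP => i j; rewrite !mxE; have [_ /(_ g Gg)] := sP (i, j).
  rewrite /Defs.peval_mx mevalM mevalB mevalC => /eqP; rewrite mulf_eq0.
  by rewrite (negPf (nz (i, j) isT)) /= subr_eq0 => /eqP.
pose AA : set 'M[K]_n := [set g | forall p, (exists i j,
   p = R i j - (peval_mx (R i j) 1%:M)%:MP) -> peval_mx p g = 0]%classic.
have AAP g : AA g <-> rep_at R g = rep_at R 1%:M.
  split=> [Ag|gE p [i [j ->]]].
    apply/matrixP => i j; rewrite !mxE; apply/eqP; rewrite -subr_eq0; apply/eqP.
    have := Ag _ (ex_intro _ i (ex_intro _ j erefl)).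
    by rewrite /Defs.peval_mx mevalB mevalC.
  have /matrixP/(_ i j) := gE; rewrite !mxE => E.
  by rewrite /Defs.peval_mx mevalB mevalC [X in X - _]E subrr.
pose BB : set 'M[K]_n := [set g | forall p, (exists2 h, G h /\ AA h &
   forall g', peval_mx p g' = peval_mx S (invmx h *m g')) -> peval_mx p g = 0]%classic.
have BBP h g : G h -> AA h -> BB g -> peval_mx S (invmx h *m g) = 0.
  move=> Gh Ah Bg; have [|p pE] := polyfun_comp (polyfun_peval S) (F := fun g => invmx h *m g).
    by apply: polymap_mul; [exact: polymap_const|exact: polymap_id].
  by rewrite pE; apply: Bg; exists h => // g'; rewrite pE.
have [_ conn] := G_connected.
have [|||| GA|GB] := conn AA BB.
- by exists [set p | exists i j, p = R i j - (peval_mx (R i j) 1%:M)%:MP]%classic.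
- by exists [set p | exists2 h, G h /\ AA h &
    forall g', peval_mx p g' = peval_mx S (invmx h *m g')]%classic.
- move=> g Gg; have [Ag|nAg] := pselect (AA g); [by left|right].
  move=> p [h [Gh Ah] pE]; rewrite pE; apply: contrapT => /eqP nz.
  apply: nAg; apply/AAP; have := Sg _ (groupM G_group (groupV G_group Gh) Gg) nz.
  move/(congr1 (mulmx (rep_at R h))); rewrite -!R_mul //; try exact: group1.
    by rewrite mulmxA (mulmx_groupV G_group) // mul1mx mulmx1 => ->; apply/AAP.
  by apply: groupM => //; exact: groupV.
- rewrite -subset0 => g [[Gg Ag] Bg]; have := BBP g g Gg Ag Bg.
  by rewrite (mulmx_Vgroup G_group) // S1 => /eqP; rewrite oner_eq0.
- by move=> g /GA/AAP.
- have A1 : AA 1%:M by apply/AAP.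
  have := BBP _ _ (group1 G_group) A1 (GB _ (group1 G_group)).
  by rewrite invmx1 mul1mx S1 => /eqP; rewrite oner_eq0.
Qed.

End ConstantRepresentations.

(** * Linear reductivity *)

Section LinearReductivity.
Variables (K : closedFieldType) (char0 : [pchar K] =i pred0) (n : nat).
Variables (G : set 'M[K]_n) (G_group : algebraic_group G).
Hypothesis G_nochar : no_nontrivial_characters G.
Hypothesis G_connected : connected_set (@closed_mx K n) G.
Hypothesis G_reductive : reductive G.
Local Notation peval_mx := (@peval_mx K n).
Local Notation A := {mpoly K[n * n]}.

(** The Lie algebra, in row vectors, where bases and Gram matrices live. *)
Let S (u : 'rV[K]_(n * n)) : Prop := lie G (vec_mx u).

Let sS : subspace S.
Proof.
have [S0 SD] := lie_subspace G.
by split=> [|c u v Su Sv]; rewrite /S ?linear0 // linearP; exact: SD.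
Qed.

Let tform (u v : 'rV[K]_(n * n)) : K := \tr (vec_mx u *m vec_mx v).

Let tform_l y c u v : tform (c *: u + v) y = c * tform u y + tform v y.
Proof. by rewrite /tform linearP mulmxDl -scalemxAl mxtraceD mxtraceZ. Qed.

Let tform_r x c u v : tform x (c *: u + v) = c * tform x u + tform x v.
Proof. by rewrite /tform linearP mulmxDr -scalemxAr mxtraceD mxtraceZ. Qed.

Let conj_row g (u : 'rV[K]_(n * n)) : 'rV[K]_(n * n) :=
  mxvec (g *m vec_mx u *m invmx g).

Let S_conj g u : G g -> S u -> S (conj_row g u).
Proof. by move=> Gg Su; rewrite /S mxvecK; exact: lie_conj. Qed.

Let tform_conj g u v : G g -> tform (conj_row g u) (conj_row g v) = tform u v.
Proof.
move=> Gg; rewrite /tform !mxvecK !mulmxA -[_ *m invmx g *m g]mulmxA.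
rewrite (mulmx_Vgroup G_group) // mulmx1 mxtrace_mulC !mulmxA.
by rewrite (mulmx_Vgroup G_group) // mul1mx.
Qed.

Let conj_rowVK g u : G g -> conj_row g (conj_row (invmx g) u) = u.
Proof.
move=> Gg; rewrite /conj_row mxvecK invmxK !mulmxA (mulmx_groupV G_group) // mul1mx.
by rewrite -mulmxA (mulmx_groupV G_group) // mulmx1 vec_mxK.
Qed.

Lemma orthogonal_in_subspace (b : 'rV[K]_(n * n) -> 'rV[K]_(n * n) -> K) T :
  (forall y c u v, b (c *: u + v) y = c * b u y + b v y) ->
  subspace (orthogonal_in b S T).
Proof.
move=> bl; have [S0 SD] := sS; split=> [|c u v [Su uT] [Sv vT]].
  split=> // y Ty; have := bl y 1 0 0; rewrite scaler0 addr0 mul1r => E.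
  by apply: (addrI (b 0 y)); rewrite -E addr0.
split=> [|y Ty]; first exact: SD.
by rewrite bl uT // vT // mulr0 addr0.
Qed.

(** The elements of such a subspace are nilpotent, by
    [nilpotent_of_replica_traces], so that [lie_nilpotent_eq0] applies. *)
Lemma conj_stable_eq0 (T : 'rV[K]_(n * n) -> Prop) : subspace T ->
  (forall u, T u -> S u) -> (forall g u, G g -> T u -> T (conj_row g u)) ->
  (forall x P q, T (mxvec x) -> P \in unitmx ->
     block_triangular (invmx P *m x *m P) ->
     relation_orthogonal (fun j => (invmx P *m x *m P) j j) q ->
     \tr (x *m replica P q) = 0) ->
  forall u, T u -> u = 0.
Proof.
move=> sT TS Tconj Ttr u Tu.
suff E : vec_mx u = 0 by rewrite -[u]vec_mxK E linear0.
have TL x : T (mxvec x) -> lie G x by move/TS; rewrite /S mxvecK.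
apply: (lie_nilpotent_eq0 char0 G_group G_nochar G_reductive (a := fun x => T (mxvec x))).
- by case: sT => T0 TD; split=> [|c x y Tx Ty]; rewrite ?linear0 ?linearP //; exact: TD.
- exact: TL.
- move=> x Tx; have [P Pu Ptri] := block_triangularization x.
  apply: (nilpotent_of_replica_traces char0 Pu Ptri) => q qo.
  exact: Ttr Tx Pu Ptri qo.
- by move=> g x Gg Tx; have := Tconj g _ Gg Tx; rewrite /conj_row mxvecK.
- by rewrite vec_mxK.
Qed.

Section TraceForm.
Variables (m : nat) (R : 'I_m -> 'I_m -> A).
Hypothesis R_mul : multiplicative_rep G R.
Hypothesis R_unit : rep_at R 1%:M = 1%:M.

Let rform (u v : 'rV[K]_(n * n)) : K := \tr (drep R (vec_mx u) *m drep R (vec_mx v)).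

Let rform_l y c u v : rform (c *: u + v) y = c * rform u y + rform v y.
Proof. by rewrite /rform linearP drep_linear mulmxDl -scalemxAl mxtraceD mxtraceZ. Qed.

Let rform_r x c u v : rform x (c *: u + v) = c * rform x u + rform x v.
Proof. by rewrite /rform linearP drep_linear mulmxDr -scalemxAr mxtraceD mxtraceZ. Qed.

Let rformC u v : rform u v = rform v u.
Proof. exact: mxtrace_mulC. Qed.

Let repVK g : G g -> rep_at R (invmx g) *m rep_at R g = 1%:M.
Proof.
move=> Gg; rewrite -R_mul //; last exact: groupV.
by rewrite (mulmx_Vgroup G_group).
Qed.

Let rform_conj g u v : G g -> S u -> S v -> rform (conj_row g u) (conj_row g v) = rform u v.
Proof.
move=> Gg Su Sv; rewrite /rform !mxvecK !(drep_conj char0 G_group R_mul) //.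
rewrite !mulmxA -[_ *m rep_at R (invmx g) *m rep_at R g]mulmxA repVK // mulmx1.
by rewrite mxtrace_mulC !mulmxA repVK // mul1mx.
Qed.

(** The complement of [Trad] is taken for the trace form of matrices, as [rform]
    is 0 on [Trad]. *)
Let Trad : 'rV[K]_(n * n) -> Prop := orthogonal_in rform S S.
Let Torth : 'rV[K]_(n * n) -> Prop := orthogonal_in tform S Trad.

Let sTrad : subspace Trad. Proof. exact: orthogonal_in_subspace. Qed.

Let sTorth : subspace Torth. Proof. exact: orthogonal_in_subspace. Qed.

Let Trad_conj g u : G g -> Trad u -> Trad (conj_row g u).
Proof.
move=> Gg [Su u0]; split; first exact: S_conj.
move=> y Sy; rewrite -[y](conj_rowVK _ Gg) rform_conj //.
  by apply: u0; apply: S_conj => //; exact: groupV.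
by apply: S_conj => //; exact: groupV.
Qed.

Let Torth_conj g u : G g -> Torth u -> Torth (conj_row g u).
Proof.
move=> Gg [Su u0]; split; first exact: S_conj.
move=> y Ty; rewrite -[y](conj_rowVK _ Gg) tform_conj //.
by apply: u0; apply: Trad_conj => //; exact: groupV.
Qed.

(** The replicas of [x] lie in the Lie algebra, so [x] is orthogonal to them for
    [rform], and [replica_trace_eq0] applies. *)
Let Trad_replica x P q : Trad (mxvec x) -> P \in unitmx ->
  block_triangular (invmx P *m x *m P) ->
  relation_orthogonal (fun j => (invmx P *m x *m P) j j) q ->
  S (mxvec (replica P q)) /\ drep R (replica P q) = 0.
Proof.
move=> [Sx x0] Pu Ptri qo; have Lx : lie G x by move: Sx; rewrite /S mxvecK.
have LQ r : relation_orthogonal (fun j => (invmx P *m x *m P) j j) r -> lie G (replica P r).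
  exact: (replica_lie char0 Pu Ptri G_group Lx).
split; first by rewrite /S mxvecK; exact: LQ.
apply: (replica_trace_eq0 char0 Pu Ptri G_group Lx R_mul R_unit) => // r ro.
have := x0 (mxvec (replica P r)); rewrite /rform !mxvecK; apply.
by rewrite /S mxvecK; exact: LQ.
Qed.

Let Trad_Torth u : Trad u -> Torth u -> u = 0.
Proof.
move=> Tu Ou.
apply: (@conj_stable_eq0 (fun v => Trad v /\ Torth v)) => //.
- case: sTrad sTorth => R0 RD [O0 OD]; split=> // c v w [Rv Ov] [Rw Ow].
  by split; [exact: RD|exact: OD].
- by move=> v [[]].
- by move=> g v Gg [Rv Ov]; split; [exact: Trad_conj|exact: Torth_conj].
- move=> x P q [Rx [_ Ox]] Pu Ptri qo; have [SQ dQ] := Trad_replica Rx Pu Ptri qo.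
  have := Ox (mxvec (replica P q)); rewrite /tform !mxvecK; apply; split=> // y Sy.
  by rewrite /rform mxvecK dQ mul0mx mxtrace0.
Qed.

Let S_decomposition u : S u -> exists y z, [/\ Trad y, Torth z & u = y + z].
Proof.
apply: (orthogonal_decomposition tform_l tform_r sS sTrad) => [x []|x] //.
exact: Trad_Torth.
Qed.

(** The orthogonal of the kernel of [drep R] is stable under conjugation, and is
    orthogonal to the replicas of its elements, which lie in the kernel. So it
    is 0, and the kernel is the whole Lie algebra. *)
Let drep_eq0_of_radical : (forall u, S u -> Trad u) -> forall x, lie G x -> drep R x = 0.
Proof.
move=> ST x Lx; pose T0 u := S u /\ drep R (vec_mx u) = 0.
have sT0 : subspace T0.
  have [S0 SD] := sS; split=> [|c u v [Su u0] [Sv v0]].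
    split=> //; rewrite linear0; have := drep_linear R 1 0 0.
    by rewrite scaler0 addr0 scale1r => E; apply: (addrI (drep R 0)); rewrite -E addr0.
  split; first exact: SD.
  by rewrite linearP drep_linear u0 v0 scaler0 addr0.
have T0_conj g u : G g -> T0 u -> T0 (conj_row g u).
  move=> Gg [Su u0]; split; first exact: S_conj.
  by rewrite mxvecK (drep_conj char0 G_group R_mul) // u0 mulmx0 mul0mx.
have T00 u : orthogonal_in tform S T0 u -> u = 0.
  apply: conj_stable_eq0 => [|v []//|g v Gg [Sv v0]|y P q Ty Pu Ptri qo].
  - exact: orthogonal_in_subspace.
  - split; first exact: S_conj.
    move=> y Ty; rewrite -[y](conj_rowVK _ Gg) tform_conj //.
    by apply: v0; apply: T0_conj => //; exact: groupV.
  - have [Sy y0] := Ty; have [SQ dQ] := Trad_replica (ST _ Sy) Pu Ptri qo.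
    have := y0 (mxvec (replica P q)); rewrite /tform !mxvecK; apply.
    by split; rewrite ?mxvecK.
have := orthogonal_eq0_full tform_l tform_r sS sT0 (fun u (Tu : T0 u) => proj1 Tu) T00.
move=> /(_ (mxvec x)); rewrite /S mxvecK => /(_ Lx) [_].
by rewrite mxvecK.
Qed.

(** The Casimir operator of [Torth], on which the trace form of the
    representation is nondegenerate; its trace is the dimension of [Torth]. *)
Let casimir : exists (C : 'M[K]_m) (d : nat),
  [/\ combination_of_group G R 0 C, \tr C = d%:R,
      forall g, G g -> rep_at R g *m C = C *m rep_at R g &
      d = 0%N -> forall u, S u -> Trad u].
Proof.
have [L LE] := subspace_rowspace sTorth.
pose B := row_base L; have BE u : Torth u <-> (u <= B)%MS by rewrite eq_row_base.
pose Gm := gram rform B B.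
have BO i : Torth (row i B) by apply/BE; exact: row_sub.
have BS i : S (row i B) by case: (BO i).
have Gu : Gm \in unitmx.
  rewrite -row_free_unit -kermx_eq0; apply/eqP/row_matrixP => i; rewrite row0.
  set u := row i _; have uG : u *m Gm = 0 by apply/sub_kermxP; exact: row_sub.
  have OuB : Torth (u *m B) by apply/BE; exact: submxMl.
  have : u *m B = 0.
    apply: Trad_Torth => //; split; first by case: OuB.
    move=> y /S_decomposition[y1 [y2 [[Sy1 y10] Oy2 ->]]].
    have -> : rform (u *m B) (y1 + y2) = rform (u *m B) y1 + rform (u *m B) y2.
      by rewrite -[y1]scale1r rform_r mul1r scale1r.
    rewrite rformC y10 ?add0r; last by case: OuB.
    by apply: (orthogonal_in_gram rform_l rform_r uG); apply/BE.
  by move/(canRL (mulmxKp (row_base_free L))); rewrite mul0mx.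
pose X i := drep R (vec_mx (row i B)).
have XE (u : 'rV_(\rank L)) : drep R (vec_mx (u *m B)) = \sum_k u 0 k *: X k.
  rewrite [u *m B]mulmx_sum_row linear_sum.
  elim/big_rec2: _ => [|k y1 y2 _ <-]; last by rewrite linearZ drep_linear.
  have := drep_linear R 1 0 0; rewrite scaler0 addr0 scale1r => E.
  by apply: (addrI (drep R 0)); rewrite -E addr0.
pose C := \sum_i \sum_j (invmx Gm) i j *: (X i *m X j).
have C0 : combination_of_group G R 0 C.
  have Xc i : combination_of_group G R 0 (X i).
    by apply: (combination_group_drep char0); exact: BS.
  have -> : 0 = \sum_(i < \rank L) \sum_(j < \rank L) (invmx Gm) i j * (0 * 0) :> K.
    by rewrite big1 // => i _; rewrite big1 // => j _; rewrite !mulr0.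
  apply: combination_group_sum => i; apply: combination_group_sum => j.
  by apply: combination_groupZ; apply: combination_groupM.
exists C, (\rank L); split=> // [|g Gg|rL0 u Su].
- rewrite /C; rewrite raddf_sum /=.
  have -> : \sum_(i < \rank L) \tr (\sum_j (invmx Gm) i j *: (X i *m X j)) =
      \tr (invmx Gm *m Gm).
    apply: eq_bigr => i _; rewrite raddf_sum mxE; apply: eq_bigr => j _ /=.
    by rewrite mxtraceZ mxE rformC.
  by rewrite mulVmx // mxtrace1.
- pose M := \matrix_i conj_row g (row i B).
  have MB : (M <= B)%MS.
    by apply/row_subP => i; rewrite rowK; apply/BE; exact: Torth_conj.
  have [a Ma] := submxP MB.
  have aG : a *m Gm *m a^T = Gm.
    rewrite -(gram_mulmx rform_l rform_r) -Ma; apply/matrixP => i j.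
    by rewrite !mxE !rowK rform_conj.
  have aGV : a^T *m invmx Gm *m a = invmx Gm.
    have : a *m (Gm *m a^T *m invmx Gm) = 1%:M by rewrite !mulmxA aG mulmxV.
    move/mulmx1C; rewrite -!mulmxA => /(congr1 (mulmx (invmx Gm))).
    by rewrite mulKmx // mulmx1.
  have Xg i : rep_at R g *m X i *m rep_at R (invmx g) = \sum_k a i k *: X k.
    rewrite -(drep_conj char0 G_group R_mul) //; last exact: BS.
    have -> : g *m vec_mx (row i B) *m invmx g = vec_mx (row i a *m B).
      by rewrite -row_mul -Ma rowK mxvecK.
    by rewrite XE; apply: eq_bigr => k _; rewrite mxE.
  have : rep_at R g *m C *m rep_at R (invmx g) = C.
    have -> : rep_at R g *m C *m rep_at R (invmx g) =
        \sum_i \sum_j (invmx Gm) i j *: ((\sum_k a i k *: X k) *m (\sum_l a j l *: X l)).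
      rewrite mulmx_sumr mulmx_suml; apply: eq_bigr => i _.
      rewrite mulmx_sumr mulmx_suml; apply: eq_bigr => j _.
      rewrite -scalemxAr -scalemxAl -!Xg; congr (_ *: _); rewrite !mulmxA.
      by rewrite -[_ *m rep_at R (invmx g) *m rep_at R g]mulmxA repVK // mulmx1.
    rewrite /C -{2}aGV.
    under eq_bigr => i _ do under eq_bigr => j _ do
      (rewrite mulmx_suml scaler_sumr;
       under eq_bigr => k _ do rewrite mulmx_sumr scaler_sumr).
    transitivity (\sum_i \sum_j \sum_k \sum_l (a i k * invmx Gm i j * a j l) *: (X k *m X l)).
      apply: eq_bigr => i _; apply: eq_bigr => j _; apply: eq_bigr => k _.
      apply: eq_bigr => l _; rewrite -scalemxAl -scalemxAr !scalerA; congr (_ *: _).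
      by rewrite [a i k * _]mulrC.
    transitivity (\sum_k \sum_l (\sum_i \sum_j a i k * invmx Gm i j * a j l) *: (X k *m X l)).
      under [RHS]eq_bigr => k _ do under eq_bigr => l _ do rewrite scaler_suml.
      under [RHS]eq_bigr => k _ do rewrite exchange_big.
      rewrite [RHS]exchange_big; apply: eq_bigr => i _.
      under [RHS]eq_bigr => k _ do under eq_bigr => l _ do rewrite scaler_suml.
      under [RHS]eq_bigr => k _ do rewrite exchange_big.
      by rewrite [RHS]exchange_big.
    apply: eq_bigr => k _; apply: eq_bigr => l _; congr (_ *: _).
    rewrite mxE exchange_big; apply: eq_bigr => j _; rewrite mxE mulr_suml.
    by apply: eq_bigr => i _; rewrite mxE.
  move/(congr1 (mulmx^~ (rep_at R g))) => /=.
  by rewrite -mulmxA repVK // mulmx1.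
- have [y [z [Ty Oz ->]]] := S_decomposition Su.
  suff -> : z = 0 by rewrite addr0.
  move/BE: Oz => /submxP[w ->].
  have -> : w = 0 by apply/rowP => i; have := ltn_ord i; rewrite [X in (_ < X)%N]rL0.
  by rewrite mul0mx.
Qed.

(** Induction on the dimension: the Fitting component of the Casimir operator
    for the eigenvalue 0 is a smaller representation, unless the Casimir
    operator is nilpotent, when the representation is trivial. *)
Lemma reynolds_step : (forall m', (m' < m)%N -> forall R' : 'I_m' -> 'I_m' -> A,
    multiplicative_rep G R' -> rep_at R' 1%:M = 1%:M ->
    exists e, combination_of_group G R' 1 e /\
      forall g, G g -> rep_at R' g *m e = e /\ e *m rep_at R' g = e) ->
  exists e, combination_of_group G R 1 e /\
    forall g, G g -> rep_at R g *m e = e /\ e *m rep_at R g = e.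
Proof.
move=> IH; have [C [d [C0 trC Ccom d0]]] := casimir.
have [E [N [s [EE Eid [k CE]]]]] := fitting C.
have E1 : combination_of_group G R 1 E.
  have -> : 1 = 1 + \sum_(k < N) s k * 0 :> K.
    by rewrite big1 ?addr0 // => l _; rewrite mulr0.
  rewrite EE; apply: combination_groupD.
    by rewrite -[1 in X in _ X]R_unit; apply: combination_group_rep; exact: group1.
  apply: combination_group_sum => l; apply: combination_groupZ.
  elim: {l}(nat_of_ord l) => [|l IHl]; first by rewrite expr1.
  by rewrite exprS -[0](mulr0 (0 : K)); apply: combination_groupM.
have Ecom g : G g -> rep_at R g *m E = E *m rep_at R g.
  move=> Gg; rewrite EE mulmxDr mulmxDl mulmx1 mul1mx; congr (_ + _).
  rewrite mulmx_sumr mulmx_suml; apply: eq_bigr => l _.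
  rewrite -scalemxAr -scalemxAl; congr (_ *: _).
  elim: {l}(nat_of_ord l) => [|l IHl]; first by rewrite expr1 Ccom.
  by rewrite exprS -[C * _]/(C *m _) mulmxA Ccom // -!mulmxA IHl.
have [rE|rE] := ltnP (\rank E) m.
  have [rb [cb [rbcb cbrb]]] : exists (rb : 'M[K]_(\rank E, m)) (cb : 'M[K]_(m, \rank E)),
      rb *m cb = 1%:M /\ cb *m rb = E.
    by exists (row_base E), (col_base E); rewrite mulmx_base idempotent_base.
  pose R' i j : A := \sum_a \sum_b (rb i a * cb b j) *: R a b.
  have R'E g : rep_at R' g = rb *m rep_at R g *m cb.
    apply/matrixP => i j; rewrite mxE [RHS]mxE /R' /Defs.peval_mx raddf_sum /=.
    under eq_bigr => a _ do rewrite raddf_sum /=.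
    rewrite exchange_big; apply: eq_bigr => b _; rewrite [(rb *m _) i b]mxE mulr_suml.
    by apply: eq_bigr => a _ /=; rewrite mevalZ [rep_at R g a b]mxE mulrAC.
  have rbE : rb *m E = rb by rewrite -[X in rb *m X]cbrb mulmxA rbcb mul1mx.
  have Ecb : E *m cb = cb by rewrite -[X in X *m cb]cbrb -mulmxA rbcb mulmx1.
  have [||e' [[t [tG t1 e'E]] e'inv]] := IH _ rE R'.
  - move=> g h Gg Gh; transitivity (rb *m (rep_at R g *m E) *m rep_at R h *m cb).
      by rewrite R'E Ecom // mulmxA rbE R_mul // !mulmxA.
    by rewrite !R'E -[X in rep_at R g *m X]cbrb !mulmxA.
  - by rewrite R'E R_unit mulmx1.
  exists (cb *m e' *m rb); split.
    have -> : cb *m e' *m rb = E *m (\sum_(z <- t) z.1 *: rep_at R z.2) *m E.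
      rewrite e'E mulmx_sumr !mulmx_suml mulmx_sumr mulmx_suml; apply: eq_bigr => z _.
      rewrite R'E -!scalemxAr -!scalemxAl; congr (_ *: _).
      by rewrite !mulmxA cbrb -[_ *m cb *m rb]mulmxA cbrb.
    rewrite -[1 : K]mulr1; apply: combination_groupM => //.
    rewrite -[1 : K]mul1r; apply: combination_groupM => //.
    by exists t.
  move=> g Gg; have [e'l e'r] := e'inv g Gg; split.
    have -> : rep_at R g *m (cb *m e' *m rb) = cb *m (rep_at R' g *m e') *m rb.
      by rewrite R'E !mulmxA cbrb -Ecom // -[_ *m E *m cb]mulmxA Ecb.
    by rewrite e'l.
  have -> : cb *m e' *m rb *m rep_at R g = cb *m (e' *m rep_at R' g) *m rb.
    rewrite R'E !mulmxA -[_ *m cb *m rb]mulmxA cbrb -[_ *m rep_at R g *m E]mulmxA Ecom //.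
    by rewrite mulmxA -[_ *m rb *m E]mulmxA rbE.
  by rewrite e'r.
have E_1 : E = 1%:M.
  have Eu : E \in unitmx by rewrite -row_full_unit /row_full eqn_leq rank_leq_col.
  by rewrite -[LHS](mulKmx Eu) [E *m E]Eid mulVmx.
have Cnil : nilpotent_mx C by exists k; move: CE; rewrite E_1 -[_ * _]/(_ *m _) mulmx1.
have dd0 : d = 0%N.
  move: trC; rewrite (mxtrace_nilpotent Cnil) => /esym/eqP.
  by move/pcharf0P : char0 => -> /eqP.
have dR0 := drep_eq0_of_radical (d0 dd0).
exists 1%:M; split; first by rewrite -R_unit; apply: combination_group_rep; exact: group1.
move=> g Gg; rewrite (rep_constant char0 G_group G_connected R_mul dR0 Gg).
by rewrite R_unit mulmx1.
Qed.

End TraceForm.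

(** Linear reductivity: [e] is the projection onto the invariant vectors. It
    comes from the group algebra, with augmentation 1, so it will commute with
    multiplication by invariants. *)
Theorem reynolds m (R : 'I_m -> 'I_m -> A) :
  multiplicative_rep G R -> rep_at R 1%:M = 1%:M ->
  exists e, combination_of_group G R 1 e /\
    forall g, G g -> rep_at R g *m e = e /\ e *m rep_at R g = e.
Proof.
elim: {m}m.+1 {-2}m (ltnSn m) R => // N IHN m mN R R_mul R_unit.
apply: reynolds_step => // m' m'm; apply: IHN.
by rewrite (leq_trans m'm) // -ltnS.
Qed.

End LinearReductivity.

(** * Linear substitutions in polynomials *)

Section LinearSubstitution.
Variables (K : closedFieldType) (char0 : [pchar K] =i pred0) (m : nat).
Local Notation A := {mpoly K[m]}.

Definition pull (B : 'M[K]_m) (p : A) : A :=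
  p \mPo [tuple \sum_j B i j *: 'X_j | i < m].

Lemma peval_pull B p v : peval (pull B p) v = peval p (B *m v).
Proof.
rewrite /peval /pull comp_mpoly_meval; apply: meval_eq => i.
rewrite tnth_mktuple raddf_sum mxE; apply: eq_bigr => j _.
by rewrite /= mevalZ mevalXU.
Qed.

Lemma peval_ext (p q : A) : (forall v, peval p v = peval q v) -> p = q.
Proof.
move=> pq; apply: (mpoly_ext char0) => v.
have /= := pq (\col_i v i); rewrite /peval.
by rewrite !(meval_eq (v1 := fun i => (\col_i v i) i 0) (v2 := v)) // => i; rewrite mxE.
Qed.

Lemma pullD B p q : pull B (p + q) = pull B p + pull B q.
Proof. exact: comp_mpolyD. Qed.

Lemma pullZ B c p : pull B (c *: p) = c *: pull B p.
Proof. exact: comp_mpolyZ. Qed.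

Lemma pullM B p q : pull B (p * q) = pull B p * pull B q.
Proof. exact: (rmorphM (comp_mpoly _)). Qed.

Lemma pull1 B : pull B 1 = 1.
Proof. exact: comp_mpoly1. Qed.

Lemma pull_sum B (I : Type) (r : seq I) (P : pred I) F :
  pull B (\sum_(i <- r | P i) F i) = \sum_(i <- r | P i) pull B (F i).
Proof. exact: (raddf_sum (comp_mpoly _)). Qed.

Lemma pull_id p : pull 1%:M p = p.
Proof. by apply: peval_ext => v; rewrite peval_pull mul1mx. Qed.

Lemma pull_pull B C p : pull C (pull B p) = pull (B *m C) p.
Proof. by apply: peval_ext => v; rewrite !peval_pull mulmxA. Qed.

Lemma msizeM_leS (p q : A) k l :
  (msize p <= k.+1 -> msize q <= l.+1 -> msize (p * q) <= (k + l).+1)%N.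
Proof.
have [->|p0] := eqVneq p 0; first by rewrite mul0r msize0.
have [->|q0] := eqVneq q 0; first by rewrite mulr0 msize0.
rewrite msizeM //; move: (msize p) (msize q) => a b; lia.
Qed.

Lemma msize_sum_le (I : Type) (r : seq I) (P : pred I) (F : I -> A) d :
  (forall i, P i -> msize (F i) <= d)%N -> (msize (\sum_(i <- r | P i) F i)%R <= d)%N.
Proof.
move=> Fd; apply: (big_ind (fun p => msize p <= d)%N) => [|p q pd qd|//].
  by rewrite msize0.
by apply: leq_trans (msizeD_le _ _) _; rewrite geq_max pd.
Qed.

Lemma msize_pull B p d : (msize p <= d -> msize (pull B p) <= d)%N.
Proof.
move=> pd; rewrite /pull (comp_mpolywE _ pd); apply: msize_sum_le => a _.
apply: leq_trans (msizeZ_le _ _) _; apply: leq_trans (bmdeg a).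
rewrite mdegE; apply: (big_ind2 (fun (q : A) e => msize q <= e.+1)%N).
- by rewrite msize1.
- by move=> q k r l; exact: msizeM_leS.
move=> i _; rewrite tnth_mktuple; elim: (bmnm a i) => [|l IHl].
  by rewrite expr0 msize1.
rewrite exprS -add1n; apply: (msizeM_leS (k := 1) _ IHl).
apply: msize_sum_le => j _; apply: leq_trans (msizeZ_le _ _) _.
by rewrite msizeX mdeg1.
Qed.

End LinearSubstitution.

(** * The Reynolds operator *)

Section ReynoldsOperator.
Variables (K : closedFieldType) (char0 : [pchar K] =i pred0) (n m : nat).
Variables (G : set 'M[K]_n) (rho : 'M[K]_n -> 'M[K]_m).
Hypothesis G_group : algebraic_group G.
Hypothesis G_nochar : no_nontrivial_characters G.
Hypothesis V_rep : rational_representation G rho.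
Local Notation A := {mpoly K[m]}.

Lemma rho1 : rho 1%:M = 1%:M.
Proof.
have [U M _] := V_rep; have G1 := group1 G_group.
by rewrite -[LHS](mulKmx (U _ G1)) -M // mul1mx mulVmx // U.
Qed.

Lemma rhoM g h : G g -> G h -> rho (g *m h) = rho g *m rho h.
Proof. by case: V_rep => _ + _; apply. Qed.

Lemma rho_polynomial : exists R0, forall g, G g -> rho g = rep_at R0 g.
Proof.
have [_ _ reg] := V_rep.
have /choice[R0 R0P] : forall i, exists r : 'I_m -> {mpoly K[n * n]},
    forall j g, G g -> rho g i j = peval_mx (r j) g.
  move=> i; suff /choice[r rP] : forall j, exists p, forall g, G g -> rho g i j = peval_mx p g.
    by exists r.
  move=> j; have [p [k pE]] := reg i j; exists p => g Gg.
  by rewrite pE // (group_det1 G_group G_nochar) // expr1n divr1.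
by exists R0 => g Gg; apply/matrixP => i j; rewrite mxE R0P.
Qed.

Lemma pull_group g h p : G g -> G h -> pull (rho h) (pull (rho g) p) = pull (rho (g *m h)) p.
Proof. by move=> Gg Gh; rewrite rhoM // (pull_pull char0). Qed.

Lemma pull_groupK g p : G g -> pull (rho (invmx g)) (pull (rho g) p) = p.
Proof.
move=> Gg; rewrite pull_group ?(mulmx_groupV G_group) //; last exact: groupV.
by rewrite rho1 (pull_id char0).
Qed.

Lemma pull_groupVK g p : G g -> pull (rho g) (pull (rho (invmx g)) p) = p.
Proof.
move=> Gg; rewrite pull_group ?(mulmx_Vgroup G_group) //; last exact: groupV.
by rewrite rho1 (pull_id char0).
Qed.

Lemma invariantsP p : invariants G rho p <-> forall g, G g -> pull (rho g) p = p.
Proof.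
split=> ip g; first by move=> Gg; apply: (peval_ext char0) => v; rewrite peval_pull ip.
by move=> v Gg; rewrite -peval_pull ip.
Qed.

Lemma polyfun_pull_coef (R0 : 'I_m -> 'I_m -> {mpoly K[n * n]}) p a :
  polyfun (fun g => (pull (rep_at R0 g) p)@_a).
Proof.
elim/mpoly_generated: p a => [c|i|p q IHp IHq|p q IHp IHq] a.
- by apply: polyfun_eq (polyfun_const _ (c%:MP@_a)) => g; rewrite /pull comp_mpolyC.
- apply: (@polyfun_eq _ _ (fun g => \sum_j (rep_at R0 g i j) * 'X_j@_a)) => [g|].
    rewrite /pull comp_mpolyXU -tnth_nth tnth_mktuple raddf_sum.
    by apply: eq_bigr => j _; rewrite /= mcoeffZ.
  apply: polyfun_sum => j _; apply: polyfunM (polyfun_const _ _).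
  by apply: polyfun_eq (polyfun_peval (R0 i j)) => g; rewrite mxE.
- by apply: polyfun_eq (polyfunD (IHp a) (IHq a)) => g; rewrite pullD mcoeffD.
- apply: (polyfun_eq (fun g => esym (congr1 (mcoeff a) (pullM _ p q)))).
  apply: (polyfun_eq (fun g => esym (mcoeffM _ _ a))).
  by apply: polyfun_sum => k _; apply: polyfunM.
Qed.

Section BoundedDegree.
Variable d : nat.
Local Notation N := #|{: 'X_{1..m < d}}|.
Local Notation mon i := (bmnm (enum_val i : 'X_{1..m < d})).

(** Polynomials of degree below [d], as row vectors on which substitutions act
    by matrices; as functions of the group element these are polynomial. *)
Definition coef_row (p : A) : 'rV[K]_N := \row_i p@_(mon i).

Lemma coef_row_inj p q : (msize p <= d)%N -> (msize q <= d)%N ->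
  coef_row p = coef_row q -> p = q.
Proof.
move=> pd qd /rowP pq; rewrite (mpolywE pd) (mpolywE qd).
by apply: eq_bigr => a _; have := pq (enum_rank a); rewrite !mxE enum_rankK => ->.
Qed.

Definition pull_mx (B : 'M[K]_m) : 'M[K]_N :=
  \matrix_(i, j) (pull B 'X_[mon i])@_(mon j).

Lemma coef_row_pull B p : (msize p <= d)%N ->
  coef_row (pull B p) = coef_row p *m pull_mx B.
Proof.
move=> pd; apply/rowP => j; rewrite [LHS]mxE [RHS]mxE [in LHS](mpolywE pd).
rewrite pull_sum raddf_sum /= (reindex (fun i : 'I_N => enum_val i)) /=; last first.
  by exists enum_rank => i _; rewrite ?enum_rankK ?enum_valK.
by apply: eq_bigr => i _; rewrite pullZ mcoeffZ !mxE.
Qed.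

End BoundedDegree.

Definition average (s : seq (K * 'M[K]_n)) (p : A) : A :=
  \sum_(z <- s) z.1 *: pull (rho z.2) p.

Hypothesis G_connected : connected_set (@closed_mx K n) G.
Hypothesis G_reductive : reductive G.

(** A fixed combination of translations: it commutes with multiplication by
    invariants, and preserves every [G]-stable ideal. *)
Theorem reynolds_operator d : exists s : seq (K * 'M[K]_n),
  [/\ forall z, z \in s -> G z.2, \sum_(z <- s) z.1 = 1 &
      forall p, (msize p <= d)%N -> invariants G rho (average s p)].
Proof.
have [R0 R0E] := rho_polynomial.
have /choice[S SP] : forall i, exists r : 'I__ -> {mpoly K[n * n]},
    forall j g, pull_mx d (rep_at R0 g) i j = peval_mx (r j) g.
  move=> i; suff /choice[r rP] : forall j, exists p, forall g,
      pull_mx d (rep_at R0 g) i j = peval_mx p g by exists r.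
  move=> j; have [p pE] := polyfun_pull_coef R0 'X_[bmnm (enum_val i : 'X_{1..m < d})]
    (bmnm (enum_val j : 'X_{1..m < d})).
  by exists p => g; rewrite mxE.
have SE g : G g -> rep_at S g = pull_mx d (rho g).
  by move=> Gg; apply/matrixP => i j; rewrite R0E // SP mxE.
have bnd (i : 'I_#|{: 'X_{1..m < d}}|) : (msize ('X_[bmnm (enum_val i : 'X_{1..m < d})] : A) <= d)%N.
  by rewrite msizeX; apply: bmdeg.
have rowX i : coef_row d 'X_[bmnm (enum_val i : 'X_{1..m < d})] = delta_mx 0 i :> 'rV[K]_ _.
  apply/rowP => j; rewrite !mxE mcoeffX eqxx /=; congr (_ (nat_of_bool _)).
  by apply/eqP/eqP => [/val_inj/enum_val_inj ->|->].
have tauE B i : row i (pull_mx d B) = coef_row d (pull B 'X_[bmnm (enum_val i : 'X_{1..m < d})]).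
  by rewrite coef_row_pull // rowX -rowE.
have [||e [[s [sG s1 eE]] eP]] := @reynolds K char0 n G G_group G_nochar G_connected G_reductive _ S.
- move=> g h Gg Gh; rewrite !SE ?(groupM G_group) //; last exact: groupM.
  apply/row_matrixP => i; rewrite row_mul !tauE -coef_row_pull ?msize_pull //.
  by rewrite pull_group.
- rewrite SE; last exact: group1.
  by apply/row_matrixP => i; rewrite tauE rho1 (pull_id char0) rowX row1.
exists s; split=> // p pd; apply/invariantsP => g Gg.
have avd : (msize (average s p) <= d)%N.
  by apply: msize_sum_le => z _; apply: leq_trans (msizeZ_le _ _) _; apply: msize_pull.
have avE : coef_row d (average s p) = coef_row d p *m e.
  rewrite eE mulmx_sumr; apply/rowP => j; rewrite mxE raddf_sum summxE.
  rewrite !big_seq; apply: eq_bigr => z /sG Gz.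
  by rewrite /= -scalemxAr [RHS]mxE mcoeffZ SE // -coef_row_pull // mxE.
apply: (coef_row_inj (d := d)) => //; first exact: msize_pull.
rewrite coef_row_pull // avE -mulmxA -SE //.
by have [_ ->] := eP _ Gg.
Qed.

End ReynoldsOperator.

(** * The quotient map *)

Section QuotientMap.
Variables (K : closedFieldType) (char0 : [pchar K] =i pred0) (n m : nat).
Variables (G : set 'M[K]_n) (rho : 'M[K]_n -> 'M[K]_m).
Hypothesis G_group : algebraic_group G.
Hypothesis G_connected : connected_set (@closed_mx K n) G.
Hypothesis G_reductive : reductive G.
Hypothesis G_nochar : no_nontrivial_characters G.
Hypothesis V_rep : rational_representation G rho.
Local Notation A := {mpoly K[m]}.
Local Notation inv := (invariants G rho).
Local Notation pi := (@git_pi K n m G rho).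

Lemma weak_nullstellensatz_cV (I : A -> Prop) : ideal I -> ~ I 1 ->
  exists v, forall p, I p -> peval p v = 0.
Proof.
move=> idI I1; have [v vP] := weak_nullstellensatz char0 idI I1.
exists (\col_i v i) => p /vP <-; rewrite /peval.
by apply: meval_eq => i; rewrite mxE.
Qed.

Lemma invariantsM p q : inv p -> inv q -> inv (p * q).
Proof.
move=> /(invariantsP char0) ip /(invariantsP char0) iq; apply/(invariantsP char0) => g Gg.
by rewrite pullM ip // iq.
Qed.

Lemma average_mull s p q : (forall z, z \in s -> G z.2) -> inv p ->
  average rho s (p * q) = p * average rho s q.
Proof.
move=> sG /(invariantsP char0) ip; rewrite /average mulr_sumr !big_seq.
by apply: eq_bigr => z /sG Gz; rewrite pullM ip // scalerAr.
Qed.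

Lemma averageD s p q : average rho s (p + q) = average rho s p + average rho s q.
Proof. by rewrite /average -big_split; apply: eq_bigr => z _; rewrite pullD scalerDr. Qed.

Lemma average_sum s (I : Type) (r : seq I) F :
  average rho s (\sum_(i <- r) F i) = \sum_(i <- r) average rho s (F i).
Proof.
rewrite /average exchange_big; apply: eq_bigr => z _ /=.
by rewrite pull_sum scaler_sumr.
Qed.

Lemma average1 s : \sum_(z <- s) z.1 = 1 -> average rho s 1 = 1.
Proof.
move=> s1; rewrite /average (eq_bigr (fun z => z.1 *: 1)); last by move=> z _; rewrite pull1.
by rewrite -scaler_suml s1 scale1r.
Qed.

Lemma git_ext (x y : git_quotient G rho) : sval x = sval y -> x = y.
Proof. by move: x y => [I Im] [J Jm] /= IJ; subst J; congr exist; exact: Prop_irrelevance. Qed.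

Lemma git_pi_eq v w : pi v = pi w -> forall p, inv p -> peval p v = peval p w.
Proof.
move=> /(congr1 sval) /= vw p ip; apply/eqP; rewrite -subr_eq0; apply/eqP.
have: (inv `&` [set f | peval f w = 0])%classic (p - (peval p w)%:MP).
  split; last by rewrite /= /peval mevalB mevalC subrr.
  by move=> g u Gg; rewrite /peval !mevalB !mevalC; congr (_ - _); exact: ip.
have -> : (inv `&` [set f | peval f w = 0] = [set f | inv f /\ peval f w = 0])%classic by [].
by rewrite -vw => -[_]; rewrite /peval mevalB mevalC.
Qed.

Lemma git_pi_orbit g v : G g -> pi (rho g *m v) = pi v.
Proof.
move=> Gg; apply: git_ext => /=; apply/seteqP; split=> p [ip] /= pv; split=> //.
  by rewrite -(ip g).
by rewrite ip.
Qed.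

(** A maximal ideal of the invariants generates a proper ideal of polynomials:
    averaging an expression of 1 would put 1 into the maximal ideal. *)
Theorem git_pi_surjective x : exists v, pi v = x.
Proof.
have [I [idI I1 Imax] xE] : exists2 I, maximal_ideal inv I & I = sval x by exists (sval x) => //; exact: svalP.
have [IA I0 ID IM] := idI.
pose J p := exists r : seq (A * A), (forall z, z \in r -> I z.1) /\ p = \sum_(z <- r) z.1 * z.2.
have idJ : ideal J.
  split=> [|p q [r [rI ->]] [s [sI ->]]|p q [r [rI ->]]].
  - by exists [::]; rewrite big_nil.
  - exists (r ++ s); rewrite big_cat; split=> // z.
    by rewrite mem_cat => /orP[/rI|/sI].
  - exists [seq (z.1, p * z.2) | z <- r]; split=> [_ /mapP[z /rI Iz ->] //|].
    by rewrite big_map mulr_sumr; apply: eq_bigr => z _; rewrite mulrCA.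
have [|v vP] := weak_nullstellensatz_cV idJ.
  move=> [r [rI r1]]; apply: I1.
  pose d := (\max_(z <- r) msize z.2)%N.
  have [s [sG s1 sinv]] := reynolds_operator char0 G_group G_nochar V_rep G_connected G_reductive d.
  rewrite -(average1 s1) r1 average_sum big_seq.
  apply: (big_ind I) => // z zr; rewrite average_mull //; last exact/IA/rI.
  rewrite mulrC; apply: IM; last exact: rI.
  by apply: sinv; rewrite /d; exact: leq_bigmax_seq.
exists v; apply: git_ext; rewrite -xE; have [idv v1 _] := maximal_ideal_at G rho v.
apply: Imax => // p Ip; split; first exact: IA.
apply: vP; exists [:: (p, 1)]; rewrite big_seq1 mulr1; split=> // z.
by rewrite inE => /eqP ->.
Qed.

Lemma closure_of_cV X v : closure_of (@closed_cV K m) X v <->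
  forall p, (forall w, X w -> peval p w = 0) -> peval p v = 0.
Proof.
split=> [cv p pX|cv C [S ->] XS p Sp].
  apply: (cv [set w | forall f, [set p]%classic f -> peval f w = 0]%classic _ _ p) => //.
    by exists [set p]%classic.
  by move=> w Xw f ->; exact: pX.
by apply: cv => w /XS; apply.
Qed.

Lemma orbit_of_self v : orbit_of G rho v v.
Proof. by exists 1%:M; [exact: group1|rewrite (rho1 G_group V_rep) mul1mx]. Qed.

Lemma orbit_of_translate g v w : G g -> orbit_of G rho v w -> orbit_of G rho v (rho g *m w).
Proof.
move=> Gg [h Gh ->]; exists (g *m h); first exact: groupM.
by rewrite (rhoM V_rep) // mulmxA.
Qed.

Lemma orbit_of_sym v w : orbit_of G rho v w -> orbit_of G rho w v.
Proof.
move=> [g Gg ->]; exists (invmx g); first exact: groupV.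
rewrite mulmxA -(rhoM V_rep) //; last exact: groupV.
by rewrite (mulmx_Vgroup G_group) // (rho1 G_group V_rep) mul1mx.
Qed.

Local Notation closure := (closure_of (@closed_cV K m)).

Lemma closure_orbit_translate g v w : G g ->
  closure (orbit_of G rho v) w -> closure (orbit_of G rho v) (rho g *m w).
Proof.
move=> Gg /closure_of_cV vw; apply/closure_of_cV => p pv; rewrite -peval_pull.
by apply: vw => u vu; rewrite peval_pull; apply/pv/orbit_of_translate.
Qed.

(** Disjoint closed [G]-stable sets are separated by an invariant: average a
    decomposition of 1 in the sum of their ideals. *)
Lemma closure_orbit_meet v w : pi v = pi w ->
  exists u, closure (orbit_of G rho v) u /\ closure (orbit_of G rho w) u.
Proof.
move=> vw.
pose I x (p : A) := forall y, orbit_of G rho x y -> peval p y = 0.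
have II x : ideal (I x).
  rewrite /I /peval; split=> [y _|p q Ip Iq y xy|p q Iq y xy].
  - by rewrite meval0.
  - by rewrite mevalD [X in X + _]Ip // [X in _ + X]Iq // addr0.
  - by rewrite mevalM [X in _ * X]Iq // mulr0.
have Iav x s p : (forall z, z \in s -> G z.2) -> I x p -> peval (average rho s p) x = 0.
  move=> sG Ip; rewrite /peval /average raddf_sum big_seq big1 // => z /sG Gz /=.
  rewrite mevalZ [X in _ * X](_ : _ = 0) ?mulr0 //.
  have := peval_pull (rho z.2) p x; rewrite /peval => ->.
  by apply: Ip; exists z.2.
pose J p := exists a b, [/\ I v a, I w b & p = a + b].
have [iv0 ivD ivM] := II v; have [iw0 iwD iwM] := II w.
have idJ : ideal J.
  split=> [|p q [a [b [Ia Ib ->]]] [a' [b' [Ia' Ib' ->]]]|p q [a [b [Ia Ib ->]]]].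
  - by exists 0, 0; rewrite addr0.
  - by exists (a + a'), (b + b'); split; [exact: ivD|exact: iwD|rewrite addrACA].
  - by exists (p * a), (p * b); split; [exact: ivM|exact: iwM|rewrite mulrDr].
have [|u uJ] := weak_nullstellensatz_cV idJ; last first.
  exists u; split; apply/closure_of_cV => p Ip; apply: uJ.
    by exists p, 0; rewrite addr0.
  by exists 0, p; rewrite add0r.
move=> [a [b [Ia Ib ab]]].
have [s [sG s1 sinv]] := reynolds_operator char0 G_group G_nochar V_rep G_connected G_reductive
  (msize a).
have := git_pi_eq vw (sinv a (leqnn _)); rewrite Iav //.
have : peval (average rho s (a + b)) w = 1 by rewrite -ab average1 // peval1.
rewrite averageD /peval mevalD [X in _ + X = _]Iav // addr0 => -> /eqP.
by rewrite eq_sym oner_eq0.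
Qed.

(** The closure of the orbit of [v] meets the orbit of [w], which is closed, so
    it contains [w]; by stability of [w] both orbits coincide. *)
Lemma stable_saturated v w : pi v = pi w -> stable_vectors G rho w -> stable_vectors G rho v.
Proof.
move=> vw [wcl wst]; suff vwE : orbit_of G rho v = orbit_of G rho w.
  rewrite /stable_vectors /= vwE; split=> // u uv; apply: wst.
  have : orbit_of G rho v w by rewrite vwE; exact: orbit_of_self.
  by move=> [g Gg ->]; exact: closure_orbit_translate.
have [u [vu wu]] := closure_orbit_meet vw.
have /orbit_of_sym[g Gg wE] : orbit_of G rho w u by apply: wu.
by apply: wst; rewrite wE; exact: closure_orbit_translate.
Qed.

End QuotientMap.

(** * Prime factors of invariants *)

Section SemiInvariants.
Variables (K : closedFieldType) (char0 : [pchar K] =i pred0) (n m : nat).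
Variables (G : set 'M[K]_n) (rho : 'M[K]_n -> 'M[K]_m).
Hypothesis G_group : algebraic_group G.
Hypothesis G_connected : connected_set (@closed_mx K n) G.
Hypothesis G_nochar : no_nontrivial_characters G.
Hypothesis V_rep : rational_representation G rho.
Local Notation A := {mpoly K[m]}.
Local Notation inv := (invariants G rho).

Lemma dvdr_factors (R : idomainType) (p x : R) ps : prime_elt p -> factors x ps -> dvdr p x ->
  exists2 q, q \in ps & dvdr p q.
Proof.
move=> pp [_ [u u1 ->]]; have [_ p1 pM] := pp.
by case/pM => [pu|/(prime_elt_dvd_prod pp)//]; case: p1; exact: dvdr_trans pu u1.
Qed.

Lemma mpoly_unit_const (u : A) : dvdr u 1 -> exists2 c, c != 0 & u = c%:MP.
Proof.
move=> [v uv]; apply/msize_poly1P/eqP.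
have /eqP : v * u != 0 by rewrite -uv oner_eq0.
move/eqP; rewrite mulf_eq0 => /norP[v0 u0].
have := congr1 (fun p : A => msize p) uv; rewrite /= msize1 msizeM //.
by move: v0 u0; rewrite -!msize_poly_eq0; move: (msize v) (msize u) => a b; lia.
Qed.

Lemma dvdr_pull B (p q : A) : dvdr p q -> dvdr (pull B p) (pull B q).
Proof. by move=> [z ->]; exists (pull B z); rewrite pullM. Qed.

Lemma dvdr_pull_group g (p q : A) : G g ->
  dvdr (pull (rho g) p) q -> dvdr p (pull (rho (invmx g)) q).
Proof.
by move=> Gg /(dvdr_pull (rho (invmx g))); rewrite (pull_groupK char0 G_group V_rep).
Qed.

Lemma prime_elt_pull g (p : A) : G g -> prime_elt p -> prime_elt (pull (rho g) p).
Proof.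
move=> Gg [p0 p1 pM]; have pullK q := pull_groupK char0 G_group V_rep q Gg.
have pullVK q := pull_groupVK char0 G_group V_rep q Gg.
split=> [||x y].
- apply/eqP => pE; move: p0; rewrite -(pullK p) pE.
  by rewrite [pull _ 0]comp_mpoly0 eqxx.
- by move=> /(dvdr_pull_group Gg); rewrite pull1.
- move=> /(dvdr_pull_group Gg); rewrite pullM => /pM[] /(dvdr_pull (rho g)).
    by rewrite pullVK; left.
  by rewrite pullVK; right.
Qed.

Lemma closed_mxU X Y : closed_mx X -> closed_mx Y -> closed_mx (X `|` Y : set 'M[K]_n)%classic.
Proof.
move=> [S ->] [T ->].
exists (fun r => exists p q, [/\ S p, T q & r = p * q]).
apply/seteqP; split=> g /=.
  by case=> [Sg|Tg] _ [p [q [Sp Tq ->]]]; rewrite /peval_mx mevalM;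
    [rewrite [X in X * _]Sg ?mul0r|rewrite [X in _ * X]Tg ?mulr0].
move=> ST; apply: contrapT => /not_orP[/existsNP[p /not_implyP[Sp p0]]].
move=> /existsNP[q /not_implyP[Tq /eqP q0]].
have /eqP := ST (p * q) (ex_intro _ p (ex_intro _ q (And3 Sp Tq erefl))).
by rewrite /peval_mx mevalM mulf_eq0 => /orP[/eqP //|]; apply/negP.
Qed.

Lemma closed_mx_list (I : eqType) (r : seq I) (X : I -> set 'M[K]_n) :
  (forall i, i \in r -> closed_mx (X i)) ->
  closed_mx [set g | exists2 i, i \in r & X i g]%classic.
Proof.
elim: r => [|i r IHr] Xcl.
  exists [set 1]%classic; apply/seteqP; split=> [g [] //|g /(_ _ erefl)].
  by rewrite /peval_mx rmorph1 => /eqP; rewrite oner_eq0.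
rewrite (_ : mkset _ = X i `|` [set g | exists2 i, i \in r & X i g])%classic.
  apply: closed_mxU; first by apply: Xcl; rewrite mem_head.
  by apply: IHr => j jr; apply: Xcl; rewrite inE jr orbT.
apply/seteqP; split=> g /=.
  by move=> [j]; rewrite inE => /orP[/eqP ->|jr Xj]; [left|right; exists j].
by case=> [Xi|[j jr Xj]]; [exists i; rewrite ?mem_head|exists j; rewrite // inE jr orbT].
Qed.

(** Proportionality is the vanishing of two-by-two minors of coefficients. *)
Lemma closed_mx_proportional (R0 : 'I_m -> 'I_m -> {mpoly K[n * n]}) (f p : A) : p != 0 ->
  closed_mx [set g | exists c, pull (rep_at R0 g) f = c *: p]%classic.
Proof.
move=> p0; pose c g a := (pull (rep_at R0 g) f)@_a.
exists (fun P => exists a b, forall g, peval_mx P g = c g a * p@_b - c g b * p@_a).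
apply/seteqP; split=> g /=.
  move=> [e gE] P [a [b ->]]; rewrite /c gE !mcoeffZ; ring.
move=> gP; have [b pb] : exists b, p@_b != 0 by exists (mlead p); rewrite mleadc_eq0.
exists (c g b / p@_b); apply/mpolyP => a; rewrite mcoeffZ mulrAC.
apply: (canRL (mulfK pb)); apply/eqP; rewrite -subr_eq0 -/(c g a).
have cP a' : polyfun (fun g => c g a') := polyfun_pull_coef R0 f a'.
have [P PE] := polyfunB (polyfunM (cP a) (polyfun_const _ p@_b))
  (polyfunM (cP b) (polyfun_const _ p@_a)).
by rewrite PE gP //; exists a, b => h; rewrite -PE.
Qed.

(** The translates of [f] are, up to scalars, among the finitely many prime
    factors of [F]; by connectedness they are all proportional to [f], and the
    factor of proportionality is a character. *)
Theorem prime_semi_invariant (f F : A) : prime_elt f -> F != 0 ->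
  (forall g, G g -> dvdr (pull (rho g) f) F) -> inv f.
Proof.
move=> pf F0 fF; have [f0 _ _] := pf.
have [R0 R0E] := rho_polynomial G_group G_nochar V_rep.
have [ps psF] := @factorial_mpoly K m F F0; have [psP _] := psF.
have pull0 g : G g -> pull (rep_at R0 g) f != 0.
  by move=> Gg; rewrite -R0E //; have [] := prime_elt_pull Gg pf.
pose prop (p : A) := [set g | exists c, pull (rep_at R0 g) f = c *: p]%classic.
pose other := [seq p <- ps | ~~ `[< exists c, p = c *: f >]].
have cover g : G g -> exists2 p, p \in ps & prop p g.
  move=> Gg; have pg := prime_elt_pull Gg pf.
  have [p pps gp] := dvdr_factors pg psF (fF g Gg); exists p => //.
  have [u /mpoly_unit_const[c c0 ->] pE] := prime_elt_associates pg (psP p pps) gp.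
  by exists c^-1; rewrite pE mul_mpolyC scalerA mulVf // scale1r R0E.
have [GX _] := G_connected; have G1 := group1 G_group.
have scal g : G g -> exists c, pull (rho g) f = c *: f.
  suff Gf : (G `<=` prop f)%classic by move=> Gg; have := Gf g Gg; rewrite R0E.
  have [_ conn] := G_connected.
  case: (conn (prop f) [set g | exists2 p, p \in other & prop p g]%classic) => //.
  - exact: closed_mx_proportional.
  - apply: closed_mx_list => p; rewrite mem_filter => /andP[_ /psP[p0 _ _]].
    exact: closed_mx_proportional.
  - move=> h Gh; have [p pps hp] := cover h Gh.
    have [[c pE]|nf] := pselect (exists c, p = c *: f); [left|right].
      by have [d hE] := hp; exists (d * c); rewrite -scalerA -pE.
    by exists p => //; rewrite mem_filter pps andbT; apply/asboolP.
  - apply/seteqP; split=> // h [[Gh [c hf]] [p]].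
    rewrite mem_filter => /andP[/asboolP nf _] [d hp]; apply: nf.
    have d0 : d != 0 by apply/eqP => d0; have := pull0 h Gh; rewrite hp d0 scale0r eqxx.
    by exists (d^-1 * c); rewrite -scalerA -hf hp scalerA mulVf // scale1r.
  - move=> Go; have [p] := Go _ G1; rewrite mem_filter => /andP[/asboolP nf _] [c].
    rewrite -R0E // (rho1 G_group V_rep) (pull_id char0) => fE; case: nf.
    have c0 : c != 0 by apply/eqP => c0; move: f0; rewrite fE c0 scale0r eqxx.
    by exists c^-1; rewrite fE scalerA mulVf // scale1r.
have [b fb] : exists b, f@_b != 0 by exists (mlead f); rewrite mleadc_eq0.
pose chi g := (pull (rep_at R0 g) f)@_b / f@_b.
have chiE g : G g -> pull (rho g) f = chi g *: f.
  move=> Gg; have [c cE] := scal g Gg.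
  by rewrite /chi -R0E // cE mcoeffZ mulfK.
apply/(invariantsP char0) => g Gg; rewrite chiE // (G_nochar _ Gg) ?scale1r //.
split=> [h Gh|h k Gh Gk|].
- apply/eqP => c0; have := pull0 h Gh.
  by rewrite -R0E // chiE // c0 scale0r eqxx.
- have := chiE (h *m k) (groupM G_group Gh Gk).
  rewrite -(pull_group char0 V_rep) // chiE // pullZ chiE // scalerA => /(congr1 (mcoeff b)).
  by rewrite !mcoeffZ => /(mulIf fb).
- have [P PE] := polyfunM (polyfun_pull_coef R0 f b) (polyfun_const _ (f@_b)^-1).
  by exists P, 0%N => h _; rewrite expr0 divr1 -PE.
Qed.

Lemma invariants_prime_factor (f F : A) : prime_elt f -> F != 0 -> dvdr f F -> inv F -> inv f.
Proof.
move=> pf F0 fF /(invariantsP char0) iF; apply: (prime_semi_invariant pf F0) => g Gg.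
by rewrite -(iF g Gg); exact: dvdr_pull.
Qed.

Lemma invariants_quotient (f q : A) : f != 0 -> inv f -> inv (q * f) -> inv q.
Proof.
move=> f0 /(invariantsP char0) iF /(invariantsP char0) iqf; apply/(invariantsP char0) => g Gg.
by apply: (mulIf f0); rewrite -[in LHS](iF g Gg) -pullM iqf.
Qed.

End SemiInvariants.

(** * Hypersurfaces in an affine space and in its quotient *)

Local Open Scope classical_set_scope.

Section Topology.
Variables (T : Type) (cl : set (set T)).

(** By Zorn's lemma, since the union of a chain of irreducible sets is
    irreducible. *)
Lemma exists_irreducible_component (X : set T) x : X x ->
  exists2 C, irreducible_component cl X C & C x.
Proof.
move=> Xx; pose splits D := forall A B, cl A -> cl B -> D `<=` A `|` B -> D `<=` A \/ D `<=` B.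
(* The empty set is allowed, for the sake of the empty chain. *)
pose P := [set D | [/\ D `<=` X, forall y, D y -> D x & splits D]].
have P1 : P [set x].
  split=> [_ -> //|_ _ //|A B _ _ /(_ x erefl)[]]; first by left=> _ ->.
  by right=> _ ->.
have [|C [[CX Cx Csplit] Cmax]] := @Zorn_bigcup T P.
  move=> F FP Ftot; split=> [y [D /FP[DX _ _]]|y [D FD Dy]|A B clA clB FAB].
  - exact: DX.
  - by exists D => //; have [_ /(_ _ Dy)] := FP D FD.
  apply: contrapT => /not_orP[/existsNP[a /not_implyP[[D FD Da] Aa]]].
  move=> /existsNP[b /not_implyP[[E FE Eb] Bb]].
  have key M : F M -> M a -> M b -> False.
    move=> FM Ma Mb; have [_ _ /(_ A B clA clB)] := FP M FM.
    by case=> [y My|/(_ a Ma)//|/(_ b Mb)//]; apply: FAB; exists M.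
  by case: (Ftot D E FD FE) => [/(_ a Da) Ea|/(_ b Eb) Db]; [apply: (key E)|apply: (key D)].
have {Cx}Cx : C x.
  apply: contrapT => nCx; apply: (Cmax [set x]) => //; split=> [y /Cx //|/(_ x erefl)//].
exists C => //; split=> //; first by split; first by exists x.
move=> D DX [_ Dirr] CD; apply: contrapT => DC; apply: (Cmax D).
  by split=> // DC'; apply: DC; apply/seteqP.
by split=> // y _; apply: CD.
Qed.

End Topology.

(** What the affine space and its quotient have in common: a space [T] below
    the affine space, with closed sets cut out by the functions in [A]. The last
    two conditions transfer factorizations from the polynomial ring to [A]. *)
Record factorial_quotient (K : fieldType) (m : nat) (T : Type) (cl : set (set T))
    (phi : 'cV[K]_m -> T) (A : set {mpoly K[m]}) : Prop := FactorialQuotient {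
  fq_surjective : forall x, exists v, phi v = x;
  fq_closed : forall C, cl C <-> exists2 S, S `<=` A &
    forall v, C (phi v) <-> forall p, S p -> peval p v = 0;
  fq_fiber : forall v w, phi v = phi w -> forall p, A p -> peval p v = peval p w;
  fq_one : A 1;
  fq_mul : forall p q, A p -> A q -> A (p * q);
  fq_quotient : forall p q, p != 0 -> A p -> A (q * p) -> A q;
  fq_factor : forall p q, prime_elt p -> q != 0 -> dvdr p q -> A q -> A p }.

Section Hypersurfaces.
Variables (K : closedFieldType) (char0 : [pchar K]%R =i pred0) (m : nat).
Variables (T : Type) (cl : set (set T)) (phi : 'cV[K]_m -> T) (A : set {mpoly K[m]}).
Hypothesis quoA : factorial_quotient cl phi A.

Definition hypersurface (f : {mpoly K[m]}) : set T := phi @` [set v | peval f v = 0].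

Lemma hypersurfaceE f v : A f -> hypersurface f (phi v) <-> peval f v = 0.
Proof.
move=> Af; split=> [[w fw wv]|fv]; last by exists v.
by rewrite -(fq_fiber quoA wv Af).
Qed.

Lemma closed_hypersurface f : A f -> cl (hypersurface f).
Proof.
move=> Af; apply/(fq_closed quoA); exists [set f] => [_ -> //|v].
by rewrite (hypersurfaceE _ Af); split=> [fv _ ->|/(_ f erefl)].
Qed.

Lemma fq_ext (X Y : set T) : (forall v, X (phi v) <-> Y (phi v)) -> X = Y.
Proof.
by move=> XY; apply/seteqP; split=> x; have [v <-] := fq_surjective quoA x; move/XY.
Qed.

Lemma peval_mul (p q : {mpoly K[m]}) v : peval (p * q) v = peval p v * peval q v.
Proof. exact: mevalM. Qed.

Lemma prime_vanishing (f h : {mpoly K[m]}) : prime_elt f ->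
  (forall v, peval f v = 0 -> peval h v = 0) -> dvdr f h.
Proof.
move=> pf fh; apply: contrapT => nfh.
have [v [fv /eqP[]]] := nullstellensatz char0 (prime_elt_ideal pf) nfh.
have E p : peval p (\col_i v i) = p.@[v] by apply: meval_eq => i; rewrite mxE.
by rewrite -E; apply: fh; rewrite E; apply: fv; exists 1; rewrite mul1r.
Qed.

Lemma prime_point (f : {mpoly K[m]}) : prime_elt f -> exists v, peval f v = 0.
Proof.
move=> pf; apply: contrapT => nv; have [_ + _] := pf; apply.
by apply: (prime_vanishing pf) => v fv; case: nv; exists v.
Qed.

Lemma nonzero_point (f : {mpoly K[m]}) : f != 0 -> exists v, peval f v != 0.
Proof.
move=> f0; apply: contrapT => nv; case/eqP: f0; apply: (peval_ext char0) => v.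
have -> : peval 0 v = 0 :> K by exact: meval0.
by apply: contrapT => /eqP fv; apply: nv; exists v.
Qed.

Lemma irreducible_hypersurface f : A f -> prime_elt f -> irreducible_set cl (hypersurface f).
Proof.
move=> Af pf; split; first by have [v fv] := prime_point pf; exists (phi v), v.
move=> X Y /(fq_closed quoA)[S SA XS] /(fq_closed quoA)[S' SA' YS] fXY.
apply: contrapT => /not_orP[/existsNP[x /not_implyP[[v fv <-]]]].
move=> /XS/existsNP[p /not_implyP[Sp pv]].
move=> /existsNP[y /not_implyP[[w fw <-]]] /YS/existsNP[q /not_implyP[Sq qw]].
have [_ _ /(_ p q)] := pf; case.
- apply: prime_vanishing => // u fu; rewrite peval_mul; apply/eqP; rewrite mulf_eq0.
  have : hypersurface f (phi u) by exists u.
  by case/fXY => [/XS/(_ p Sp) ->|/YS/(_ q Sq) ->]; rewrite eqxx ?orbT.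
- by move=> [z pE]; apply: pv; rewrite pE peval_mul fv mulr0.
- by move=> [z qE]; apply: qw; rewrite qE peval_mul fw mulr0.
Qed.

Lemma irreducible_whole : irreducible_set cl setT.
Proof.
split; first by exists (phi 0).
move=> X Y /(fq_closed quoA)[S SA XS] /(fq_closed quoA)[S' SA' YS] XY.
apply: contrapT => /not_orP[/existsNP[x /not_implyP[_]]].
have [v <-] := fq_surjective quoA x; move=> /XS/existsNP[p /not_implyP[Sp pv]].
move=> /existsNP[y /not_implyP[_]].
have [w <-] := fq_surjective quoA y; move=> /YS/existsNP[q /not_implyP[Sq qw]].
have nz (r : {mpoly K[m]}) u : peval r u <> 0 -> r != 0.
  by move=> ru; apply/eqP => r0; apply: ru; rewrite r0; exact: meval0.
have [u] : exists u, peval (p * q) u != 0.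
  by apply: nonzero_point; apply: mulf_neq0; [exact: (nz _ v)|exact: (nz _ w)].
rewrite peval_mul mulf_eq0 => /norP[/eqP pu /eqP qu].
by case: (XY (phi u) I) => [/XS/(_ p Sp)|/YS/(_ q Sq)].
Qed.

Lemma closed_whole : cl setT.
Proof. by apply/(fq_closed quoA); exists set0. Qed.

Lemma hypersurface_proper f : A f -> f != 0 -> hypersurface f <> setT.
Proof.
move=> Af f0 fT; have [v /eqP[]] := nonzero_point f0.
by apply/(hypersurfaceE _ Af); rewrite fT.
Qed.

Lemma closed_proper_vanishing C : cl C -> C <> setT ->
  exists2 p, A p /\ p != 0 & C `<=` hypersurface p.
Proof.
move=> /(fq_closed quoA)[S SA CS] CT; apply: contrapT => np; apply: CT; apply: fq_ext => v.
split=> // _; apply/CS => p Sp; apply: contrapT => pv; apply: np; exists p.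
  by split; [exact: SA|apply/eqP => p0; apply: pv; rewrite p0; exact: meval0].
move=> x; have [w <-] := fq_surjective quoA x; move=> /CS/(_ p Sp) pw; by exists w.
Qed.

Lemma msize_prime (f : {mpoly K[m]}) : prime_elt f -> (1 < msize f)%N.
Proof.
move=> [f0 f1 _]; rewrite ltnNge; apply/negP => /msize1_polyC fE; apply: f1.
have c0 : f@_0 != 0 by apply/eqP => c0; move: f0; rewrite fE c0 mpolyC0 eqxx.
by exists (f@_0)^-1%:MP; rewrite [X in _ * X]fE -mpolyCM mulVf // mpolyC1.
Qed.

(** A nonzero function of least degree vanishing on [D] also vanishes on the
    hypersurface, so it is divisible by [f]. The quotient has smaller degree and
    cannot vanish on [D], so [f] does, [D] being irreducible. *)
Lemma hypersurface_maximal f D : A f -> prime_elt f ->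
  cl D -> irreducible_set cl D -> hypersurface f `<=` D -> D <> setT -> D `<=` hypersurface f.
Proof.
move=> Af pf clD [_ Dirr] fD DT; apply: contrapT => nDf.
have [|p [[Ap p0 Dp] pmin]] := @exists_minimal {mpoly K[m]}
   (fun p => [/\ A p, p != 0 & D `<=` hypersurface p]) (fun p => msize p).
  by have [p [Ap p0] Dp] := closed_proper_vanishing clD DT; exists p.
have [f0 _ _] := pf.
have [q pE] : dvdr f p.
  apply: (prime_vanishing pf) => v fv; apply/(hypersurfaceE _ Ap)/Dp/fD.
  by exists v.
have Aq : A q by apply: (fq_quotient quoA f0 Af); rewrite -pE.
have q0 : q != 0 by apply/eqP => q0; move: p0; rewrite pE q0 mul0r eqxx.
case: (Dirr (hypersurface q) (hypersurface f)) => //; try exact: closed_hypersurface.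
  move=> x /Dp[v pv <-]; move/eqP: pv; rewrite pE peval_mul mulf_eq0.
  by case/orP => /eqP; [left|right]; exists v.
move=> Dq; have := pmin q (And3 Aq q0 Dq); rewrite pE msizeM //.
have := msize_prime pf; have : (0 < msize q)%N by rewrite lt0n msize_poly_eq0.
move: (msize q) (msize f) => a b; lia.
Qed.

Lemma codim_hypersurface f : A f -> prime_elt f -> has_codim cl (hypersurface f) 1.
Proof.
move=> Af pf; have [f0 _ _] := pf.
have clf := closed_hypersurface Af; have irrf := irreducible_hypersurface Af pf.
split.
  exists (fun i => if i is 0%N then hypersurface f else setT); split=> // [[|i] _|[|i] //].
  - by [].
  - by split; [exact: closed_whole|exact: irreducible_whole].
  - by move=> _; split=> // Tf; apply: (hypersurface_proper Af f0); apply/seteqP.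
move=> [Z [Z0 Zirr Zlt]]; have [cl1 irr1] := Zirr 1%N isT.
have [Z01 nZ01] := Zlt 0%N isT; have [_ nZ12] := Zlt 1%N isT.
apply: nZ01; rewrite Z0; apply: hypersurface_maximal => //; first by rewrite -Z0.
by move=> Z1T; apply: nZ12; rewrite Z1T.
Qed.

Lemma hypersurface_prod_mem (ps : seq {mpoly K[m]}) v :
  peval (\prod_(p <- ps) p) v = 0 <-> exists2 p, p \in ps & peval p v = 0.
Proof.
have -> : peval (\prod_(p <- ps) p) v = \prod_(p <- ps) peval p v.
  exact: (rmorph_prod (meval (fun i => v i 0))).
split=> [/eqP|[p pps pv]].
  by rewrite prodf_seq_eq0 => /hasP[p pps /eqP pv]; exists p.
by apply/eqP; rewrite prodf_seq_eq0; apply/hasP; exists p => //; rewrite pv eqxx.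
Qed.

Lemma fq_prod ps : (forall p, p \in ps -> A p) -> A (\prod_(p <- ps) p).
Proof.
move=> psA; rewrite big_seq; apply: (big_ind A) => //; first exact: (fq_one quoA).
exact: (fq_mul quoA).
Qed.

Lemma irreducible_in_hypersurfaces ps X : (forall p, p \in ps -> A p) ->
  irreducible_set cl X -> X `<=` hypersurface (\prod_(p <- ps) p) ->
  exists2 p, p \in ps & X `<=` hypersurface p.
Proof.
move=> psA [[x Xx] Xirr]; elim: ps psA => [|p ps IHps] psA Xps.
  by have [v /hypersurface_prod_mem[]] := Xps x Xx.
have Ap : A p by apply: psA; rewrite mem_head.
have psA' q : q \in ps -> A q by move=> qps; apply: psA; rewrite inE qps orbT.
case: (Xirr (hypersurface p) (hypersurface (\prod_(q <- ps) q))).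
- exact: closed_hypersurface.
- exact/closed_hypersurface/fq_prod.
- move=> y /Xps[v + <-]; rewrite big_cons /= peval_mul => /eqP.
  by rewrite mulf_eq0 => /orP[] /eqP ?; [left|right]; exists v.
- by exists p; rewrite ?mem_head.
- by move=> /(IHps psA')[q qps Xq]; exists q; rewrite // inE qps orbT.
Qed.

(** Otherwise [X], the hypersurface and the whole space would be a chain of
    length two. *)
Lemma codim1_hypersurface X p : A p -> prime_elt p -> has_codim cl X 1 ->
  X `<=` hypersurface p -> X = hypersurface p.
Proof.
move=> Ap pp [[Z [Z0 Zirr _]] n2] Xp; apply: contrapT => nX; apply: n2.
have [p0 _ _] := pp.
exists (fun i => match i with 0%N => X | 1%N => hypersurface p | _ => setT end).
split=> // [[|[|i]] _|[|[|i]] // _].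
- by rewrite -Z0; apply: Zirr.
- by split; [exact: closed_hypersurface|exact: irreducible_hypersurface].
- by split; [exact: closed_whole|exact: irreducible_whole].
- by split=> // pX; apply: nX; apply/seteqP.
- by split=> // Tp; apply: (hypersurface_proper Ap p0); apply/seteqP.
Qed.

Definition prime_functions (ps : seq {mpoly K[m]}) : Prop :=
  forall p, p \in ps -> A p /\ prime_elt p.

(** A component of [X] lies in the hypersurface of a prime factor of any nonzero
    function vanishing on [X], and is equal to it. There are finitely many such
    prime factors, and the components cover [X]. *)
Theorem pure_codim1_hypersurface X : pure_of_codim cl 1 X -> X <> setT ->
  exists2 ps, prime_functions ps & X = hypersurface (\prod_(p <- ps) p).
Proof.
move=> [clX Xpure] XT; have [F [AF F0] XF] := closed_proper_vanishing clX XT.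
have [ps [psP [u u1 FE]]] := @factorial_mpoly K m F F0.
have psA p : p \in ps -> A p.
  move=> pps; apply: (fq_factor quoA (psP p pps) F0) => //.
  by rewrite FE; apply: dvdr_mull; exists (\prod_(q <- rem p ps) q); rewrite (big_rem p pps) /= mulrC.
pose qs := [seq p <- ps | `[< hypersurface p `<=` X >]].
exists qs => [p|].
  by rewrite mem_filter => /andP[_ pps]; split; [exact: psA|exact: psP].
apply/seteqP; split=> x.
  move=> Xx; have [D Dcomp Dx] := exists_irreducible_component cl Xx.
  have [DX Dirr _] := Dcomp; have Dcod := Xpure D Dcomp.
  have [|p pps Dp] := irreducible_in_hypersurfaces psA Dirr.
    move=> y /DX/XF[v Fv <-]; exists v => //; move/eqP: Fv; rewrite FE peval_mul mulf_eq0.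
    case/orP => /eqP // uv; case: u1 => z /(congr1 (fun q => peval q v)).
    by rewrite peval1 peval_mul uv mulr0 => /eqP; rewrite oner_eq0.
  have DE := codim1_hypersurface (psA p pps) (psP p pps) Dcod Dp.
  have := Dx; rewrite DE => -[v pv <-]; exists v => //; apply/hypersurface_prod_mem.
  by exists p => //; rewrite mem_filter pps andbT; apply/asboolP; rewrite -DE.
move=> [v /hypersurface_prod_mem[p + pv] <-].
by rewrite mem_filter => /andP[/asboolP pX _]; apply: pX; exists v.
Qed.

Theorem hypersurface_component ps C : prime_functions ps ->
  irreducible_component cl (hypersurface (\prod_(p <- ps) p)) C ->
  exists2 p, p \in ps & C = hypersurface p.
Proof.
move=> psP [CX Cirr Cmax].
have psA p : p \in ps -> A p by move=> /psP[].
have [p pps Cp] := irreducible_in_hypersurfaces psA Cirr CX.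
have [Ap pp] := psP p pps; exists p => //; apply/esym; apply: Cmax => //.
  by move=> _ [v pv <-]; exists v => //; apply/hypersurface_prod_mem; exists p.
exact: irreducible_hypersurface.
Qed.

Corollary hypersurface_pure ps : prime_functions ps ->
  pure_of_codim cl 1 (hypersurface (\prod_(p <- ps) p)).
Proof.
move=> psP; split; first by apply/closed_hypersurface/fq_prod => p /psP[].
by move=> C /(hypersurface_component psP)[p /psP[Ap pp] ->]; exact: codim_hypersurface.
Qed.

End Hypersurfaces.

(** * Stable loci of codimension one *)

Lemma affine_factorial_quotient (K : fieldType) (m : nat) :
  factorial_quotient (@closed_cV K m) id setT.
Proof.
split=> //; first by move=> v; exists v.
- move=> C; split=> [[S ->]|[S _ CS]]; first by exists S.
  by exists S; apply/seteqP; split=> v /CS.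
- by move=> v w ->.
Qed.

Section GITQuotient.
Variables (K : closedFieldType) (char0 : [pchar K]%R =i pred0) (n m : nat).
Variables (G : set 'M[K]_n) (rho : 'M[K]_n -> 'M[K]_m).
Hypothesis G_group : algebraic_group G.
Hypothesis G_connected : connected_set (@closed_mx K n) G.
Hypothesis G_reductive : reductive G.
Hypothesis G_nochar : no_nontrivial_characters G.
Hypothesis V_rep : rational_representation G rho.
Local Notation inv := (invariants G rho).
Local Notation pi := (@git_pi K n m G rho).
Local Notation sss := (sss G rho).

Lemma git_factorial_quotient :
  factorial_quotient (@closed_maxspec _ inv) pi inv.
Proof.
have surj := git_pi_surjective char0 G_group G_connected G_reductive G_nochar V_rep.
split.
- exact: surj.
- move=> C; split=> [[S SA ->]|[S SA CS]]; exists S => //.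
    move=> v; split=> [Sv p Sp|Sv p Sp]; first by have [] := Sv p Sp.
    by split; [exact: SA|exact: Sv].
  apply/seteqP; split=> x; have [v <-] := surj x.
    by move=> /CS vS p Sp; split; [exact: SA|exact: vS].
  by move=> vS; apply/CS => p /vS[].
- exact: git_pi_eq.
- by move=> g v _; rewrite !peval1.
- by move=> p q ip iq; exact: (invariantsM char0 ip iq).
- by move=> p q p0; exact: (invariants_quotient char0 p0).
- by move=> p q pp q0 pq; exact: (invariants_prime_factor char0 G_group G_connected G_nochar V_rep pp q0 pq).
Qed.

Lemma sss_saturated v w : pi v = pi w -> sss v -> sss w.
Proof.
move=> vw nv sw; apply: nv.
exact: (stable_saturated char0 G_group G_connected G_reductive G_nochar V_rep vw sw).
Qed.

Lemma image_sssE v : (pi @` sss) (pi v) <-> sss v.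
Proof. by split=> [[w sw /sss_saturated]|sv]; [exact|exists v]. Qed.

(** An invariant multiple of [p] is a multiple by an invariant. *)
Lemma git_hypersurface_principal p : inv p -> prime_elt p ->
  principal_divisor (hypersurface pi p).
Proof.
move=> Ip pp; have quo := git_factorial_quotient; split.
- exact: (closed_hypersurface quo).
- exact: (irreducible_hypersurface char0 quo).
- exact: (codim_hypersurface char0 quo).
exists p => // h; split=> [[Ih ph]|[q Iq ->]].
  have [q hE] : dvdr p h.
    apply: (prime_vanishing char0 pp) => v pv.
    by have [] := ph (pi v) (ex_intro2 _ _ v pv erefl).
  by exists q => //; have [p0 _ _] := pp; apply: (fq_quotient quo p0 Ip); rewrite -hE.
split; first exact: (fq_mul quo).
move=> x [v pv <-]; split; first exact: (fq_mul quo).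
by rewrite peval_mul pv mulr0.
Qed.

(** The primes cutting out the set of non-stable vectors are invariant: the set
    is [G]-stable, so all translates of these primes divide their product. *)
Lemma pure_sss_coprincipal : stable_representation G rho ->
  pure_of_codim (@closed_cV K m) 1 sss -> coprincipal G rho.
Proof.
move=> Vst sss_pure; have aff := affine_factorial_quotient K m.
have [ps psP sssE] : exists2 ps, prime_functions setT ps &
    sss = hypersurface id (\prod_(p <- ps) p).
  apply: (pure_codim1_hypersurface char0 aff) => // sssT.
  by have [v sv] := Vst; have : sss v by rewrite sssT.
have sssP v : sss v <-> peval (\prod_(p <- ps) p) v = 0.
  by rewrite sssE; apply: (hypersurfaceE aff).
have psI : prime_functions inv ps.
  move=> p pps; have [_ pp] := psP p pps; split=> //.
  apply: (prime_semi_invariant char0 G_group G_connected G_nochar V_rep pp (F := \prod_(p <- ps) p)).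
    by rewrite prodf_seq_neq0; apply/allP => q /psP[_ [q0 _ _]].
  move=> g Gg; apply: (prime_vanishing char0).
    exact: (prime_elt_pull char0 G_group V_rep).
  move=> v; rewrite peval_pull => pv; apply/sssP.
  apply: (sss_saturated (git_pi_orbit rho v Gg)); apply/sssP.
  by apply/hypersurface_prod_mem; exists p.
have imE p : pi @` hypersurface id p = hypersurface pi p.
  by rewrite /hypersurface image_comp.
split.
  split=> //; rewrite sssE imE; exact: (hypersurface_pure char0 git_factorial_quotient).
move=> Z; rewrite sssE => /(hypersurface_component char0 aff psP)[p /psI[Ip pp] ->].
by rewrite imE; exact: git_hypersurface_principal.
Qed.

(** The set of non-stable vectors is the full preimage of its image, so it has
    the same equation. *)
Lemma pure_representation_sss : pure_representation G rho ->
  pure_of_codim (@closed_cV K m) 1 sss.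
Proof.
move=> [Vst im_pure]; have quo := git_factorial_quotient.
have [ps psI imE] : exists2 ps, prime_functions inv ps &
    pi @` sss = hypersurface pi (\prod_(p <- ps) p).
  apply: (pure_codim1_hypersurface char0 quo) => // imT.
  by have [v sv] := Vst; have /image_sssE[] : (pi @` sss) (pi v) by rewrite imT.
have -> : sss = hypersurface id (\prod_(p <- ps) p).
  apply/seteqP; split=> v.
    move/image_sssE; rewrite imE => /(hypersurfaceE quo) pv; exists v => //; apply: pv.
    by apply: (fq_prod quo) => p /psI[].
  by move=> [w pw <-]; apply/image_sssE; rewrite imE; exists w.
apply: (hypersurface_pure char0 (affine_factorial_quotient K m)).
by move=> p /psI[].
Qed.

End GITQuotient.

Theorem lemma1p3 (K : closedFieldType) (char0 : ([pchar K]%R =i pred0))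
  (n m : nat) (G : set 'M[K]_n) (rho : 'M[K]_n -> 'M[K]_m)
  (G_group : algebraic_group G)
  (G_connected : connected_set (@closed_mx K n) G)
  (G_reductive : reductive G)
  (G_nochar : no_nontrivial_characters G)
  (V_rep : rational_representation G rho) :
  (stable_representation G rho ->
   pure_of_codim (@closed_cV K m) 1 (sss G rho) ->
   coprincipal G rho)
  /\ (pure_representation G rho -> coprincipal G rho).
Proof.
split; first exact: pure_sss_coprincipal.
move=> V_pure; have [V_stable _] := V_pure.
by apply: pure_sss_coprincipal => //; exact: pure_representation_sss.
Qed.
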